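(* Consider the R-Xi-row iteration defined in the context, under the network, problem and noise assumptions stated there. Let the gains be $$\lambda_k=\frac{c_\lambda}{(k+1)^p},\quad \gamma_k=\frac{c_\gamma}{(k+1)^q},\quad \alpha_k=\frac{c_\alpha}{(k+1)^a},\quad \beta_k=\frac{c_\beta}{(k+1)^b},$$ with constants $c_\lambda,c_\beta\in(0,1]$, $c_\gamma,c_\alpha>0$ and exponents satisfying $0<q<p<1$, $\frac12<b<a<1$, $a>2p-1$ and $2a-b>1$. Then, with $m=\min\{2(1-p),\,a-b,\,2b-a\}$, as $k\to\infty$, $$\mathbb E[F(\tilde x_k)-F(x^* )],\quad \mathbb E\big[\|\mathbf x_k-\mathbf 1\tilde x_k\|_A^2\big],\quad \mathbb E\big[\|\mathbf z_k-\mathbf 1\tilde z_k\|_A^2\big]\quad\text{are all } \mathcal O\big((k+1)^{-m}\big).$$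
   Context: Setting (scalar decision variable). There are $n$ agents, $\mathcal V=\{1,\dots,n\}$, with functions $f_i:\mathbb R\to\mathbb R$, $F(x)=\frac1n\sum_{i=1}^n f_i(x)$, and $x^*$ denotes the minimizer of $F$. Network assumption: $W=[W_{ij}]\in\mathbb R^{n\times n}$ is a primitive nonnegative matrix with $W\mathbf 1=\mathbf 1$; here $W_{ij}\in(0,1)$ if $j=i$ or $j$ is an in-neighbor of $i$ in the communication digraph, and $W_{ij}=0$ otherwise. Let $\mathbf r=(r_1,\dots,r_n)^\top$ be the unique positive vector with $\mathbf r^\top W=\mathbf r^\top$ and $\mathbf r^\top\mathbf 1=1$. Problem assumption: each $f_i$ is $\mu$-strongly convex and $L$-smooth (differentiable with $L$-Lipschitz gradient) for some $\mu,L>0$. R-Xi-row iteration. Let $\{\lambda_k\},\{\gamma_k\},\{\alpha_k\},\{\beta_k\}$ be positive (deterministic) gain sequences and $\varepsilon_\kappa>0$ a fixed constant. Initialize with arbitrary $x_{i,0},z_{i,0}\in\mathbb R$, $\mathbf y_{i,0}\in\mathbb R^n$ equal to the $i$-th standard basis vector, and $\kappa_{i,-1}=0$. For $k=0,1,2,\dots$ and each $i\in\mathcal V$, set $\hat{\mathbf y}_{i,k}=\sum_{j}W_{ij}\mathbf y_{j,k}+\mathbf e^y_{i,k}$, $\hat z_{i,k}=\sum_jW_{ij}z_{j,k}+e^z_{i,k}$, $\hat x_{i,k}=\sum_jW_{ij}x_{j,k}+e^x_{i,k}$, and $$\mathbf y_{i,k+1}=(1-\lambda_k)\mathbf y_{i,k}+\lambda_k\hat{\mathbf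 y}_{i,k}+\gamma_k\mathbf y_{i,0},$$ $$\kappa_{i,k}=\frac{\sum_{j=1}^n[\mathbf y_{i,k+1}]_j}{n[\mathbf y_{i,k+1}]_i}\ \text{ if }[\mathbf y_{i,k+1}]_i>\varepsilon_\kappa,\qquad \kappa_{i,k}=\kappa_{i,k-1}\ \text{ otherwise},$$ $$z_{i,k+1}=(1-\beta_k)z_{i,k}+\beta_k\hat z_{i,k}+\alpha_k\kappa_{i,k}\nabla f_i(x_{i,k}),$$ $$x_{i,k+1}=(1-\beta_k)x_{i,k}+\beta_k\hat x_{i,k}-(z_{i,k+1}-z_{i,k}).$$ Here $e^x_{i,k},e^z_{i,k}$ are real random variables and $\mathbf e^y_{i,k}$ are $\mathbb R^n$-valued random vectors. Noise assumption: $e^x_{i,k},\mathbf e^y_{i,k},e^z_{i,k}$ are mutually independent over all $i\in\mathcal V$, $k\ge0$; all are zero-mean with variances uniformly bounded by a constant $\sigma>0$; moreover there is a constant $\tilde\sigma_y$ with $\|\mathbf e^y_{i,k}\|\le\tilde\sigma_y$ for all $i,k$ almost surely. Notation: $\mathbf x_k=(x_{1,k},\dots,x_{n,k})^\top$, $\mathbf z_k=(z_{1,k},\dots,z_{n,k})^\top$, $\tilde x_k=\mathbf r^\top\mathbf x_k$, $\tilde z_k=\mathbf r^\top\mathbf z_k$, $W_k=(1-\beta_k)I+\beta_kW$. Norm: $\|\mathbf x\|_A=\|\bar A\mathbf x\|_2$ on $\mathbb R^n$, where $\bar A\in\mathbb R^{n\times n}$ is a fixed nonsingular matrix chosen so that,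 for the induced matrix norm $\|M\|_A=\|\bar AM\bar A^{-1}\|_2$ and some $\rho_A>0$, $\|W_k-\mathbf 1\mathbf r^\top\|_A\le 1-\beta_k\rho_A<1$ for all $k$, and rescaled so that $\|\mathbf x\|_2\le\|\mathbf x\|_A$ for all $\mathbf x\in\mathbb R^n$. *)

(* Defs.v *)
From HB Require Import structures.
From mathcomp Require Import all_boot all_order all_algebra finmap.
From mathcomp Require Import all_classical all_reals all_analysis.

Set Implicit Arguments.
Unset Strict Implicit.
Unset Printing Implicit Defensive.

Import Order.TTheory GRing.Theory Num.Theory.
Import numFieldNormedType.Exports.

Local Open Scope classical_set_scope.
Local Open Scope ring_scope.

(* The library norm on matrices is the sup norm, hence these definitions. *)
Definition norm2 (R : realType) (n : nat) (v : 'cV[R]_n) : R :=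
  Num.sqrt (\sum_(i < n) v i 0 ^+ 2).

Definition mxnorm2 (R : realType) (n : nat) (M : 'M[R]_n) : R :=
  sup [set norm2 (M *m v) | v in [set v : 'cV[R]_n | norm2 v <= 1]].

Definition normA (R : realType) (n : nat) (A : 'M[R]_n) (v : 'cV[R]_n) : R :=
  norm2 (A *m v).

Definition mxnormA (R : realType) (n : nat) (A M : 'M[R]_n) : R :=
  mxnorm2 (A *m M *m invmx A).

Definition ones (R : realType) (n : nat) : 'cV[R]_n := const_mx 1.

Definition primitive_mx (R : realType) (n : nat) (W : 'M[R]_n) : Prop :=
  (forall i j, 0 <= W i j) /\
  exists2 k : nat, (0 < k)%N & forall i j, 0 < (W ^+ k) i j.

(* [edge j i] : there is an arc from j to i, i.e. j is an in-neighbor of i. *)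
Definition weight_mx (R : realType) (n : nat) (edge : rel 'I_n) (W : 'M[R]_n)
    : Prop :=
  [/\ forall i j, (j == i) || edge j i -> 0 < W i j < 1,
      forall i j, ~~ ((j == i) || edge j i) -> W i j = 0,
      primitive_mx W
    & W *m ones R n = ones R n].

(* Such an r is unique for primitive row-stochastic W (Perron-Frobenius). *)
Definition left_perron (R : realType) (n : nat) (W : 'M[R]_n) (r : 'cV[R]_n)
    : Prop :=
  [/\ forall i, 0 < r i 0, r^T *m W = r^T & \sum_(i < n) r i 0 = 1].

Definition lazy_mx (R : realType) (n : nat) (W : 'M[R]_n) (beta : R)
    : 'M[R]_n := (1 - beta) *: 1%:M + beta *: W.

Definition wavg (R : realType) (n : nat) (r v : 'cV[R]_n) : R :=
  \sum_(i < n) r i 0 * v i 0.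

Definition strongly_convex (R : realType) (mu : R) (f : R -> R) : Prop :=
  forall x y t : R, 0 <= t <= 1 ->
    f (t * x + (1 - t) * y) <=
      t * f x + (1 - t) * f y - mu / 2 * t * (1 - t) * (x - y) ^+ 2.

Definition smooth (R : realType) (L : R) (f : R -> R) : Prop :=
  (forall x : R, derivable f x 1) /\
  (forall x y : R, `|derive1 f x - derive1 f y| <= L * `|x - y|).

Definition mean_objective (R : realType) (n : nat) (f : 'I_n -> R -> R)
    (x : R) : R := n%:R^-1 * \sum_(i < n) f i x.

Record RXi_parameters (R : realType) (n : nat) := RXiParameters {
  weights : 'M[R]_n;
  objective : 'I_n -> R -> R;
  lambda : nat -> R;
  gamma : nat -> R;
  alpha : nat -> R;
  beta : nat -> R;
  eps_kappa : R;
  x_init : 'cV[R]_n;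
  z_init : 'cV[R]_n }.

(* One realization of the noises e^x_{i,k}, e^y_{i,k}, e^z_{i,k}. *)
Record noise_realization (R : realType) (n : nat) := NoiseRealization {
  noise_x : 'I_n -> nat -> R;
  noise_y : 'I_n -> nat -> 'cV[R]_n;
  noise_z : 'I_n -> nat -> R }.

(* At time k: y_{i,k}, kappa_{i,k-1} (note the shift), z_k and x_k. *)
Record RXi_state (R : realType) (n : nat) := RXiState {
  y_ : 'I_n -> 'cV[R]_n;
  kappa_prev : 'I_n -> R;
  z_ : 'cV[R]_n;
  x_ : 'cV[R]_n }.

Definition RXi_init (R : realType) (n : nat) (p : RXi_parameters R n)
    : RXi_state R n :=
  {| y_ := fun i => delta_mx i 0;
     kappa_prev := fun=> 0;
     z_ := z_init p;
     x_ := x_init p |}.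

Definition RXi_step (R : realType) (n : nat) (p : RXi_parameters R n)
    (e : noise_realization R n) (k : nat) (s : RXi_state R n)
    : RXi_state R n :=
  let W := weights p in
  let y_hat i := \sum_(j < n) W i j *: y_ s j + noise_y e i k in
  let z_hat i := \sum_(j < n) W i j * z_ s j 0 + noise_z e i k in
  let x_hat i := \sum_(j < n) W i j * x_ s j 0 + noise_x e i k in
  let y_next i := (1 - lambda p k) *: y_ s i + lambda p k *: y_hat i
                  + gamma p k *: delta_mx i 0 in
  let kappa i := if y_next i i 0 > eps_kappa p
                 then (\sum_(j < n) y_next i j 0) / (n%:R * y_next i i 0)
                 else kappa_prev s i in
  let z_next : 'cV[R]_n :=
    \col_i ((1 - beta p k) * z_ s i 0 + beta p k * z_hat i
            + alpha p k * kappa i * derive1 (objective p i) (x_ s i 0)) in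
  let x_next : 'cV[R]_n :=
    \col_i ((1 - beta p k) * x_ s i 0 + beta p k * x_hat i
            - (z_next i 0 - z_ s i 0)) in
  {| y_ := y_next; kappa_prev := kappa; z_ := z_next; x_ := x_next |}.

Fixpoint RXi (R : realType) (n : nat) (p : RXi_parameters R n)
    (e : noise_realization R n) (k : nat) : RXi_state R n :=
  if k is k'.+1 then RXi_step p e k' (RXi p e k') else RXi_init p.

Definition mutually_independent (d : measure_display) (T : measurableType d)
    (R : realType) (P : probability T R) (I : choiceType)
    (G : I -> set_system T) : Prop :=
  forall (J : {fset I}) (A : I -> set T),
    (forall j, j \in J -> G j (A j)) ->
    P (\bigcap_(j in [set` J]) A j) = (\prod_(j <- J) P (A j))%E.

Definition col_of_tuple (R : realType) (n : nat) (t : n.-tuple R) : 'cV[R]_n :=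
  \col_i tnth t i.

(* The family of all noises is indexed by three copies of 'I_n * nat; each
   e^y_{i,k} enters as one R^n-valued variable, whose coordinates may be
   mutually dependent. *)
Definition noise_sigma_algebra (d : measure_display) (T : measurableType d)
    (R : realType) (P : probability T R) (n : nat)
    (ex : 'I_n -> nat -> {RV P >-> R})
    (ey : 'I_n -> nat -> {RV P >-> n.-tuple R})
    (ez : 'I_n -> nat -> {RV P >-> R})
    (l : 'I_n * nat + 'I_n * nat + 'I_n * nat) : set_system T :=
  match l with
  | inl (inl (i, k)) => g_sigma_algebra_preimage (ex i k)
  | inl (inr (i, k)) => g_sigma_algebra_preimage (ey i k)
  | inr (i, k) => g_sigma_algebra_preimage (ez i k)
  end.

(* The variance of the vector e^y_{i,k} is E ||e^y_{i,k} - E e^y_{i,k}||_2^2,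
   i.e. the sum of the variances of its coordinates. *)
Definition noise_assumption (d : measure_display) (T : measurableType d)
    (R : realType) (P : probability T R) (n : nat) (sigma sigma_y : R)
    (ex : 'I_n -> nat -> {RV P >-> R})
    (ey : 'I_n -> nat -> {RV P >-> n.-tuple R})
    (ez : 'I_n -> nat -> {RV P >-> R}) : Prop :=
  [/\ mutually_independent P (noise_sigma_algebra ex ey ez),
      forall i k, ('E_P[ex i k] = 0 /\ 'V_P[ex i k] <= sigma%:E)%E,
      forall i k,
        ((forall j : 'I_n, 'E_P[fun w => tnth (ey i k w) j] = 0) /\
         \sum_(j < n) 'V_P[fun w => tnth (ey i k w) j] <= sigma%:E)%E,
      forall i k, ('E_P[ez i k] = 0 /\ 'V_P[ez i k] <= sigma%:E)%E
    & forall i k, {ae P, forall w, norm2 (col_of_tuple (ey i k w)) <= sigma_y}].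

Definition noise_at (d : measure_display) (T : measurableType d)
    (R : realType) (P : probability T R) (n : nat)
    (ex : 'I_n -> nat -> {RV P >-> R})
    (ey : 'I_n -> nat -> {RV P >-> n.-tuple R})
    (ez : 'I_n -> nat -> {RV P >-> R}) (w : T) : noise_realization R n :=
  {| noise_x := fun i k => ex i k w;
     noise_y := fun i k => col_of_tuple (ey i k w);
     noise_z := fun i k => ez i k w |}.

Definition power_gain (R : realType) (c s : R) (k : nat) : R :=
  c / (k.+1%:R `^ s).

(* u_k = O(g_k) as k -> oo for an extended-real u; bounding in \bar R makes
   finiteness of u_k part of the claim. *)
Definition ebigO (R : realType) (u : nat -> \bar R) (g : nat -> R) : Prop :=
  exists C : R, \forall k \near \oo, (`|u k| <= (C * `|g k|)%:E)%E.

(* Main.v *)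
(* For large k the entry y_{i,k}(l) is r_l (1 + sum_{j<k} gamma_j) up to a
   consensus error of size O(k^(p-q)) and a martingale. As the noise of y is
   bounded, kappa_{i,k} is eventually within any prescribed distance of
   1/(n r_i), uniformly over the sample space, and its mean square error is
   O(k^-m). The consensus errors of x and z contract at rate beta_k, the
   distance of the average to the minimizer contracts at rate alpha_k, and
   independence removes all cross terms with the current noise of x and z.
   With U, X, Z the mean squares of these three errors and tau a large constant,
   V = U + X + tau Z satisfies V' <= (1 - c alpha_k) V + C alpha_k (k+1)^-m, the
   forcing alpha_k^2/beta_k and beta_k^2 being alpha_k times (k+1)^-(a-b) and
   (k+1)^-(2b-a). Since a < 1, Chung's lemma gives V = O(k^-m). *)
Require Import Defs.
From HB Require Import structures.
From mathcomp Require Import all_boot all_order all_algebra finmap ring lra.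
From mathcomp Require Import all_classical all_reals all_analysis measurable_realfun.

Set Implicit Arguments.
Unset Strict Implicit.
Unset Printing Implicit Defensive.

Import Order.TTheory GRing.Theory Num.Theory.
Import numFieldNormedType.Exports.

Local Open Scope classical_set_scope.
Local Open Scope ring_scope.

(** * Independence *)

(** In the recursion of the average, the error of the weights multiplies the squared distance to the
    minimizer. The two are dependent, so the expectation of the product cannot be factored. Hence
    two estimates of the weights: a pathwise one, small enough to be absorbed by strong convexity,
    and a mean square one that sets the rate. The pathwise one rests on the bounded noise and on
    [q < p]: the martingale is at most of order k^(1-p), while the deterministic part grows like
    k^(1-q). The weight kappa_{i,k} already contains the y-noise of time k, so the past before time
    k is too small for conditioning. No conditional expectation is used: a noise variable is
    orthogonal to whatever is measurable with respect to the sigma-algebra of all the other noises.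
    The A-norm contraction is given at the gains beta_k, whereas the y-iteration runs with lambda_k;
    convexity carries it from beta_0 to every smaller gain. *)

Definition sigma_other (T : Type) (I : choiceType) (G : I -> set_system T)
    (l0 : I) : set_system T :=
  <<s [set B | exists2 l, l != l0 & G l B] >>.

(* Finite intersections of events of the sigma-algebras other than [G l0] form
   a pi-system, so independence extends to the sigma-algebra they generate. *)
Lemma indep_sigma_other d (T : measurableType d) (R : realType)
    (P : probability T R) (I : choiceType) (G : I -> set_system T) (l0 : I) :
  (forall l, G l `<=` measurable) -> (forall l, setI_closed (G l)) ->
  (forall l, G l setT) ->
  mutually_independent P G ->
  forall B E, sigma_other G l0 B -> G l0 E -> P (B `&` E) = (P B * P E)%E.
Proof.
move=> Gm GI GT ind B E FB GE.
pose Pi : set_system T := [set X | exists (J : {fset I}) (A : I -> set T),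
  [/\ l0 \notin J, forall j, G j (A j) & X = \bigcap_(j in [set` J]) A j]].
have bigcapm (J : {fset I}) (A : I -> set T) : (forall j, G j (A j)) ->
    measurable (\bigcap_(j in [set` J]) A j).
  by move=> GA; apply: fin_bigcap_measurable => // j _; apply/Gm/GA.
have Pim : Pi `<=` measurable by move=> _ [J [A [_ GA ->]]]; exact: bigcapm.
have PiI : setI_closed Pi.
  move=> _ _ [J1 [A1 [l1 G1 ->]]] [J2 [A2 [l2 G2 ->]]].
  (* Padding each family by [setT] outside its own index set lets one family over the union describe
     both intersections. *)
  exists (J1 `|` J2)%fset, (fun j => (if j \in J1 then A1 j else setT) `&`
     (if j \in J2 then A2 j else setT)); split.
  - by rewrite in_fsetU negb_or l1.
  - by move=> j; apply: GI; case: ifP.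
  - apply/seteqP; split => x /=.
      by move=> [h1 h2] j _; split; case: ifP => // jJ; [apply: h1|apply: h2].
    move=> h; split => j /= jJ; have := h j; rewrite /= in_fsetU jJ ?orbT.
      by move=> /(_ isT)[].
    by move=> /(_ isT)[].
have PiT : Pi setT.
  exists fset0, (fun=> setT); split => //.
  by apply/seteqP; split => // x _ j /=.
have mE : measurable E by exact: Gm GE.
have PE0 : (0 <= fine (P E))%R by rewrite fine_ge0.
(* Both sides of the claim as finite measures of [B]: the trace of [P] on [E], and [P] scaled by the
   probability of [E]. They need only agree on the pi-system. *)
pose m1 := mrestr P mE.
pose m2 := mscale (NngNum PE0) P.
have key X : Pi X -> m1 X = m2 X.
  move=> [J [A [l0J GA XE]]]; subst X.
  rewrite /m1 /m2 /mrestr /mscale /= fineK ?fin_num_measure//.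
  (* [E] enters as the event of index [l0], which [J] avoids, so independence over [J] enlarged by
     [l0] splits off its probability. *)
  pose A' j := if j == l0 then E else A j.
  have GA' j : G j (A' j) by rewrite /A'; case: eqP => [->|].
  have A'J j : j \in J -> A' j = A j.
    by move=> jJ; rewrite /A'; case: eqP => // jl; rewrite -jl jJ in l0J.
  have -> : \bigcap_(j in [set` J]) A j `&` E =
      \bigcap_(j in [set` (l0 |` J)%fset]) A' j.
    apply/seteqP; split => x /=.
      move=> [h1 h2] j /=; rewrite in_fset1U /A'; case: eqP => // _ /= jJ.
      exact: h1.
    move=> h; split.
      by move=> j /= jJ; rewrite -A'J//; apply: h; rewrite /= in_fset1U jJ orbT.
    by have := h l0; rewrite /= in_fset1U eqxx /A' eqxx; apply.
  rewrite ind; last by move=> j _; exact: GA'.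
  rewrite big_fsetU1//= /A' eqxx; congr (_ * _)%E.
  rewrite ind; last by move=> j _; exact: GA.
  by apply: eq_big_seq => j jJ; case: eqP => // jl; rewrite -jl jJ in l0J.
have sub : sigma_other G l0 `<=` <<s Pi >>.
  apply: sub_sigma_algebra2 => X [l ll0 GX].
  exists [fset l]%fset, (fun j => if j == l then X else setT); split.
  - by rewrite in_fset1 eq_sym.
  - by move=> j; case: eqP => [->|].
  - apply/seteqP; split => x /=.
      by move=> Xx j /=; rewrite in_fset1 => /eqP ->; rewrite eqxx.
    by move=> /(_ l); rewrite /= in_fset1 eqxx; apply.
have /= m12 : m1 B = m2 B.
  apply: (@g_sigma_algebra_measure_unique _ R T Pi Pim (fun=> setT) (fun=> PiT) _
    m1 m2 PiI key _ B (sub _ FB)).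
  - by rewrite bigcup_const//; exists 0%N.
  - by move=> _; rewrite /m1 /= /mrestr setTI ltey_eq fin_num_measure.
transitivity (m1 B) => //.
by rewrite m12 /m2 /mscale /= fineK ?fin_num_measure// muleC.
Qed.

(** Independence on rectangles identifies the joint law of [(X, Y)] with the product of the marginal
    laws. Fubini then integrates the second variable first, and each inner integral is x times the
    mean of [Y], hence 0. *)
Lemma indep_integral_mul0 d (T : measurableType d) (R : realType)
    (P : probability T R) (X Y : T -> R) :
  measurable_fun setT X -> measurable_fun setT Y ->
  (forall B C, measurable B -> measurable C ->
     P (X @^-1` B `&` Y @^-1` C) = (P (X @^-1` B) * P (Y @^-1` C))%E) ->
  P.-integrable setT (EFin \o (fun w => X w * Y w)) ->
  P.-integrable setT (EFin \o Y) ->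
  (\int[P]_w (Y w)%:E = 0)%E ->
  (\int[P]_w (X w * Y w)%:E = 0)%E.
Proof.
move=> mX mY ind iXY iY Y0.
pose Z (w : T) : R * R := (X w, Y w).
have mZ : measurable_fun setT Z by exact/measurable_fun_pair.
pose X' : {RV P >-> R} := mfun_Sub (mem_set mX : X \in mfun).
pose Y' : {RV P >-> R} := mfun_Sub (mem_set mY : Y \in mfun).
pose Z' : {RV P >-> (R * R)%type} := mfun_Sub (mem_set mZ : Z \in mfun).
pose mXY : R * R -> \bar R := fun z => (z.1 * z.2)%:E.
have mXYm : measurable_fun setT mXY.
  by apply/measurable_EFinP; apply: measurable_funM;
    [exact: measurable_fst|exact: measurable_snd].
have dZ : forall S, measurable S ->
    (distribution P X' \x distribution P Y')%E S = distribution P Z' S.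
  apply: product_measure_unique => B C mB mC.
  by rewrite /distribution /pushforward /= -ind//.
have iprod : (distribution P X' \x distribution P Y')%E.-integrable setT mXY.
  have : (distribution P Z').-integrable setT mXY.
    apply: integrable_pushforward => //=.
  move=> /integrableP[_ h]; apply/integrableP; split => //.
  rewrite (eq_measure_integral (distribution P Z'))// => S mS _.
  exact: dZ.
transitivity (\int[distribution P Z']_z mXY z)%E.
  by rewrite integral_distribution.
transitivity (\int[(distribution P X' \x distribution P Y')]_z mXY z)%E.
  by apply: eq_measure_integral => S mS _; apply: esym; exact: dZ.
rewrite -integral12_prod_meas1//=.
apply: integral0_eq => x _; rewrite /fubini_F /mXY /=.
under eq_integral do rewrite EFinM.
have iid : (distribution P Y').-integrable setT (fun y => y%:E).
  by apply: integrable_pushforward => //=; exact/measurable_EFinP.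
rewrite (integralZl measurableT iid) integral_distribution//= ?Y0 ?mule0//.
Qed.

(** * Integrable and square-integrable random variables *)

Section square_integrable.
Context {d} {T : measurableType d} {R : realType} (P : probability T R).
Implicit Types (f g : T -> R) (c : R).

Definition L1 f := P.-integrable setT (EFin \o f).

(** Integrability of the square alone would not make [f] itself measurable. *)
Definition L2 f := measurable_fun setT f /\ L1 (fun w => f w ^+ 2).

(** Real-valued, with value 0 when the extended integral is infinite. Linearity and monotonicity
    therefore ask for integrability, while nonnegativity does not. *)
Definition mean f : R := Rintegral P setT f.

Lemma L1_measurable f : L1 f -> measurable_fun setT f.
Proof. by move=> /measurable_int/measurable_EFinP. Qed.

Lemma L1_ext f g : f =1 g -> L1 f -> L1 g.
Proof. by move=> /funext ->. Qed.

(** The almost-sure form is required because the y-noise, and with it the weights kappa, is bounded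
    only almost surely. *)
Lemma L1_le_ae f g : measurable_fun setT f -> L1 g ->
  {ae P, forall w, `|f w| <= g w} -> L1 f.
Proof.
move=> mf /integrableP[mg ig] fg; apply/integrableP; split.
  exact/measurable_EFinP.
apply: le_lt_trans ig; apply: ae_ge0_le_integral => //.
- by do 2 apply: measurableT_comp => //; exact/measurable_EFinP.
- by apply: measurableT_comp.
- by apply: filterS fg => w h _ /=; rewrite lee_fin (le_trans h)// ler_norm.
Qed.

Lemma L1_le f g : measurable_fun setT f -> L1 g ->
  (forall w, `|f w| <= g w) -> L1 f.
Proof. by move=> mf ig h; apply: (L1_le_ae mf ig); exact: nearW. Qed.

Lemma L1_cst c : L1 (fun=> c).
Proof. by apply: finite_measure_integrable_cst. Qed.

Lemma L1D f g : L1 f -> L1 g -> L1 (fun w => f w + g w).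
Proof.
move=> h1 h2; have := integrableD measurableT h1 h2.
by apply: eq_integrable => // w _; rewrite /= EFinD.
Qed.

Lemma L1Z c f : L1 f -> L1 (fun w => c * f w).
Proof.
move=> h1; have := integrableZl measurableT c h1.
by apply: eq_integrable => // w _; rewrite /= EFinM.
Qed.

Lemma L1_sum (I : Type) (r : seq I) (F : I -> T -> R) :
  (forall i, L1 (F i)) -> L1 (fun w => \sum_(i <- r) F i w).
Proof.
move=> h; elim: r => [|i r ih].
  by apply: L1_ext (L1_cst 0) => w; rewrite big_nil.
by apply: L1_ext (L1D (h i) ih) => w; rewrite big_cons.
Qed.

Lemma meanD f g : L1 f -> L1 g -> mean (fun w => f w + g w) = mean f + mean g.
Proof. by move=> h1 h2; rewrite /mean RintegralD. Qed.

Lemma meanZ c f : L1 f -> mean (fun w => c * f w) = c * mean f.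
Proof. by move=> h1; rewrite /mean RintegralZl. Qed.

Lemma mean_cst c : mean (fun=> c) = c.
Proof. by rewrite /mean Rintegral_cst// [X in fine X](@probability_setT _ _ _ P) mulr1. Qed.

Lemma mean_sum (I : Type) (r : seq I) (F : I -> T -> R) :
  (forall i, L1 (F i)) ->
  mean (fun w => \sum_(i <- r) F i w) = \sum_(i <- r) mean (F i).
Proof.
move=> h; elim: r => [|i r ih].
  by rewrite big_nil -[RHS](mean_cst 0); congr mean; apply/funext => w; rewrite big_nil.
rewrite big_cons -ih -meanD//; last exact: L1_sum.
by congr mean; apply/funext => w; rewrite big_cons.
Qed.

Lemma mean_ge0 f : (forall w, 0 <= f w) -> 0 <= mean f.
Proof. by move=> h; apply: Rintegral_ge0. Qed.

Lemma mean_ge0_ae f : L1 f -> {ae P, forall w, 0 <= f w} -> 0 <= mean f.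
Proof.
move=> f1 f0.
(* Almost everywhere [f] equals its absolute value, which is nonnegative at every point. *)
have fE : mean f = mean (fun w => `|f w|).
  congr fine; apply: ae_eq_integral => //.
  - exact/measurable_EFinP/L1_measurable.
  - apply/measurable_EFinP; apply: measurableT_comp => //; exact: L1_measurable.
  - by apply: filterS f0 => w h _ /=; rewrite ger0_norm.
by rewrite fE; apply: mean_ge0.
Qed.

Lemma mean_le_ae f g : L1 f -> L1 g ->
  {ae P, forall w, f w <= g w} -> mean f <= mean g.
Proof.
move=> f1 g1 fg; rewrite -subr_ge0.
have -> : mean g - mean f = mean (fun w => g w + (-1) * f w).
  by rewrite meanD ?meanZ ?mulN1r//; exact: L1Z.
apply: mean_ge0_ae; first by apply: L1D => //; exact: L1Z.
by apply: filterS fg => w h; rewrite mulN1r subr_ge0.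
Qed.

Lemma mean_le f g : L1 f -> L1 g -> (forall w, f w <= g w) -> mean f <= mean g.
Proof. by move=> f1 g1 h; apply: mean_le_ae => //; exact: nearW. Qed.

Lemma L2_ext f g : f =1 g -> L2 f -> L2 g.
Proof. by move=> /funext ->. Qed.

Lemma L2_le_ae f g : measurable_fun setT f -> L2 g ->
  {ae P, forall w, `|f w| <= g w} -> L2 f.
Proof.
move=> mf [mg ig] fg; split => //.
apply: (L1_le_ae _ ig); first exact: measurable_funX.
apply: filterS fg => w h; rewrite normrX ler_pXn2r// ?nnegrE//.
exact: le_trans h.
Qed.

Lemma L2M_L1 f g : L2 f -> L2 g -> L1 (fun w => f w * g w).
Proof.
move=> [mf if_] [mg ig].
apply: (L1_le _ (L1D if_ ig)); first exact: measurable_funM.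
move=> w; rewrite ler_norml; apply/andP; split.
- have := sqr_ge0 (f w + g w); have := sqr_ge0 (f w); have := sqr_ge0 (g w).
  nra.
- have := sqr_ge0 (f w - g w); have := sqr_ge0 (f w); have := sqr_ge0 (g w).
  nra.
Qed.

Lemma L2D f g : L2 f -> L2 g -> L2 (fun w => f w + g w).
Proof.
move=> f2 g2; split; first by apply: measurable_funD; [case: f2|case: g2].
apply: L1_ext (L1D (L1D f2.2 g2.2) (L1Z 2 (L2M_L1 f2 g2))) => w /=.
ring.
Qed.

Lemma L2Z c f : L2 f -> L2 (fun w => c * f w).
Proof.
move=> f2; split; first by apply: measurable_funM => //; case: f2.
by apply: L1_ext (L1Z (c ^+ 2) f2.2) => w; rewrite exprMn.
Qed.

Lemma L2_cst c : L2 (fun=> c).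
Proof. by split => //; exact: L1_cst. Qed.

Lemma L2N f : L2 f -> L2 (fun w => - f w).
Proof. by move=> /(L2Z (-1)); apply: L2_ext => w; rewrite mulN1r. Qed.

Lemma L2B f g : L2 f -> L2 g -> L2 (fun w => f w - g w).
Proof. by move=> f2 g2; apply: L2D => //; exact: L2N. Qed.

Lemma L2_norm f : L2 f -> L2 (fun w => `|f w|).
Proof.
move=> [mf f2]; split; first exact: measurableT_comp.
by apply: L1_ext f2 => w; rewrite real_normK// num_real.
Qed.

Lemma L2_sum (I : Type) (r : seq I) (F : I -> T -> R) :
  (forall i, L2 (F i)) -> L2 (fun w => \sum_(i <- r) F i w).
Proof.
move=> h; elim: r => [|i r ih].
  by apply: L2_ext (L2_cst 0) => w; rewrite big_nil.
by apply: L2_ext (L2D (h i) ih) => w; rewrite big_cons.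
Qed.

(** Serves for a weight kappa times a gradient: the first factor is almost surely bounded, the
    second square integrable. *)
Lemma L2_bddM (b : T -> R) f c : measurable_fun setT b -> {ae P, forall w, `|b w| <= c} ->
  L2 f -> L2 (fun w => b w * f w).
Proof.
move=> mb bc f2.
apply: (L2_le_ae _ (L2Z c (L2_norm f2))).
  by apply: measurable_funM => //; case: f2.
by apply: filterS bc => w h; rewrite normrM ler_wpM2r.
Qed.

(** The form in which noise enters the recursions: its second moment is added and no cross term
    survives. *)
Lemma mean_sqrD f g : L2 f -> L2 g -> mean (fun w => f w * g w) = 0 ->
  mean (fun w => (f w + g w) ^+ 2) =
  mean (fun w => f w ^+ 2) + mean (fun w => g w ^+ 2).
Proof.
move=> f2 g2 fg0.
have -> : (fun w => (f w + g w) ^+ 2) =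
    (fun w => (f w ^+ 2 + g w ^+ 2) + 2 * (f w * g w)).
  by apply/funext => w; ring.
rewrite meanD; [|apply: L1D; [exact: f2.2|exact: g2.2]|apply: L1Z; exact: L2M_L1].
rewrite meanZ; last exact: L2M_L1.
by rewrite fg0 mulr0 addr0 meanD//; [exact: f2.2|exact: g2.2].
Qed.

Lemma mean_sqrM_sum0 (I : finType) f (F : I -> T -> R) (c : I -> R) :
  L2 f -> (forall i, L2 (F i)) -> (forall i, mean (fun w => f w * F i w) = 0) ->
  mean (fun w => f w * \sum_i c i * F i w) = 0.
Proof.
move=> f2 F2 fF0.
have -> : (fun w => f w * \sum_i c i * F i w) =
    (fun w => \sum_i c i * (f w * F i w)).
  by apply/funext => w; rewrite mulr_sumr; apply: eq_bigr => i _; ring.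
rewrite mean_sum; last by move=> i; apply/L1Z/L2M_L1.
by rewrite big1// => i _; rewrite meanZ ?fF0 ?mulr0//; exact: L2M_L1.
Qed.

End square_integrable.

(** Cauchy-Schwarz against the constant vector, from 2 F_i F_j <= F_i^2 + F_j^2 summed over all
    pairs. *)
Lemma sqr_sum_le (R : realFieldType) (I : finType) (F : I -> R) :
  (\sum_i F i) ^+ 2 <= #|I|%:R * \sum_i F i ^+ 2.
Proof.
rewrite expr2 mulr_suml.
apply: (@le_trans _ _ (\sum_i \sum_j 2^-1 * (F i ^+ 2 + F j ^+ 2))).
  apply: ler_sum => i _; rewrite mulr_sumr; apply: ler_sum => j _.
  rewrite -subr_ge0 (_ : _ - _ = 2^-1 * (F i - F j) ^+ 2); last by field.
  by rewrite mulr_ge0// sqr_ge0.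
under eq_bigr do rewrite -mulr_sumr big_split/= sumr_const.
rewrite -mulr_sumr big_split/= sumr_const sumrMnl -mulr_natl.
by rewrite le_eqVlt; apply/orP; left; apply/eqP; field.
Qed.

Lemma sum_ord_eq1_gt0 (R : nzRingType) n (F : 'I_n -> R) :
  \sum_i F i = 1 -> (0 < n)%N.
Proof.
case: n F => // F; rewrite big_ord0 => /esym/eqP.
by rewrite oner_eq0.
Qed.

(** * Power gains and scalar recursions *)

Section power_gains.
Context {R : realType}.
Implicit Types (s t c C m a : R) (k : nat).

Lemma powR_natS_gt0 s k : 0 < k.+1%:R `^ s :> R.
Proof. by rewrite powR_gt0// ltr0n. Qed.

Lemma ge1_powR_ge1 s k : 0 <= s -> 1 <= k.+1%:R `^ s :> R.
Proof. by move=> s0; rewrite -[leLHS](powRr0 k.+1%:R) ler_powR// ler1n. Qed.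

Lemma power_gainE c s k : power_gain c s k = c * k.+1%:R `^ (- s).
Proof. by rewrite /power_gain powRN. Qed.

Lemma power_gain_gt0 c s k : 0 < c -> 0 < power_gain c s k.
Proof. by move=> c0; rewrite divr_gt0// powR_natS_gt0. Qed.

Lemma power_gain_ge0 c s k : 0 <= c -> 0 <= power_gain c s k.
Proof. by move=> c0; rewrite divr_ge0// ltW// powR_natS_gt0. Qed.

Lemma power_gain_le c s k : 0 <= c -> 0 <= s -> power_gain c s k <= c.
Proof.
by move=> c0 s0; rewrite ler_pdivrMr ?powR_natS_gt0// ler_peMr// ge1_powR_ge1.
Qed.

Lemma power_gain0 c s : power_gain c s 0 = c.
Proof. by rewrite /power_gain powR1 divr1. Qed.

Lemma natS_powRD s t k :
  k.+1%:R `^ (s + t) = k.+1%:R `^ s * k.+1%:R `^ t :> R.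
Proof. by rewrite powRD// pnatr_eq0 implybT. Qed.

Lemma cvg_powR_natSN s : 0 < s -> (k.+1%:R `^ (- s) : R) @[k --> \oo] --> (0 : R).
Proof.
move=> s0; apply/cvgrPdist_lt => e e0.
(* Chosen so that [B] to the power [s] is the inverse of [e]. *)
pose B : R := (e^-1) `^ (s^-1).
have [N hN] : exists N : nat, B < N%:R.
  by exists (Num.bound B); rewrite archi_boundP// powR_ge0.
near=> k.
rewrite sub0r normrN ger0_norm ?powR_ge0// powRN.
have Bk : B < k.+1%:R.
  apply: lt_le_trans hN _; rewrite ler_nat.
  by apply: leqW; near: k; exact: nbhs_infty_ge.
have : B `^ s < k.+1%:R `^ s by rewrite gt0_ltr_powR// nnegrE ?powR_ge0.
rewrite /B -powRrM mulVf ?gt_eqF// powRr1 ?invr_ge0 ?ltW//.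
by move=> h; rewrite -[ltRHS]invrK ltf_pV2// posrE ?invr_gt0 ?powR_natS_gt0.
Unshelve. all: by end_near. Qed.

Lemma near_powR_natSN_le s e : 0 < s -> 0 < e ->
  \forall k \near \oo, (k.+1%:R `^ (- s) : R) <= e.
Proof.
move=> s0 e0; have /cvgrPdist_le/(_ _ e0) := cvg_powR_natSN s0.
by apply: filterS => k; rewrite sub0r normrN ger0_norm ?powR_ge0.
Qed.

(* With x = k / (k + 1), the bound t (1 - x) <= (1 + t) (1 - x^t) follows from
   exp y >= 1 + y and ln x <= x - 1. *)
Lemma powR_natS_increment t k : 0 < t ->
  t / (1 + t) * k.+1%:R `^ (t - 1) <= k.+1%:R `^ t - k%:R `^ t :> R.
Proof.
move=> t0.
have k1 : 0 < k.+1%:R :> R by rewrite ltr0n.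
pose x : R := k%:R / k.+1%:R.
have x0 : 0 <= x by rewrite divr_ge0.
have xE : 1 - x = k.+1%:R^-1.
  rewrite /x; apply: (mulIf (lt0r_neq0 k1)).
  by rewrite mulrBl divfK ?gt_eqF// mulVf ?gt_eqF// mul1r -natr1 addrAC subrr add0r.
have x1 : 0 < 1 - x by rewrite xE invr_gt0.
have x1' : 1 - x <= 1 by rewrite lerBlDr lerDl.
have kE : k%:R = x * k.+1%:R by rewrite /x divfK ?gt_eqF.
rewrite [in leRHS]kE powRM// natS_powRD (powRN _ 1) (powRr1 (ltW k1)) -xE mulrCA.
have -> : k.+1%:R `^ t - x `^ t * k.+1%:R `^ t = k.+1%:R `^ t * (1 - x `^ t) :> R by ring.
rewrite ler_wpM2l ?powR_ge0//.
have t1 : 0 < 1 + t by rewrite ltr_pwDl// ltW.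
suff h : x `^ t * (1 + t * (1 - x)) <= 1.
  have xt : x `^ t <= (1 + t * (1 - x))^-1.
    by rewrite -[leRHS]mul1r ler_pdivlMr// ltr_pwDl// mulr_ge0// ltW.
  apply: le_trans (lerB (lexx 1) xt).
  have D0 : 0 < 1 + t * (1 - x) by rewrite ltr_pwDl// mulr_ge0// ltW.
  have -> : 1 - (1 + t * (1 - x))^-1 = t * (1 - x) / (1 + t * (1 - x)).
    by apply: (mulIf (lt0r_neq0 D0)); rewrite mulrBl mulVf ?divfK ?gt_eqF// mul1r addrAC subrr add0r.
  rewrite mulrAC; apply: ler_wpM2l; first by rewrite mulr_ge0// ltW.
  by rewrite lef_pV2// ?posrE// lerD2l ler_piMr// ltW.
have [->|xn0] := eqVneq x 0.
  by rewrite powR0 ?gt_eqF// mul0r.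
have xp : 0 < x by rewrite lt_def xn0.
have -> : x `^ t = (x `^ (- t))^-1 by rewrite powRN invrK.
rewrite mulrC ler_pdivrMr ?powR_gt0// mul1r.
rewrite /powR gt_eqF//; apply: le_trans (expR_ge1Dx _).
rewrite lerD2l mulNr -mulrN ler_wpM2l//; first exact: ltW.
rewrite lerNr opprB.
have -> : ln x = ln (1 + (x - 1)) by congr ln; rewrite addrC subrK.
by apply: le_ln1Dx; rewrite ltrBrDr addrC subrr.
Qed.

(** Telescoping of [powR_natS_increment]. It bounds the sum of the lambda_j (with t = 1 - p) and,
    after enlarging the exponent, the sum of their squares. *)
Lemma sum_powR_le t k : 0 < t ->
  \sum_(j < k) j.+1%:R `^ (t - 1) <= (1 + t) / t * k%:R `^ t :> R.
Proof.
move=> t0; elim: k => [|k ih].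
  by rewrite big_ord0 powR0 ?gt_eqF// mulr0.
rewrite big_ord_recr/=.
have t1 : 0 < 1 + t by rewrite ltr_pwDl// ltW.
have := powR_natS_increment k t0; rewrite -ler_pdivlMl ?divr_gt0// invf_div mulrBr => h.
have := lerD ih h; rewrite addrC addrCA addrC subrr.
by rewrite addr0 addrC.
Qed.

(** With x = (k+1)/(k+2) the claim is x <= x^m, true since x <= 1 and m <= 1. *)
Lemma powR_natSN_ratio m k : 0 <= m <= 1 ->
  (1 - k.+2%:R^-1) * k.+1%:R `^ (- m) <= k.+2%:R `^ (- m) :> R.
Proof.
move=> /andP[m0 m1].
have k2 : 0 < k.+2%:R :> R by rewrite ltr0n.
pose x : R := k.+1%:R / k.+2%:R.
have x0 : 0 < x by rewrite divr_gt0// ltr0n.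
have xE : 1 - k.+2%:R^-1 = x.
  rewrite /x; apply: (mulIf (lt0r_neq0 k2)); rewrite mulrBl mulVf ?gt_eqF// mul1r divfK ?gt_eqF//.
  by rewrite -(natr1 k.+1) addrK.
have x1 : x <= 1 by rewrite -xE lerBlDr lerDl invr_ge0 ltW.
have kE : k.+1%:R = x * k.+2%:R by rewrite /x divfK ?gt_eqF.
rewrite xE kE (powRM _ (ltW x0) (ltW k2)) mulrA -[leRHS]mul1r ler_wpM2r ?powR_ge0//.
rewrite powRN ler_pdivrMr ?powR_gt0// mul1r.
by apply: ger1_powR => //; rewrite x0.
Qed.

End power_gains.

Section gradient_descent_rate.
Context {R : realType}.

(* Chung's lemma. As [a < 1], the gain [c (k+1)^-a] dominates the relative
   decrease [1 - ((k+1)/(k+2))^m <= 1/(k+2)] of the target rate. *)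
Lemma chung (V : nat -> R) (K : nat) (a m c C : R) :
  a < 1 -> 0 <= m <= 1 -> 0 < c -> 0 <= C ->
  (forall k, 0 <= V k) ->
  (forall k, (K <= k)%N -> c * k.+1%:R `^ (- a) <= 1 /\
     V k.+1 <= (1 - c * k.+1%:R `^ (- a)) * V k
               + C * (k.+1%:R `^ (- a) * k.+1%:R `^ (- m))) ->
  exists D, forall k, (K <= k)%N -> V k <= D * k.+1%:R `^ (- m).
Proof.
move=> a1 m01 c0 C0 V0 rec.
have a1' : 0 < 1 - a by rewrite subr_gt0.
have c2 : 0 < c / 2 by rewrite divr_gt0.
(* From [K1] on, 1/(k+1) <= (c/2) (k+1)^-a: half of the contraction pays for the decrease of the
   target rate. *)
have [K1 _ hK1] := near_powR_natSN_le a1' c2.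
pose N := maxn K K1.
(* The first entry lets the other half of the contraction absorb the forcing; the second starts the
   induction at [N]. *)
pose D := Num.max (2 * C / c) (V N * N.+1%:R `^ m).
have D0 : 0 <= D by rewrite le_max (mulr_ge0 (V0 N) (powR_ge0 _ _)) orbT.
have late k : (N <= k)%N -> V k <= D * k.+1%:R `^ (- m).
  elim: k => [|k ih].
    rewrite leqn0 => /eqP N0; rewrite powR1 mulr1 le_max; apply/orP; right.
    by rewrite N0 powR1 mulr1.
  rewrite leq_eqVlt => /predU1P[<-|].
    by rewrite powRN ler_pdivlMr ?powR_natS_gt0// le_max lexx orbT.
  rewrite ltnS => Nk.
  have Kk : (K <= k)%N by apply: leq_trans Nk; exact: leq_maxl.
  have K1k : (K1 <= k)%N by apply: leq_trans Nk; exact: leq_maxr.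
  have [s1 /le_trans] := rec k Kk; apply.
  have vk := ih Nk.
  apply: le_trans (ler_wpM2l D0 (powR_natSN_ratio k m01)).
  set A := k.+1%:R `^ (- a) in s1 *; set M := k.+1%:R `^ (- m) in vk *.
  have A0 : 0 <= A by exact: powR_ge0.
  have M0 : 0 <= M by exact: powR_ge0.
  have DC : C <= D * (c / 2).
    have : 2 * C / c <= D by rewrite le_max lexx.
    by rewrite ler_pdivrMr//; lra.
  have ik : k.+2%:R^-1 <= c / 2 * A.
    have h := hK1 k K1k; rewrite opprB in h.
    have h2 : k.+1%:R^-1 <= c / 2 * A.
      have -> : k.+1%:R^-1 = k.+1%:R `^ (a - 1) * A :> R.
        by rewrite -natS_powRD addrAC subrr add0r powR_inv1// ler0n.
      by rewrite ler_wpM2r.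
    by apply: le_trans h2; rewrite lef_pV2 ?posrE ?ltr0n// ler_nat.
  have h1 : (1 - c * A) * V k <= (1 - c * A) * (D * M).
    by rewrite ler_wpM2l// subr_ge0.
  have h2 : C * (A * M) <= D * (c / 2) * (A * M) by rewrite ler_wpM2r// mulr_ge0.
  have h3 : D * M * k.+2%:R^-1 <= D * M * (c / 2 * A) by rewrite ler_wpM2l// mulr_ge0.
  move: h1 h2 h3; move: (V k) (k.+2%:R^-1) => v i h1 h2 h3.
  have -> : D * ((1 - i) * M) = (1 - c * A) * (D * M) + D * (c / 2) * (A * M) +
     (D * M * (c / 2 * A) - D * M * i) by field.
  by rewrite -[leLHS]addr0 lerD ?subr_ge0// lerD.
(* Covers the finitely many times before [N]. *)
pose E := \sum_(j < N) V j * j.+1%:R `^ m.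
have E0 : 0 <= E by apply: sumr_ge0 => j _; rewrite mulr_ge0// powR_ge0.
exists (D + E) => k _.
have [Nk|kN] := leqP N k.
  apply: le_trans (late k Nk) _; rewrite ler_wpM2r ?powR_ge0//.
  by rewrite lerDl.
rewrite powRN ler_pdivlMr ?powR_natS_gt0//.
apply: (@le_trans _ _ E); last by rewrite lerDr.
rewrite /E (bigD1 (Ordinal kN))//= lerDl.
by apply: sumr_ge0 => j _; rewrite mulr_ge0// powR_ge0.
Qed.

(* The forcing is [lambda] times a growing power, so any large multiple of that
   power is a supersolution. *)
Lemma growing_supersolution (u lam B : nat -> R) (K : nat) (rho C s : R) :
  0 < rho -> 0 <= C -> 0 <= s -> (forall k, 0 <= lam k) ->
  (forall k, (K <= k)%N -> rho * lam k <= 1) ->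
  (forall k, (K <= k)%N ->
     u k.+1 <= (1 - rho * lam k) * u k + C * lam k * k.+1%:R `^ s) ->
  (forall k, u k <= B k) ->
  forall k, u k <= (C / rho + \sum_(j < K.+1) `|B j|) * k.+1%:R `^ s.
Proof.
move=> rho0 C0 s0 lam0 lam1 rec uB.
set D := C / rho + _.
have S0 : 0 <= \sum_(j < K.+1) `|B j| by apply: sumr_ge0.
have D0 : 0 <= D by rewrite addr_ge0// divr_ge0// ltW.
have early k : (k <= K)%N -> u k <= D * k.+1%:R `^ s.
  move=> kK; apply: (@le_trans _ _ D); last by rewrite ler_peMr// ge1_powR_ge1.
  apply: le_trans (uB k) _; apply: le_trans (ler_norm _) _.
  rewrite /D (bigD1 (Ordinal (kK : (k < K.+1)%N)))//= addrCA lerDl.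
  by rewrite addr_ge0// ?divr_ge0// ?sumr_ge0// ltW.
elim=> [|k ih]; first exact: early.
have [kK|Kk] := leqP k.+1 K; first exact: early.
apply: le_trans (rec k Kk) _.
apply: (@le_trans _ _ (D * k.+1%:R `^ s)); last first.
  by rewrite ler_wpM2l// ge0_ler_powR// ?nnegrE ?ler0n// ler_nat.
set S := k.+1%:R `^ s in ih *.
have S0' : 0 <= S by exact: powR_ge0.
have h1 : (1 - rho * lam k) * u k <= (1 - rho * lam k) * (D * S).
  by rewrite ler_wpM2l// subr_ge0 lam1.
have DC : C <= rho * D.
  have : C / rho <= D by rewrite lerDl.
  by rewrite ler_pdivrMr// mulrC.
have h2 : C * (lam k * S) <= rho * D * (lam k * S).
  by rewrite ler_wpM2r// mulr_ge0.
nra.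
Qed.

End gradient_descent_rate.

(** * Norms, consensus and objectives *)

Section squared_norms.
Context {R : realType}.

Definition sqn (m : nat) (v : 'cV[R]_m) : R := \sum_(i < m) v i 0 ^+ 2.

Lemma sqn_ge0 m (v : 'cV[R]_m) : 0 <= sqn v.
Proof. by apply: sumr_ge0 => i _; exact: sqr_ge0. Qed.

Lemma norm2_sqr m (v : 'cV[R]_m) : norm2 v ^+ 2 = sqn v.
Proof. by rewrite sqr_sqrtr// sqn_ge0. Qed.

Lemma norm2_ge0 m (v : 'cV[R]_m) : 0 <= norm2 v.
Proof. exact: sqrtr_ge0. Qed.

Lemma coord_sqr_le m (v : 'cV[R]_m) i : v i 0 ^+ 2 <= sqn v.
Proof.
by rewrite /sqn (bigD1 i)//= lerDl; apply: sumr_ge0 => j _; exact: sqr_ge0.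
Qed.

Lemma coord_norm_le m (v : 'cV[R]_m) i : `|v i 0| <= norm2 v.
Proof.
rewrite -ler_sqr ?nnegrE ?norm2_ge0// norm2_sqr real_normK ?num_real//.
exact: coord_sqr_le.
Qed.

Lemma sqnZ m c (v : 'cV[R]_m) : sqn (c *: v) = c ^+ 2 * sqn v.
Proof. by rewrite /sqn mulr_sumr; apply: eq_bigr => i _; rewrite mxE exprMn. Qed.

Lemma sqnN m (v : 'cV[R]_m) : sqn (- v) = sqn v.
Proof. by rewrite -scaleN1r sqnZ sqrrN expr1n mul1r. Qed.

Lemma norm2Z m c (v : 'cV[R]_m) : norm2 (c *: v) = `|c| * norm2 v.
Proof.
apply/eqP; rewrite -(eqrXn2 (n := 2)) ?mulr_ge0 ?norm2_ge0//.
by rewrite exprMn !norm2_sqr sqnZ real_normK ?num_real.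
Qed.

(** Coordinatewise, the right side exceeds the left by s^-1 (s u - v)^2. *)
Lemma sqn_young m (s : R) (u v : 'cV[R]_m) : 0 < s ->
  sqn (u + v) <= (1 + s) * sqn u + (1 + s^-1) * sqn v.
Proof.
move=> s0; rewrite /sqn !mulr_sumr -big_split/=; apply: ler_sum => i _.
rewrite mxE -subr_ge0.
have -> : (1 + s) * u i 0 ^+ 2 + (1 + s^-1) * v i 0 ^+ 2 - (u i 0 + v i 0) ^+ 2
    = s^-1 * (s * u i 0 - v i 0) ^+ 2 by field; rewrite gt_eqF.
by rewrite mulr_ge0 ?sqr_ge0// invr_ge0 ltW.
Qed.

Lemma sqnD2 m (u v : 'cV[R]_m) : sqn (u + v) <= 2 * sqn u + 2 * sqn v.
Proof. by have := sqn_young u v (@ltr01 R); rewrite invr1. Qed.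

(** The squared Frobenius norm times the number of columns. The extra factor comes from
    [sqr_sum_le]; only some bound on the squared operator norm is wanted. *)
Definition frob (m p : nat) (M : 'M[R]_(m, p)) : R :=
  p%:R * \sum_i \sum_j M i j ^+ 2.

Lemma frob_ge0 m p (M : 'M[R]_(m, p)) : 0 <= frob M.
Proof.
rewrite mulr_ge0//; apply: sumr_ge0 => i _; apply: sumr_ge0 => j _.
exact: sqr_ge0.
Qed.

Lemma sqn_mulmx m p (M : 'M[R]_(m, p)) (v : 'cV[R]_p) :
  sqn (M *m v) <= frob M * sqn v.
Proof.
rewrite /frob -mulrA mulr_suml mulr_sumr; apply: ler_sum => i _.
rewrite mxE; apply: le_trans (sqr_sum_le _) _.
rewrite card_ord ler_wpM2l// mulr_suml; apply: ler_sum => j _.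
by rewrite exprMn ler_wpM2l ?sqr_ge0// coord_sqr_le.
Qed.

(** A [sup] over an unbounded set carries no information, so boundedness must be known before the
    operator norm can be used. *)
Lemma mxnorm2_has_ubound m (M : 'M[R]_m) :
  has_ubound [set norm2 (M *m v) | v in [set v : 'cV[R]_m | norm2 v <= 1]].
Proof.
exists (Num.sqrt (frob M)) => _ [u /= u1 <-].
apply: ler_wsqrtr; apply: le_trans (sqn_mulmx _ _) _.
by rewrite -norm2_sqr ler_piMr ?frob_ge0// expr_le1 ?norm2_ge0.
Qed.

Lemma mxnorm2_bound m (M : 'M[R]_m) (v : 'cV[R]_m) :
  norm2 (M *m v) <= mxnorm2 M * norm2 v.
Proof.
have ub := mxnorm2_has_ubound M.
have [v0|v0] := eqVneq (norm2 v) 0.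
  have sv : sqn v = 0 by rewrite -norm2_sqr v0 expr0n.
  rewrite v0 mulr0 -[leRHS]sqrtr0; apply: ler_wsqrtr.
  by apply: le_trans (sqn_mulmx _ _) _; rewrite sv mulr0.
have vp : 0 < norm2 v by rewrite lt_def v0 norm2_ge0.
rewrite -ler_pdivrMr//.
have -> : norm2 (M *m v) / norm2 v = norm2 (M *m ((norm2 v)^-1 *: v)).
  by rewrite -scalemxAr norm2Z ger0_norm ?invr_ge0 ?norm2_ge0// mulrC.
apply: ub_le_sup => //; exists ((norm2 v)^-1 *: v) => //=.
by rewrite norm2Z ger0_norm ?invr_ge0 ?norm2_ge0// mulVf.
Qed.

Lemma mxnorm2_ge0 m (M : 'M[R]_m) : 0 <= mxnorm2 M.
Proof.
have h0 : sqn (0 : 'cV[R]_m) = 0.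
  by rewrite /sqn big1// => i _; rewrite mxE expr0n.
have ub := mxnorm2_has_ubound M.
apply: (le_trans (norm2_ge0 (M *m 0))); apply: ub_le_sup => //; exists 0 => //=.
by rewrite /norm2 -/(sqn _) h0 sqrtr0.
Qed.

End squared_norms.

(** * Consensus errors and their contraction *)

Section consensus.
Context {R : realType} {n : nat}.
Variables (W : 'M[R]_n) (r : 'cV[R]_n).
Hypotheses (W1 : W *m ones R n = ones R n) (rW : r^T *m W = r^T)
  (r1 : \sum_(i < n) r i 0 = 1).

(** The projection onto the kernel of [r^T] along the constant vectors. It commutes with the mixing
    matrices, so consensus errors evolve on their own. *)
Definition Qmx : 'M[R]_n := 1%:M - ones R n *m r^T.

Lemma mulmx_wavg (v : 'cV[R]_n) : r^T *m v = (wavg r v)%:M.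
Proof.
by apply/matrixP => i j; rewrite !ord1 !mxE eqxx mulr1n; apply: eq_bigr => k _; rewrite mxE.
Qed.

Lemma Qmx_mul (v : 'cV[R]_n) : Qmx *m v = v - wavg r v *: ones R n.
Proof.
by rewrite mulmxBl mul1mx -mulmxA mulmx_wavg -scalemx1 -scalemxAr mulmx1.
Qed.

Lemma Qmx_coord (v : 'cV[R]_n) i : (Qmx *m v) i 0 = v i 0 - wavg r v.
Proof. by rewrite Qmx_mul !mxE mulr1. Qed.

Lemma wavgD (u v : 'cV[R]_n) : wavg r (u + v) = wavg r u + wavg r v.
Proof.
by rewrite /wavg -big_split; apply: eq_bigr => i _; rewrite mxE mulrDr.
Qed.

Lemma wavgZ c (v : 'cV[R]_n) : wavg r (c *: v) = c * wavg r v.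
Proof. by rewrite /wavg mulr_sumr; apply: eq_bigr => i _; rewrite mxE mulrCA. Qed.

Lemma wavg_ones : wavg r (ones R n) = 1.
Proof. by rewrite -r1; apply: eq_bigr => i _; rewrite mxE mulr1. Qed.

Lemma wavg_lazy t (v : 'cV[R]_n) : wavg r (lazy_mx W t *m v) = wavg r v.
Proof.
have h : r^T *m (lazy_mx W t *m v) = r^T *m v.
  rewrite mulmxA /lazy_mx mulmxDr -!scalemxAr mulmx1 rW -scalerDl subrK scale1r//.
by move: h; rewrite !mulmx_wavg => /matrixP/(_ 0 0); rewrite !mxE eqxx !mulr1n.
Qed.

Lemma lazy_ones t : lazy_mx W t *m ones R n = ones R n.
Proof. by rewrite mulmxDl -!scalemxAl mul1mx W1 -scalerDl subrK scale1r. Qed.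

Lemma Qmx_lazy t (v : 'cV[R]_n) :
  Qmx *m (lazy_mx W t *m v) = lazy_mx W t *m (Qmx *m v).
Proof. by rewrite !Qmx_mul mulmxBr wavg_lazy -scalemxAr lazy_ones. Qed.

Lemma wavg_Qmx (v : 'cV[R]_n) : wavg r (Qmx *m v) = 0.
Proof. by rewrite Qmx_mul -scaleN1r wavgD !wavgZ wavg_ones mulr1 mulN1r subrr. Qed.

Section contraction.
Variables (A : 'M[R]_n) (rho c : R).
Hypotheses (Au : A \in unitmx) (c0 : 0 < c) (rho0 : 0 < rho)
  (contr : mxnormA A (lazy_mx W c - ones R n *m r^T) <= 1 - c * rho).

Definition sqA (v : 'cV[R]_n) : R := sqn (A *m v).

Lemma sqA_ge0 v : 0 <= sqA v. Proof. exact: sqn_ge0. Qed.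

Lemma crho_le1 : c * rho <= 1.
Proof. by rewrite -subr_ge0; apply: le_trans contr; exact: mxnorm2_ge0. Qed.

(** A consensus error has weighted average 0, so subtracting the rank-one matrix changes nothing on
    it and the assumed norm bound applies. Squaring only helps, as the factor lies in [0, 1). *)
Lemma contraction0 (v : 'cV[R]_n) :
  sqA (lazy_mx W c *m (Qmx *m v)) <= (1 - c * rho) * sqA (Qmx *m v).
Proof.
set x := Qmx *m v.
have xE : lazy_mx W c *m x = (lazy_mx W c - ones R n *m r^T) *m x.
  rewrite mulmxBl -mulmxA mulmx_wavg /x wavg_Qmx.
  by rewrite -scalemx1 scale0r mulmx0 subr0.
rewrite xE; set M := lazy_mx W c - _.
have -> : sqA (M *m x) = norm2 ((A *m M *m invmx A) *m (A *m x)) ^+ 2.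
  by rewrite norm2_sqr /sqA -!mulmxA (mulmxA (invmx A)) mulVmx// mul1mx.
have h := le_trans (mxnorm2_bound (A *m M *m invmx A) (A *m x))
  (ler_wpM2r (norm2_ge0 _) contr).
have crho1 := crho_le1; have crho0 : 0 < c * rho by rewrite mulr_gt0.
have h1 : 0 <= 1 - c * rho by rewrite subr_ge0.
apply: (@le_trans _ _ (((1 - c * rho) * norm2 (A *m x)) ^+ 2)).
  by rewrite ler_sqr ?nnegrE ?mulr_ge0 ?norm2_ge0.
rewrite exprMn norm2_sqr -/(sqA x) ler_wpM2r ?sqA_ge0//.
by rewrite expr2 ler_piMr// lerBlDr lerDl ltW.
Qed.

(* [lazy_mx W t] is a convex combination of the identity and [lazy_mx W c]. *)
Lemma contraction t (v : 'cV[R]_n) : 0 <= t <= c ->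
  sqA (lazy_mx W t *m (Qmx *m v)) <= (1 - t * rho) * sqA (Qmx *m v).
Proof.
move=> /andP[t0 tc]; set x := Qmx *m v.
pose th := t / c.
have th0 : 0 <= th by rewrite divr_ge0// ltW.
have th1 : th <= 1 by rewrite ler_pdivrMr// mul1r.
have tE : t = th * c by rewrite /th divfK ?gt_eqF.
have -> : lazy_mx W t *m x = (1 - th) *: x + th *: (lazy_mx W c *m x).
  rewrite /lazy_mx !mulmxDl -!scalemxAl !mul1mx scalerDr !scalerA addrA -scalerDl -tE.
  by congr (_ *: _ + _); rewrite tE; ring.
apply: (@le_trans _ _ ((1 - th) * sqA x + th * sqA (lazy_mx W c *m x))).
  rewrite /sqA mulmxDr -!scalemxAr /sqn !mulr_sumr -big_split/=.
  apply: ler_sum => i _; rewrite !mxE.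
  set a := \sum_j _; set b := \sum_j _.
  have := mulr_ge0 (mulr_ge0 th0 (_ : 0 <= 1 - th)) (sqr_ge0 (a - b)).
  by rewrite subr_ge0 => /(_ th1) h; rewrite -subr_ge0; apply: le_trans h _;
    rewrite le_eqVlt; apply/orP; left; apply/eqP; ring.
have := ler_wpM2l th0 (contraction0 v); rewrite -/x => h.
rewrite tE -subr_ge0; rewrite -subr_ge0 in h; apply: le_trans h _.
by rewrite le_eqVlt; apply/orP; left; apply/eqP; ring.
Qed.

(** Young with parameter s = t rho / 2: (1 + s)(1 - t rho) <= 1 - t rho / 2, and 1 + 1/s = (t rho +
    2)/(t rho) <= 3/(t rho). *)
Lemma contraction_perturbed t (v w : 'cV[R]_n) : 0 < t <= c ->
  sqA (lazy_mx W t *m (Qmx *m v) + w) <=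
  (1 - t * rho / 2) * sqA (Qmx *m v) + 3 / (t * rho) * sqA w.
Proof.
move=> /andP[t0 tc].
have tr0 : 0 < t * rho by rewrite mulr_gt0.
have tr1 : t * rho <= 1 by apply: le_trans crho_le1; rewrite ler_wpM2r// ltW.
have s0 : 0 < t * rho / 2 by rewrite divr_gt0.
rewrite /sqA mulmxDr; apply: le_trans (sqn_young _ _ s0) _.
rewrite -!/(sqA _); apply: lerD.
  have h := @contraction t v; rewrite (ltW t0) tc in h; have {}h := h isT.
  apply: le_trans (ler_wpM2l _ h) _; first by rewrite addr_ge0// ltW.
  rewrite mulrA ler_wpM2r ?sqA_ge0//; nra.
rewrite ler_wpM2r ?sqA_ge0//.
have -> : 1 + (t * rho / 2)^-1 = (t * rho + 2) / (t * rho).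
  by field; rewrite !gt_eqF.
by rewrite ler_wpM2r ?invr_ge0 ?(ltW tr0)//; lra.
Qed.

End contraction.
End consensus.

(** * Smooth strongly convex objectives *)

Section objective.
Context {R : realType}.

Lemma smooth_is_derive L (f : R -> R) (x : R) : smooth L f -> is_derive x 1 f (derive1 f x).
Proof. by move=> [df _]; rewrite derive1E; apply/derivableP. Qed.

Lemma smooth_continuous L (f : R -> R) : smooth L f -> continuous f.
Proof.
by move=> [df _] x; apply: differentiable_continuous; apply/derivable1_diffP.
Qed.

Lemma smooth_continuous_derive L (f : R -> R) : 0 < L -> smooth L f ->
  continuous (derive1 f).
Proof.
move=> L0 [_ lip] x; apply/cvgrPdist_le => e e0; near=> y.
apply: le_trans (lip x y) _; rewrite -ler_pdivlMl//.
near: y; apply: cvgr_dist_le; first exact: cvg_id.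
by rewrite mulr_gt0// invr_gt0.
Unshelve. all: by end_near. Qed.

(** One application of the mean value theorem; this gives the constant L instead of the sharp L/2,
    which is enough here. *)
Lemma smooth_quadratic L (f : R -> R) x y : 0 < L -> smooth L f ->
  `|f y - f x - derive1 f x * (y - x)| <= L * (y - x) ^+ 2.
Proof.
move=> L0 fL; have cf := smooth_continuous fL.
have mvt a b : a <= b -> exists2 c, a <= c <= b & f b - f a = derive1 f c * (b - a).
  move=> ab; have [||c] := @MVT_segment R f (derive1 f) a b ab.
  - by move=> z _; exact: smooth_is_derive fL.
  - exact: continuous_subspaceT.
  - by rewrite in_itv/= => h ->; exists c.
have [c hc ->] : exists2 c, `|c - x| <= `|y - x| & f y - f x = derive1 f c * (y - x).
  have [xy|/ltW yx] := leP x y.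
    have [c /andP[c1 c2] e] := mvt _ _ xy; exists c => //.
    by rewrite !ger0_norm ?subr_ge0// lerD2r.
  have [c /andP[c1 c2] e] := mvt _ _ yx; exists c.
    by rewrite !ler0_norm ?subr_le0// !opprB lerD2l lerN2.
  by rewrite -opprB e -mulrN opprB.
rewrite -mulrBl normrM -[(y - x) ^+ 2]real_normK ?num_real// expr2 mulrA ler_wpM2r//.
by apply: le_trans (fL.2 _ _) _; rewrite ler_wpM2l// ltW.
Qed.

(** Strong convexity is applied at x + t h, with h = y - x, and f(x + t h) is compared with its
    tangent by [smooth_quadratic]. Dividing by t leaves an error of order t, and t tends to 0. *)
Lemma strongly_convex_tangent mu L (f : R -> R) x y :
  0 < mu -> 0 < L -> smooth L f -> strongly_convex mu f ->
  f x + derive1 f x * (y - x) + mu / 2 * (y - x) ^+ 2 <= f y.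
Proof.
move=> mu0 L0 fL cf.
set D := derive1 f x; set h := y - x.
have key t : 0 < t <= 1 -> D * h + mu / 2 * h ^+ 2 - (f y - f x) <= t * ((mu / 2 + L) * h ^+ 2).
  move=> /andP[t0 t1].
  have := smooth_quadratic x (x + t * h) L0 fL.
  have -> : x + t * h - x = t * h by ring.
  rewrite ler_norml => /andP[h1 _].
  have := cf y x t; rewrite (ltW t0) t1 => /(_ isT).
  have -> : t * y + (1 - t) * x = x + t * h by rewrite /h; ring.
  rewrite -/h => h2.
  rewrite -/D in h1.
  rewrite -(ler_pM2l t0).
  have {}h1 : D * (t * h) - L * (t * h) ^+ 2 <= f (x + t * h) - f x by lra.
  set v := f (x + t * h) in h1 h2.
  have e1 : t * (D * h + mu / 2 * h ^+ 2 - (f y - f x)) =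
    D * (t * h) - L * (t * h) ^+ 2 + L * (t * h) ^+ 2 + t * (mu / 2 * h ^+ 2) - t * (f y - f x).
    by ring.
  have e2 : t * (t * ((mu / 2 + L) * h ^+ 2)) =
    L * (t * h) ^+ 2 + t * (mu / 2 * h ^+ 2) - mu / 2 * t * (1 - t) * h ^+ 2.
    by ring.
  rewrite e1 e2.
  have {}h2 : v - f x <= t * (f y - f x) - mu / 2 * t * (1 - t) * h ^+ 2 by lra.
  lra.
have C0 : 0 <= (mu / 2 + L) * h ^+ 2.
  by rewrite mulr_ge0 ?sqr_ge0// addr_ge0 ?divr_ge0 ?ltW.
suff : D * h + mu / 2 * h ^+ 2 - (f y - f x) <= 0 by lra.
apply/ler_addgt0Pr => e e0; rewrite add0r.
set C := (mu / 2 + L) * h ^+ 2 in C0 key.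
have C1 : 0 < C + 1 by rewrite ltr_wpDl.
(* The added 1 avoids dividing by zero when [C] vanishes. *)
pose t := Num.min 1 (e / (C + 1)).
have t0 : 0 < t by rewrite lt_min ltr01 divr_gt0.
have t1 : t <= 1 by rewrite ge_min lexx.
apply: le_trans (key t _) _; first by rewrite t0 t1.
have te : t <= e / (C + 1) by rewrite ge_min lexx orbT.
rewrite ler_pdivlMr// in te; apply: le_trans te.
by rewrite ler_wpM2l ?ltW// ltrDl.
Qed.

Variables (n : nat) (f : 'I_n -> R -> R) (mu L xstar : R).
Hypotheses (n0 : (0 < n)%N) (mu0 : 0 < mu) (L0 : 0 < L)
  (fc : forall i, strongly_convex mu (f i)) (fs : forall i, smooth L (f i))
  (xmin : forall x, mean_objective f xstar <= mean_objective f x).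

Definition mean_grad (x : R) : R := n%:R^-1 * \sum_(i < n) derive1 (f i) x.

Let nR : 0 < n%:R :> R. Proof. by rewrite ltr0n. Qed.

Lemma mean_of_const c : n%:R^-1 * \sum_(i < n) c = c :> R.
Proof. by rewrite sumr_const card_ord -[c *+ n]mulr_natl mulKf// gt_eqF. Qed.

Lemma mean_objective_tangent x y :
  mean_objective f x + mean_grad x * (y - x) + mu / 2 * (y - x) ^+ 2
    <= mean_objective f y.
Proof.
rewrite -[mu / 2 * _]mean_of_const /mean_grad /mean_objective.
rewrite -(mulrA n%:R^-1 _ (y - x)) mulr_suml -!mulrDr -!big_split/=.
rewrite ler_wpM2l ?invr_ge0//; apply: ler_sum => i _.
exact: (strongly_convex_tangent x y mu0 L0 (fs i) (fc i)).
Qed.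

Lemma mean_objective_quadratic x y :
  mean_objective f y <=
  mean_objective f x + mean_grad x * (y - x) + L * (y - x) ^+ 2.
Proof.
rewrite -[L * _]mean_of_const /mean_grad /mean_objective.
rewrite -(mulrA n%:R^-1 _ (y - x)) mulr_suml -!mulrDr -!big_split/=.
rewrite ler_wpM2l ?invr_ge0//; apply: ler_sum => i _.
have := smooth_quadratic x y L0 (fs i); rewrite ler_norml => /andP[_]; lra.
Qed.

(** A gradient step of length 1/(2L) from the minimizer would lower the objective by at least
    g^2/(4L), so g = 0. *)
Lemma mean_grad_min : mean_grad xstar = 0.
Proof.
set g := mean_grad xstar.
have := mean_objective_quadratic xstar (xstar - g / (2 * L)).
have := xmin (xstar - g / (2 * L)).
have -> : xstar - g / (2 * L) - xstar = - (g / (2 * L)) by ring.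
rewrite -/g => h1 h2.
have h3 : 0 <= g * (- (g / (2 * L))) + L * (- (g / (2 * L))) ^+ 2 by lra.
have e : g * (- (g / (2 * L))) + L * (- (g / (2 * L))) ^+ 2 = - (g ^+ 2 / (4 * L)).
  by field; rewrite gt_eqF.
rewrite e oppr_ge0 pmulr_lle0 ?invr_gt0 ?mulr_gt0// in h3.
by apply/eqP; rewrite -sqrf_eq0 eq_le h3 sqr_ge0.
Qed.

Lemma mean_objective_gap x :
  mean_objective f x - mean_objective f xstar <= L * (x - xstar) ^+ 2.
Proof.
have := mean_objective_quadratic xstar x; rewrite mean_grad_min mul0r; lra.
Qed.

(** The sum of the tangent inequalities at [x] and at [xstar]. *)
Lemma mean_grad_coercive x : mu * (x - xstar) ^+ 2 <= mean_grad x * (x - xstar).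
Proof.
have := mean_objective_tangent xstar x; have := mean_objective_tangent x xstar.
rewrite mean_grad_min mul0r -(opprB x xstar) sqrrN; lra.
Qed.

Lemma mean_grad_lip x : `|mean_grad x| <= L * `|x - xstar|.
Proof.
have -> : mean_grad x = mean_grad x - mean_grad xstar by rewrite mean_grad_min subr0.
rewrite /mean_grad -mulrBr -sumrB normrM gtr0_norm ?invr_gt0//.
rewrite -[leRHS]mean_of_const ler_wpM2l ?invr_ge0//.
apply: le_trans (ler_norm_sum _ _ _) _; apply: ler_sum => i _; exact: (fs i).2.
Qed.

(** Convexity of the square at v/(1-t) and -w/t, with weights 1-t and t. *)
Lemma convex_sqrB (v w t : R) : 0 < t -> t < 1 ->
  (v - w) ^+ 2 <= (1 - t)^-1 * v ^+ 2 + t^-1 * w ^+ 2.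
Proof.
move=> t0 t1; have q0 : 0 < 1 - t by rewrite subr_gt0.
have e : (1 - t)^-1 * v ^+ 2 + t^-1 * w ^+ 2 - (v - w) ^+ 2 =
    t / (1 - t) * (v + (1 - t) / t * w) ^+ 2.
  by field; rewrite !gt_eqF.
by rewrite -subr_ge0 e mulr_ge0 ?sqr_ge0// divr_ge0// ltW.
Qed.

(** In dimension one the gradient has the sign of u = x - xstar and modulus between mu |u| and L
    |u|, so a step with a L <= 1 does not overshoot and contracts by 1 - a mu. Splitting off [e]
    with weight t = a mu costs one factor 1 - a mu of the square and leaves a / mu before e^2. *)
Lemma mean_grad_step x (a e : R) : 0 < a -> a * L <= 1 -> a * mu < 1 ->
  (x - xstar - a * (mean_grad x + e)) ^+ 2 <=
  (1 - a * mu) * (x - xstar) ^+ 2 + a / mu * e ^+ 2.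
Proof.
move=> a0 aL am.
have := mean_grad_coercive x; have := mean_grad_lip x.
set u := x - xstar; set g := mean_grad x => gL gu.
have step : (u - a * g) ^+ 2 <= ((1 - a * mu) * u) ^+ 2.
  rewrite -[leLHS]real_normK ?num_real// -[leRHS]real_normK ?num_real//.
  rewrite ler_sqr ?nnegrE// normrM (gtr0_norm (_ : 0 < 1 - a * mu)) ?subr_gt0//.
  have [u0|u0|u0] := ltgtP u 0.
  - rewrite (ltr0_norm u0) in gL *; have := ler_norm (- g); rewrite normrN => gn.
    have g1 : g <= mu * u.
      by rewrite -(ler_nM2r u0); apply: le_trans gu; rewrite expr2 mulrA.
    rewrite ler_norml; apply/andP; split; nra.
  - rewrite (gtr0_norm u0) in gL *; have gn := ler_norm g.
    have g1 : mu * u <= g.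
      by rewrite -(ler_pM2r u0); apply: le_trans gu; rewrite expr2 mulrA.
    rewrite ler_norml; apply/andP; split; nra.
  - rewrite u0 normr0 mulr0 in gL; have /eqP : `|g| = 0 by apply/eqP; rewrite eq_le gL normr_ge0.
    by rewrite normr_eq0 u0 => /eqP ->; rewrite mulr0 subrr normr0 mulr0.
have q0 : 0 < 1 - a * mu by rewrite subr_gt0.
have amu0 : 0 < a * mu by rewrite mulr_gt0.
have -> : u - a * (g + e) = (u - a * g) - a * e by ring.
set v := u - a * g in step *.
have young := convex_sqrB v (a * e) amu0 am.
apply: le_trans young _; apply: lerD.
  rewrite mulrC ler_pdivrMr//; apply: le_trans step _.
  by rewrite le_eqVlt; apply/orP; left; apply/eqP; ring.
by rewrite le_eqVlt; apply/orP; left; apply/eqP; field; rewrite !gt_eqF.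
Qed.

End objective.

(** * Measurability and square integrability of the iterates *)

Section measurability.
Context d (T : measurableType d) (R : realType).

Lemma measurable_fun_sumR (I : Type) (s : seq I) (F : I -> T -> R) :
  (forall i, measurable_fun setT (F i)) ->
  measurable_fun setT (fun w => \sum_(i <- s) F i w).
Proof.
move=> mF; elim: s => [|i s ih].
  by under eq_fun do rewrite big_nil; exact: measurable_cst.
by under eq_fun do rewrite big_cons; exact: measurable_funD.
Qed.

Lemma measurable_fun_Zl c (f : T -> R) :
  measurable_fun setT f -> measurable_fun setT (fun w => c * f w).
Proof. by move=> mf; exact: measurable_funM. Qed.

Variables (n : nat) (p : RXi_parameters R n) (N : T -> noise_realization R n).
Hypothesis eps0 : 0 < eps_kappa p.

Notation st w k := (RXi p (N w) k).

(** The measurable structure on [T] is arbitrary: the lemma serves both for the given sigma-algebra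
    and for those that omit one noise. The bound [j < k] records that the state at time k has seen
    only earlier noise. *)
Lemma RXi_y_measurable k :
  (forall i j l, (j < k)%N -> measurable_fun setT (fun w => noise_y (N w) i j l 0)) ->
  (forall i l, measurable_fun setT (fun w => y_ (st w k) i l 0)) /\
  (forall i, measurable_fun setT (fun w => kappa_prev (st w k) i)).
Proof.
elim: k => [|k ih] mN; first by split => *; exact: measurable_cst.
have [my mk] := ih (fun i j l jk => mN i j l (ltnW jk)).
have my' i l : measurable_fun setT (fun w => y_ (st w k.+1) i l 0).
  rewrite [X in measurable_fun _ X](_ : _ = fun w =>
    (1 - lambda p k) * y_ (st w k) i l 0 +
    lambda p k * (\sum_j weights p i j * y_ (st w k) j l 0 + noise_y (N w) i k l 0)
    + gamma p k * (delta_mx i 0 : 'cV[R]_n) l 0); last first.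
    apply/funext => w /=; rewrite !mxE summxE; congr (_ + _ * (_ + _) + _).
    by apply: eq_bigr => j _; rewrite mxE.
  apply: measurable_funD => //; apply: measurable_funD.
    exact: measurable_fun_Zl.
  apply: measurable_fun_Zl; apply: measurable_funD; last exact: mN.
  by apply: measurable_fun_sumR => j; exact: measurable_fun_Zl.
split => // i.
(* The quotient becomes a power with exponent -1, a measurable function of its base; the two agree
   where the threshold test succeeds, since the denominator is positive there. *)
rewrite [X in measurable_fun _ X](_ : _ = fun w =>
  if eps_kappa p < y_ (st w k.+1) i i 0 then
    (\sum_j y_ (st w k.+1) i j 0) * (n%:R * y_ (st w k.+1) i i 0) `^ (-1)
  else kappa_prev (st w k) i); last first.
  apply/funext => w /=; case: ifPn => // h; congr (_ * _).
  rewrite powR_inv1// mulr_ge0// ltW//; exact: lt_trans h.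
apply: measurable_fun_ifT => //; first exact: measurable_fun_ltr.
apply: measurable_funM; first exact: measurable_fun_sumR.
apply: (measurableT_comp (measurable_powR _)).
exact: measurable_fun_Zl.
Qed.

Hypothesis mdf : forall i, measurable_fun setT (derive1 (objective p i)).

Lemma RXi_xz_measurable k :
  (forall i j l, (j < k)%N -> measurable_fun setT (fun w => noise_y (N w) i j l 0)) ->
  (forall i j, (j < k)%N -> measurable_fun setT (fun w => noise_x (N w) i j)) ->
  (forall i j, (j < k)%N -> measurable_fun setT (fun w => noise_z (N w) i j)) ->
  (forall i, measurable_fun setT (fun w => x_ (st w k) i 0)) /\
  (forall i, measurable_fun setT (fun w => z_ (st w k) i 0)).
Proof.
elim: k => [|k ih] mNy mNx mNz; first by split => *; exact: measurable_cst.
have [mx mz] := ih (fun i j l jk => mNy i j l (ltnW jk))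
  (fun i j jk => mNx i j (ltnW jk)) (fun i j jk => mNz i j (ltnW jk)).
have [_ mk] := RXi_y_measurable mNy.
have mz' i : measurable_fun setT (fun w => z_ (st w k.+1) i 0).
  rewrite [X in measurable_fun _ X](_ : _ = fun w =>
    (1 - beta p k) * z_ (st w k) i 0 +
    beta p k * (\sum_j weights p i j * z_ (st w k) j 0 + noise_z (N w) i k)
    + alpha p k * kappa_prev (st w k.+1) i * derive1 (objective p i) (x_ (st w k) i 0));
    last by apply/funext => w /=; rewrite !mxE.
  apply: measurable_funD.
    apply: measurable_funD; first exact: measurable_fun_Zl.
    apply: measurable_fun_Zl; apply: measurable_funD; last exact: mNz.
    by apply: measurable_fun_sumR => j; exact: measurable_fun_Zl.
  apply: measurable_funM; first exact: measurable_fun_Zl.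
  exact: measurableT_comp.
split => // i.
rewrite [X in measurable_fun _ X](_ : _ = fun w =>
  (1 - beta p k) * x_ (st w k) i 0 +
  beta p k * (\sum_j weights p i j * x_ (st w k) j 0 + noise_x (N w) i k)
  - (z_ (st w k.+1) i 0 - z_ (st w k) i 0)); last first.
  by apply/funext => w /=; rewrite !mxE.
apply: measurable_funB; last exact: measurable_funB.
apply: measurable_funD; first exact: measurable_fun_Zl.
apply: measurable_fun_Zl; apply: measurable_funD; last exact: mNx.
by apply: measurable_fun_sumR => j; exact: measurable_fun_Zl.
Qed.

Section square_integrability.
Variables (P : probability T R) (L CK : R).
Hypotheses (L0 : 0 < L)
  (lip : forall i x y,
    `|derive1 (objective p i) x - derive1 (objective p i) y| <= L * `|x - y|)
  (mNy : forall i j l, measurable_fun setT (fun w => noise_y (N w) i j l 0))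
  (kbd : forall k i, {ae P, forall w, `|kappa_prev (st w k) i| <= CK})
  (Nx2 : forall i j, L2 P (fun w => noise_x (N w) i j))
  (Nz2 : forall i j, L2 P (fun w => noise_z (N w) i j)).

Lemma L2_grad i (X : T -> R) : L2 P X ->
  L2 P (fun w => derive1 (objective p i) (X w)).
Proof.
move=> X2.
apply: (@L2_le_ae _ _ _ P _
  (fun w => `|derive1 (objective p i) 0| + L * `|X w|)).
- by apply: measurableT_comp => //; case: X2.
- by apply: L2D; [exact: L2_cst|exact/L2Z/L2_norm].
apply: nearW => w; rewrite addrC -lerBlDr; apply: le_trans (lerB_dist _ _) _.
by apply: le_trans (lip _ _ _) _; rewrite subr0.
Qed.

Lemma L2_kappa_grad k i (X : T -> R) : L2 P X ->
  L2 P (fun w => kappa_prev (st w k) i * derive1 (objective p i) (X w)).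
Proof.
move=> X2; apply: (L2_bddM _ (kbd k i)); last exact: L2_grad.
by have [] := @RXi_y_measurable k (fun i j l _ => mNy i j l).
Qed.

(** Second moments propagate because gradients grow at most linearly and the weights are almost
    surely bounded. No uniformity in k is claimed. *)
Lemma RXi_xz_L2 k :
  (forall i, L2 P (fun w => x_ (st w k) i 0)) /\
  (forall i, L2 P (fun w => z_ (st w k) i 0)).
Proof.
elim: k => [|k [x2 z2]]; first by split => i; exact: L2_cst.
have z2' i : L2 P (fun w => z_ (st w k.+1) i 0).
  apply: (@L2_ext _ _ _ P (fun w =>
    (1 - beta p k) * z_ (st w k) i 0 +
    beta p k * (\sum_j weights p i j * z_ (st w k) j 0 + noise_z (N w) i k)
    + alpha p k * (kappa_prev (st w k.+1) i * derive1 (objective p i) (x_ (st w k) i 0)))).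
    by move=> w /=; rewrite !mxE mulrA.
  apply: L2D; last by apply/L2Z/L2_kappa_grad.
  apply: L2D; first exact: L2Z.
  by apply/L2Z/L2D => //; apply: L2_sum => j; exact: L2Z.
split => // i.
apply: (@L2_ext _ _ _ P (fun w =>
  (1 - beta p k) * x_ (st w k) i 0 +
  beta p k * (\sum_j weights p i j * x_ (st w k) j 0 + noise_x (N w) i k)
  - (z_ (st w k.+1) i 0 - z_ (st w k) i 0))).
  by move=> w /=; rewrite !mxE.
apply: L2B; last exact: L2B.
apply: L2D; first exact: L2Z.
by apply/L2Z/L2D => //; apply: L2_sum => j; exact: L2Z.
Qed.

End square_integrability.
End measurability.

(** * The Perron weight estimates *)

Section kappa_estimate.
Context {R : realType} {n : nat}.

(** With eta_j = y_j - r_j G and the r_j summing to 1, the difference equals (r_i sum_j eta_j -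
    eta_i)/(n r_i y_i). It is linear in the errors, and the hypothesis on y_i keeps its denominator
    of order G. *)
Lemma ratio_error (i : 'I_n) (r y : 'I_n -> R) (G : R) :
  (forall j, 0 < r j) -> (forall j, r j <= 1) -> \sum_j r j = 1 -> 0 < G ->
  r i * G / 2 <= y i ->
  ((\sum_j y j) / (n%:R * y i) - 1 / (n%:R * r i)) ^+ 2 <=
  (2 * n%:R + 2) * 4 / (n%:R ^+ 2 * r i ^+ 4 * G ^+ 2)
    * \sum_j (y j - r j * G) ^+ 2.
Proof.
move=> r0 r1 rs G0 hy.
have n0 : 0 < n%:R :> R by rewrite ltr0n; case: i {hy} => m /(leq_ltn_trans _); apply.
have ri0 := r0 i.
have y0 : 0 < y i by apply: lt_le_trans hy; rewrite divr_gt0// mulr_gt0.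
pose eta j := y j - r j * G.
have sE : \sum_j y j = G + \sum_j eta j.
  by rewrite /eta sumrB -mulr_suml rs mul1r addrC subrK.
set E := \sum_j _ ^+ 2.
have -> : (\sum_j y j) / (n%:R * y i) - 1 / (n%:R * r i) =
    (r i * \sum_j eta j - eta i) / (n%:R * r i * y i).
  by rewrite sE /eta; field; rewrite !gt_eqF.
have E0 : 0 <= E by apply: sumr_ge0 => j _; exact: sqr_ge0.
have num : (r i * \sum_j eta j - eta i) ^+ 2 <= (2 * n%:R + 2) * E.
  set S := \sum_j eta j.
  have S2 : S ^+ 2 <= n%:R * E by rewrite /S (le_trans (sqr_sum_le _))// card_ord.
  have eE : eta i ^+ 2 <= E.
    by rewrite /E (bigD1 i)//= lerDl; apply: sumr_ge0 => j _; exact: sqr_ge0.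
  have rS : (r i * S) ^+ 2 <= S ^+ 2.
    by rewrite exprMn ler_piMl ?sqr_ge0// expr_le1// ltW.
  have := sqr_ge0 (r i * S + eta i).
  have -> : (r i * S + eta i) ^+ 2 = 2 * (r i * S) ^+ 2 + 2 * eta i ^+ 2
     - (r i * S - eta i) ^+ 2 by ring.
  by move=> h; lra.
have den : (n%:R * r i * (r i * G / 2)) ^+ 2 <= (n%:R * r i * y i) ^+ 2.
  rewrite ler_sqr ?nnegrE; first by rewrite ler_wpM2l// mulr_ge0// ltW.
    by rewrite !mulr_ge0// ?invr_ge0// ltW.
  by rewrite !mulr_ge0// ltW.
have d0 : 0 < n%:R * r i * (r i * G / 2) by rewrite !mulr_gt0// invr_gt0.
have d1 : 0 < n%:R * r i * y i by rewrite !mulr_gt0.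
rewrite expr_div_n ler_pdivrMr ?exprn_gt0//.
apply: le_trans num _.
have -> : (2 * n%:R + 2) * 4 / (n%:R ^+ 2 * r i ^+ 4 * G ^+ 2) * E =
   (2 * n%:R + 2) * E * ((n%:R * r i * (r i * G / 2)) ^+ 2)^-1.
  by field; rewrite !gt_eqF.
rewrite -[leRHS]mulrA; apply: ler_peMr; first by rewrite mulr_ge0// addr_ge0// mulr_ge0.
by rewrite mulrC ler_pdivlMr ?exprn_gt0// mul1r.
Qed.

End kappa_estimate.

Section y_dynamics.
Context {R : realType} {n : nat}.
Variables (pr : RXi_parameters R n) (r : 'cV[R]_n) (A : 'M[R]_n) (rho c : R)
  (cl cg p q sy : R).
Local Notation W := (weights pr).
Hypotheses (W0 : forall i j, 0 <= W i j)
  (W1 : W *m ones R n = ones R n) (rW : r^T *m W = r^T)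
  (r0 : forall i, 0 < r i 0) (r1 : \sum_(i < n) r i 0 = 1)
  (Au : A \in unitmx) (c0 : 0 < c) (rho0 : 0 < rho)
  (contr : mxnormA A (lazy_mx W c - ones R n *m r^T) <= 1 - c * rho)
  (scaleA : forall v : 'cV[R]_n, norm2 v <= normA A v)
  (lamE : lambda pr = power_gain cl p) (gamE : gamma pr = power_gain cg q)
  (cl01 : 0 < cl <= 1) (cg0 : 0 < cg) (q0 : 0 < q) (qp : q < p) (p1 : p < 1)
  (sy0 : 0 <= sy) (eps0 : 0 < eps_kappa pr).

Let p0 : 0 < p. Proof. exact: lt_trans qp. Qed.
Let cl0 : 0 < cl. Proof. by case/andP: cl01. Qed.
Let lam01 k : 0 <= lambda pr k <= 1.
Proof.
rewrite lamE power_gain_ge0 ?(ltW cl0)//=; case/andP: cl01 => _; apply: le_trans.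
by rewrite power_gain_le// ltW.
Qed.
Let gam0 k : 0 <= gamma pr k. Proof. by rewrite gamE power_gain_ge0// ltW. Qed.
Let gam1 k : gamma pr k <= cg. Proof. by rewrite gamE power_gain_le// ltW. Qed.

Let Wsum i : \sum_j W i j = 1.
Proof.
have := W1; move/matrixP/(_ i 0); rewrite !mxE => <-.
by apply: eq_bigr => j _; rewrite mxE mulr1.
Qed.

Lemma perron_le1 i : r i 0 <= 1.
Proof.
rewrite -r1 (bigD1 i)//= lerDl; apply: sumr_ge0 => j _; exact: ltW.
Qed.

Section pathwise.
Variable e : noise_realization R n.
Hypothesis he : forall i k, norm2 (noise_y e i k) <= sy.
Local Notation st k := (RXi pr e k).

(** The entry l of all agents as one vector: the y-iteration splits into n separate scalar consensus
    iterations, one for each l. *)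
Definition ycol k (l : 'I_n) : 'cV[R]_n := \col_i y_ (st k) i l 0.
Definition ecol k (l : 'I_n) : 'cV[R]_n := \col_i noise_y e i k l 0.

Lemma ycolS k l : ycol k.+1 l =
  lazy_mx W (lambda pr k) *m ycol k l
  + (lambda pr k *: ecol k l + gamma pr k *: delta_mx l 0).
Proof.
apply/colP => i; rewrite /lazy_mx mulmxDl -!scalemxAl mul1mx !mxE /= summxE.
rewrite eqxx !andbT eq_sym addrA; congr (_ + _).
rewrite mulrDr addrA; congr (_ + _ * _ + _).
by apply: eq_bigr => j _; rewrite !mxE.
Qed.

(** A crude linear growth bound, used only to control finitely many initial times. *)
Definition ybound (k : nat) : R := 1 + k%:R * (sy + cg).

Lemma ybound_ge0 k : 0 <= ybound k.
Proof. by rewrite addr_ge0// mulr_ge0// addr_ge0// ltW. Qed.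

Lemma y_le_ybound k i l : `|y_ (st k) i l 0| <= ybound k.
Proof.
elim: k i l => [|k ih] i l.
  by rewrite /ybound mul0r addr0 /= mxE; case: (_ && _); rewrite ?normr1 ?normr0.
rewrite /= !mxE summxE.
have /andP[l0 l1] := lam01 k.
have hW : `|\sum_j (W i j *: y_ (st k) j) l 0| <= ybound k.
  apply: le_trans (ler_norm_sum _ _ _) _.
  rewrite -[leRHS]mul1r -(Wsum i) mulr_suml; apply: ler_sum => j _.
  by rewrite mxE normrM (ger0_norm (W0 i j)) ler_wpM2l.
have hN : `|noise_y e i k l 0| <= sy by apply: le_trans (coord_norm_le _ _) _.
have hd : `|(((l == i) && (0 == 0 :> 'I_1))%:R : R)| <= 1.
  by case: (_ && _); rewrite ?normr1 ?normr0.
apply: le_trans (ler_normD _ _) _.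
rewrite (normrM (gamma _ _)) (ger0_norm (gam0 k)).
apply: (@le_trans _ _ ((1 - lambda pr k) * ybound k + lambda pr k * (ybound k + sy) + cg)).
  apply: lerD; last first.
    by apply: le_trans (gam1 k); rewrite ler_piMr.
  apply: le_trans (ler_normD _ _) _; apply: lerD.
    by rewrite normrM ger0_norm ?subr_ge0// ler_wpM2l// subr_ge0.
  rewrite normrM ger0_norm// ler_wpM2l//.
  by apply: le_trans (ler_normD _ _) _; apply: lerD.
rewrite /ybound -natr1 mulrDl mul1r.
have : lambda pr k * sy <= sy by rewrite ler_piMl.
lra.
Qed.

(** The sum appears because a weight may be retained from any earlier time. A freshly computed
    weight is at most [ybound / eps_kappa], as its denominator exceeds n times the threshold. *)
Lemma kappa_crude k i :
  `|kappa_prev (st k) i| <= \sum_(j < k.+1) ybound j / eps_kappa pr.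
Proof.
elim: k => [|k ih]; first by rewrite normr0 sumr_ge0// => j _; rewrite divr_ge0 ?ybound_ge0// ltW.
rewrite big_ord_recr/=.
set S := \sum_(j < k.+1) _ in ih *.
have S0 : 0 <= S by apply: sumr_ge0 => j _; rewrite divr_ge0 ?ybound_ge0// ltW.
case: ifPn => [hy|_]; last first.
  by apply: le_trans ih _; rewrite lerDl divr_ge0 ?ybound_ge0// ltW.
have n0 : 0 < n%:R :> R by rewrite ltr0n; case: (i) => m /(leq_ltn_trans _); apply.
set y := (_ + _) in hy *; have y0 : 0 < y i 0 by exact: lt_trans hy.
apply: (@le_trans _ _ (ybound k.+1 / eps_kappa pr)); last by rewrite lerDr.
rewrite normrM normfV (gtr0_norm (_ : 0 < n%:R * y i 0)) ?mulr_gt0//.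
rewrite ler_pdivrMr ?mulr_gt0//.
apply: (@le_trans _ _ (n%:R * ybound k.+1)).
  apply: le_trans (ler_norm_sum _ _ _) _.
  rewrite mulr_natl -[X in _ *+ X](card_ord n) -sumr_const; apply: ler_sum => j _.
  exact: (y_le_ybound k.+1).
rewrite [leRHS]mulrC -mulrA ler_wpM2l// [leRHS]mulrCA -[leLHS]mulr1.
rewrite ler_wpM2l ?ybound_ge0// ler_pdivlMr// mul1r ltW//.
Qed.

(** The accumulated weighted noise. Pathwise it is of the size of the sum of the lambda_j; its
    variance is only of the size of the sum of their squares. *)
Definition ymart k (l : 'I_n) : R := \sum_(j < k) lambda pr j * wavg r (ecol j l).
Definition gsum k : R := 1 + \sum_(j < k) gamma pr j.

Lemma wavg_delta l : wavg r (delta_mx l 0) = r l 0.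
Proof.
rewrite /wavg (bigD1 l)//= mxE !eqxx mulr1 big1 ?addr0// => i il.
by rewrite mxE (negbTE il) mulr0.
Qed.

(** Mixing preserves the r-weighted average, so only the initial value, the injections gamma_j and
    the noise contribute to it. *)
Lemma wavg_ycol k l : wavg r (ycol k l) = r l 0 * gsum k + ymart k l.
Proof.
elim: k => [|k ih].
  rewrite /gsum /ymart !big_ord0 !addr0 mulr1 -wavg_delta; congr wavg.
  by apply/colP => i; rewrite !mxE eq_sym.
rewrite ycolS !wavgD !wavgZ wavg_lazy// ih wavg_delta /gsum /ymart !big_ord_recr/=.
ring.
Qed.

Lemma ymart_le k l : `|ymart k l| <= sy * (cl * ((1 + (1 - p)) / (1 - p))) * k.+1%:R `^ (1 - p).
Proof.
have p1' : 0 < 1 - p by rewrite subr_gt0.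
apply: le_trans (ler_norm_sum _ _ _) _.
apply: (@le_trans _ _ (\sum_(j < k) sy * (cl * j.+1%:R `^ ((1 - p) - 1)))).
  apply: ler_sum => j _; rewrite normrM mulrC.
  have /andP[l0 _] := lam01 j; rewrite (ger0_norm l0).
  have -> : cl * j.+1%:R `^ (1 - p - 1) = lambda pr j.
    by rewrite lamE power_gainE addrAC subrr add0r.
  rewrite ler_wpM2r//.
  apply: le_trans (ler_norm_sum _ _ _) _.
  rewrite -[leRHS]mul1r -r1 mulr_suml; apply: ler_sum => i _.
  rewrite normrM (gtr0_norm (r0 i)) ler_wpM2l ?(ltW (r0 i))// mxE.
  by apply: le_trans (coord_norm_le _ _) _.
rewrite -mulr_sumr -mulr_sumr -!mulrA ler_wpM2l// ler_wpM2l ?(ltW cl0)//.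
rewrite !mulrA; apply: le_trans (sum_powR_le _ p1') _.
rewrite ler_wpM2l//; first by rewrite divr_ge0 ?(ltW p1')// addr_ge0// ltW.
by rewrite ge0_ler_powR ?nnegrE ?ler0n ?ler_nat// ltW.
Qed.

(** Each of the k terms is at least cg (k+1)^-q, and the initial 1 stands in for the missing term
    number k+1. *)
Lemma gsum_ge k : Num.min 1 cg * k.+1%:R `^ (1 - q) <= gsum k.
Proof.
set m := Num.min 1 cg.
have m1 : m <= 1 by rewrite ge_min lexx.
have mc : m <= cg by rewrite ge_min lexx orbT.
have m0 : 0 <= m by rewrite le_min ler01 ltW.
have E : k.+1%:R `^ (1 - q) = k.+1%:R `^ (- q) + k%:R * k.+1%:R `^ (- q) :> R.
  by rewrite natS_powRD powRr1// -natr1; ring.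
rewrite E mulrDr; apply: lerD.
  apply: le_trans m1; rewrite ler_piMr// powRN invf_le1 ?powR_natS_gt0//.
  by rewrite ge1_powR_ge1// ltW.
rewrite mulrCA mulr_natl -[X in _ *+ X](card_ord k) -sumr_const.
apply: ler_sum => j _; rewrite gamE power_gainE.
apply: ler_pM => //.
rewrite !powRN lef_pV2 ?posrE ?powR_natS_gt0//.
by apply: ge0_ler_powR; rewrite ?nnegrE ?ler0n ?(ltW q0)// ler_nat ltnS ltnW.
Qed.

(** The constant that [growing_supersolution] returns: forcing divided by half the contraction rate,
    plus the crude bounds at times up to [K]. *)
Definition ydevC (K : nat) : R :=
  (3 / rho * (2 * frob (A *m Qmx r) * (n%:R * sy ^+ 2 + (cg / cl) ^+ 2))) / (rho / 2)
  + \sum_(j < K.+1) `|frob (A *m Qmx r) * (n%:R * ybound j ^+ 2)|.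

(** The squared perturbation is of order lambda^2 + gamma^2, hence at most of order lambda^2
    k^(2(p-q)). The Young factor 3/(lambda rho) turns this into lambda times a growing power. The
    assumption on [K] brings lambda_k into the range where the contraction is known. *)
Lemma ydev_le K : (forall k, (K <= k)%N -> lambda pr k <= c) ->
  forall k l, sqA A (Qmx r *m ycol k l) <= ydevC K * k.+1%:R `^ (2 * (p - q)).
Proof.
move=> hK k l.
have F0 : 0 <= frob (A *m Qmx r) by exact: frob_ge0.
have pq0 : 0 <= 2 * (p - q) by rewrite mulr_ge0// subr_ge0 ltW.
apply: (@growing_supersolution _ (fun k => sqA A (Qmx r *m ycol k l)) (lambda pr)
   (fun k => frob (A *m Qmx r) * (n%:R * ybound k ^+ 2)) K (rho / 2)
   (3 / rho * (2 * frob (A *m Qmx r) * (n%:R * sy ^+ 2 + (cg / cl) ^+ 2)))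
   (2 * (p - q))) => {k}.
- by rewrite divr_gt0.
- have rho0' := ltW rho0; apply: mulr_ge0; first exact: divr_ge0.
  apply: mulr_ge0; first exact: mulr_ge0.
  by apply: addr_ge0; [apply: mulr_ge0 => //|]; exact: sqr_ge0.
- by [].
- by move=> k; case/andP: (lam01 k).
- move=> k Kk; have cr := crho_le1 contr; have lc := hK k Kk.
  have : rho * lambda pr k <= rho * c by rewrite ler_wpM2l// ltW.
  by have /andP[l0 _] := lam01 k; have := mulr_ge0 (ltW rho0) l0; lra.
- move=> k Kk.
  have lc := hK k Kk.
  have l0 : 0 < lambda pr k by rewrite lamE power_gain_gt0.
  rewrite ycolS mulmxDr (Qmx_lazy W1 rW).
  apply: le_trans (contraction_perturbed r1 Au c0 rho0 contr _ _ _) _.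
    by rewrite l0.
  have -> : rho / 2 * lambda pr k = lambda pr k * rho / 2 by ring.
  apply: lerD => //.
  set S := k.+1%:R `^ (2 * (p - q)).
  set lam := lambda pr k in l0 *.
  have S1 : 1 <= S by exact: ge1_powR_ge1.
  have gE : gamma pr k ^+ 2 = lam ^+ 2 * ((cg / cl) ^+ 2 * S).
    have -> : S = (k.+1%:R `^ (p - q)) ^+ 2.
      by rewrite /S mulrC powRrM -powR_mulrn ?powR_ge0.
    rewrite -!exprMn /lam lamE gamE !power_gainE; congr (_ ^+ 2).
    rewrite natS_powRD [in RHS](powRN _ p).
    by field; rewrite !gt_eqF// powR_natS_gt0.
  have nb : sqn (ecol k l) <= n%:R * sy ^+ 2.
    rewrite mulr_natl -[X in _ *+ X](card_ord n) -sumr_const; apply: ler_sum => i _.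
    rewrite mxE; apply: le_trans (coord_sqr_le _ _) _.
    by rewrite -norm2_sqr ler_sqr ?nnegrE ?norm2_ge0.
  have db : sqn (delta_mx l 0 : 'cV[R]_n) = 1.
    rewrite /sqn (bigD1 l)//= mxE !eqxx expr1n big1 ?addr0// => i il.
    by rewrite mxE (negbTE il) expr0n.
  have wb : sqA A (Qmx r *m (lam *: ecol k l + gamma pr k *: delta_mx l 0)) <=
      frob (A *m Qmx r) * (2 * (lam ^+ 2 * ((n%:R * sy ^+ 2 + (cg / cl) ^+ 2) * S))).
    rewrite /sqA mulmxA; apply: le_trans (sqn_mulmx _ _) _.
    rewrite ler_wpM2l//; apply: le_trans (sqnD2 _ _) _.
    rewrite !sqnZ db mulr1 gE.
    have h1 : sqn (ecol k l) <= n%:R * sy ^+ 2 * S.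
      by apply: le_trans nb _; rewrite ler_peMr// mulr_ge0// sqr_ge0.
    have h2 : lam ^+ 2 * sqn (ecol k l) <= lam ^+ 2 * (n%:R * sy ^+ 2 * S).
      by rewrite ler_wpM2l// sqr_ge0.
    have -> : 2 * (lam ^+ 2 * ((n%:R * sy ^+ 2 + (cg / cl) ^+ 2) * S)) =
      2 * (lam ^+ 2 * (n%:R * sy ^+ 2 * S)) + 2 * (lam ^+ 2 * ((cg / cl) ^+ 2 * S)).
      by ring.
    by rewrite lerD2r ler_wpM2l.
  have k0 : 0 <= 3 / (lam * rho) by rewrite divr_ge0// mulr_ge0// ltW.
  apply: le_trans (ler_wpM2l k0 wb) _.
  rewrite le_eqVlt; apply/orP; left; apply/eqP; field.
  by rewrite !gt_eqF.
- move=> k; rewrite /sqA mulmxA; apply: le_trans (sqn_mulmx _ _) _.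
  rewrite ler_wpM2l//.
  rewrite mulr_natl -[X in _ *+ X](card_ord n) -sumr_const; apply: ler_sum => i _.
  rewrite mxE -real_normK ?num_real// ler_sqr ?nnegrE ?ybound_ge0//.
  exact: y_le_ybound.
Qed.

Lemma y_error_le K : (forall k, (K <= k)%N -> lambda pr k <= c) ->
  forall k i l, (y_ (st k) i l 0 - r l 0 * gsum k) ^+ 2 <=
    2 * (ydevC K * k.+1%:R `^ (2 * (p - q))) + 2 * ymart k l ^+ 2.
Proof.
move=> hK k i l.
have -> : y_ (st k) i l 0 - r l 0 * gsum k = (Qmx r *m ycol k l) i 0 + ymart k l.
  by rewrite Qmx_coord wavg_ycol mxE; ring.
set a := (_ *m _) i 0; set b := ymart k l.
apply: (@le_trans _ _ (2 * a ^+ 2 + 2 * b ^+ 2)).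
  rewrite -subr_ge0 (_ : _ - (a + b) ^+ 2 = (a - b) ^+ 2); last by ring.
  exact: sqr_ge0.
rewrite lerD2r ler_wpM2l//; apply: le_trans (ydev_le hK k l).
rewrite /a; apply: le_trans (coord_sqr_le _ _) _.
rewrite -norm2_sqr /sqA -(norm2_sqr (A *m _)) ler_sqr ?nnegrE ?norm2_ge0//.
Qed.

(** The bound on [H] forces y_ii >= r_i G / 2 for G = [gsum k.+1]; the next hypothesis then puts
    y_ii above the threshold, so the weight is freshly computed and [ratio_error] applies. Powers of
    k+2 occur because the state has index k+1. *)
Lemma kappa_error_le K : (forall k, (K <= k)%N -> lambda pr k <= c) ->
  forall (rm : R) k, (forall i, rm <= r i 0) -> 0 < rm ->
  let T := k.+2%:R `^ (2 * (1 - q)) in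
  let H := \sum_l (2 * (ydevC K * k.+2%:R `^ (2 * (p - q))) + 2 * ymart k.+1 l ^+ 2) in
  H <= (rm * Num.min 1 cg / 2) ^+ 2 * T ->
  2 * eps_kappa pr < rm * Num.min 1 cg * k.+2%:R `^ (1 - q) ->
  \sum_i (kappa_prev (st k.+1) i - 1 / (n%:R * r i 0)) ^+ 2 <=
  n%:R * ((2 * n%:R + 2) * 4 / (n%:R ^+ 2 * rm ^+ 4 * Num.min 1 cg ^+ 2) / T * H).
Proof.
move=> hK rm k hrm rm0 T H HT He.
set cG := Num.min 1 cg in HT He *.
have cG0 : 0 < cG by rewrite lt_min ltr01.
have T0 : 0 < T by exact: powR_natS_gt0.
have TE : T = (k.+2%:R `^ (1 - q)) ^+ 2.
  by rewrite /T mulrC powRrM -powR_mulrn ?powR_ge0.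
set t := k.+2%:R `^ (1 - q) in He TE; have t0 : 0 < t by exact: powR_natS_gt0.
set G := gsum k.+1.
have Gt : cG * t <= G by exact: gsum_ge.
have G0 : 0 < G by apply: lt_le_trans Gt; rewrite mulr_gt0.
have err i l := y_error_le hK k.+1 i l.
have errH i : \sum_l (y_ (st k.+1) i l 0 - r l 0 * G) ^+ 2 <= H.
  by apply: ler_sum => l _; exact: err.
have yi i : r i 0 * G / 2 <= y_ (st k.+1) i i 0.
  have h : (y_ (st k.+1) i i 0 - r i 0 * G) ^+ 2 <= (rm * cG / 2 * t) ^+ 2.
    rewrite exprMn -TE; apply: le_trans HT; apply: le_trans (errH i).
    by rewrite (bigD1 i)//= lerDl; apply: sumr_ge0 => j _; exact: sqr_ge0.
  have h2 : `|y_ (st k.+1) i i 0 - r i 0 * G| <= rm * cG / 2 * t.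
    rewrite -[leRHS]ger0_norm ?mulr_ge0 ?invr_ge0 ?(ltW rm0) ?(ltW cG0) ?(ltW t0)//.
    by rewrite -ler_sqr ?nnegrE// !real_normK ?num_real.
  have h3 : rm * (cG * t) <= r i 0 * G.
    by apply: ler_pM => //; [exact: ltW|rewrite mulr_ge0// ltW].
  move: h2; rewrite ler_norml => /andP[h2 _]; lra.
have yeps i : eps_kappa pr < y_ (st k.+1) i i 0.
  apply: lt_le_trans (yi i).
  have h3 : rm * (cG * t) <= r i 0 * G.
    by apply: ler_pM => //; [exact: ltW|rewrite mulr_ge0// ltW].
  lra.
have kE i : kappa_prev (st k.+1) i =
    (\sum_j y_ (st k.+1) i j 0) / (n%:R * y_ (st k.+1) i i 0).
  by have := yeps i; rewrite /= => ->.
have cstE (Y : R) : n%:R * Y = \sum_(i < n) Y by rewrite sumr_const card_ord mulr_natl.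
rewrite [leRHS]cstE; apply: ler_sum => i _.
rewrite kE.
apply: le_trans (@ratio_error _ _ i (fun j => r j 0) (fun j => y_ (st k.+1) i j 0)
  G r0 perron_le1 r1 G0 (yi i)) _.
have n0 : 0 < n%:R :> R by rewrite ltr0n; case: (i) => m /(leq_ltn_trans _); apply.
have S0 : 0 <= \sum_l (y_ (st k.+1) i l 0 - r l 0 * G) ^+ 2.
  by apply: sumr_ge0 => l _; exact: sqr_ge0.
apply: ler_pM => //.
  by rewrite divr_ge0// ?mulr_ge0 ?exprn_ge0 ?(ltW (r0 i)) ?(ltW G0)// addr_ge0// mulr_ge0.
rewrite -[leRHS]mulrA -invfM; apply: ler_wpM2l; first by rewrite mulr_ge0// addr_ge0// mulr_ge0.
rewrite lef_pV2 ?posrE ?mulr_gt0 ?exprn_gt0//.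
rewrite TE -[leLHS]mulrA -exprMn; apply: ler_pM.
- by rewrite mulr_ge0 ?exprn_ge0// ltW.
- by rewrite exprn_ge0// mulr_ge0// ltW.
- by rewrite ler_wpM2l ?exprn_ge0// ler_pXn2r ?nnegrE ?(ltW rm0) ?(ltW (r0 i)).
- by rewrite ler_pXn2r ?nnegrE ?mulr_ge0 ?(ltW cG0) ?(ltW t0) ?(ltW G0).
Qed.

End pathwise.

(** The constants precede the noise realization, so the bounds are uniform over the sample space.
    The martingale stays explicit in the last bound, because its mean square is much smaller than
    its pathwise bound. *)
Lemma kappa_estimate (dl : R) : 0 < dl -> exists CK CD K, 0 <= CD /\
  forall e : noise_realization R n, (forall i k, norm2 (noise_y e i k) <= sy) ->
    (forall k i, `|kappa_prev (RXi pr e k) i| <= CK) /\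
    (forall k, (K <= k)%N ->
      let D := \sum_i (kappa_prev (RXi pr e k.+1) i - 1 / (n%:R * r i 0)) ^+ 2 in
      D <= dl /\
      D <= CD * (k.+2%:R `^ (- (2 * (1 - p)))
                 + k.+2%:R `^ (- (2 * (1 - q))) * \sum_l ymart e k.+1 l ^+ 2)).
Proof.
move=> dl0.
pose cG : R := Num.min 1 cg.
have cG0 : 0 < cG by rewrite lt_min ltr01.
(* A positive lower bound for every r_i, as all factors are at most 1. *)
pose rm := \prod_j r j 0.
have rm0 : 0 < rm by apply: prodr_gt0.
have hrm i : rm <= r i 0.
  rewrite /rm (bigD1 i)//= ler_piMr ?(ltW (r0 i))//.
  by apply: prodr_ile1 => j _; rewrite (ltW (r0 j)) perron_le1.
have n0 : 0 < n%:R :> R.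
  by rewrite ltr0n; exact: sum_ord_eq1_gt0 r1.
have clc : 0 < c / cl by rewrite divr_gt0.
have [K1 _ hK1] := near_powR_natSN_le p0 clc.
have hK k : (K1 <= k)%N -> lambda pr k <= c.
  by move=> /hK1 /= h; rewrite lamE power_gainE mulrC -ler_pdivlMr.
pose D1 := ydevC K1.
have D10 : 0 <= D1.
  rewrite addr_ge0 ?sumr_ge0//; apply: divr_ge0; last by rewrite divr_ge0// ltW.
  have rho0' := ltW rho0; apply: mulr_ge0; first exact: divr_ge0.
  apply: mulr_ge0; first by rewrite mulr_ge0// frob_ge0.
  by apply: addr_ge0; [apply: mulr_ge0 => //|]; exact: sqr_ge0.
pose D2 := sy * (cl * ((1 + (1 - p)) / (1 - p))).
pose Cr := (2 * n%:R + 2) * 4 / (n%:R ^+ 2 * rm ^+ 4 * cG ^+ 2).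
have Cr0 : 0 <= Cr.
  by rewrite divr_ge0// ?mulr_ge0 ?exprn_ge0 ?(ltW rm0) ?(ltW cG0)// addr_ge0// mulr_ge0.
pose B := n%:R * (2 * D1 + 2 * D2 ^+ 2) + 1.
have B0 : 0 < B.
  by rewrite ltr_wpDl// mulr_ge0// addr_ge0// mulr_ge0// sqr_ge0.
(* The first entry keeps y_ii above half of its main term, the second brings the error of the
   weights below [dl]. *)
pose e1 := Num.min ((rm * cG / 2) ^+ 2 / B) (dl / (n%:R * Cr * B + 1)).
have NB0 : 0 < n%:R * Cr * B + 1 by rewrite ltr_wpDl// mulr_ge0 ?(ltW B0)// mulr_ge0.
have e10 : 0 < e1.
  by rewrite lt_min !divr_gt0// exprn_gt0// !mulr_gt0// invr_gt0.
have s1 : 0 < 2 * (1 - p) by rewrite mulr_gt0// subr_gt0.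
have s2 : 0 < 2 * (p - q) by rewrite mulr_gt0// subr_gt0.
have s3 : 0 < 1 - q by rewrite subr_gt0 (lt_trans qp).
have e3 : 0 < rm * cG / (4 * eps_kappa pr) by rewrite divr_gt0// mulr_gt0.
have [K2 _ hK2] := near_powR_natSN_le s1 e10.
have [K3 _ hK3] := near_powR_natSN_le s2 e10.
have [K4 _ hK4] := near_powR_natSN_le s3 e3.
pose K := (K2 + K3 + K4)%N.
(* The sum covers times up to [K]. Later, the weight is within 1 + dl of 1/(n r_i), since its
   squared error is at most dl <= (1 + dl)^2, and 1/(n r_i) is at most the inverse of [rm]. *)
pose CK : R := \sum_(j < K.+2) ybound j / eps_kappa pr + (rm^-1 + (1 + dl)).
have yb0 j : 0 <= ybound j / eps_kappa pr by rewrite divr_ge0 ?ybound_ge0// ltW.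
have CKs0 : 0 <= rm^-1 + (1 + dl) by rewrite !addr_ge0 ?invr_ge0 ?(ltW rm0) ?(ltW dl0).
exists CK, (n%:R * Cr * (2 * n%:R * D1 + 2)), K; split.
  apply: mulr_ge0; first exact: mulr_ge0.
  by apply: addr_ge0 => //; apply: mulr_ge0 => //; exact: mulr_ge0.
move=> e he.
have main k : (K <= k)%N ->
  let D := \sum_i (kappa_prev (RXi pr e k.+1) i - 1 / (n%:R * r i 0)) ^+ 2 in
  D <= dl /\
  D <= n%:R * Cr * (2 * n%:R * D1 + 2) * (k.+2%:R `^ (- (2 * (1 - p)))
                 + k.+2%:R `^ (- (2 * (1 - q))) * \sum_l ymart e k.+1 l ^+ 2).
  move=> Kk D.
  have k2 : (K2 <= k.+1)%N by rewrite (leq_trans _ (leqW Kk))// /K -addnA leq_addr.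
  have k3 : (K3 <= k.+1)%N.
    by rewrite (leq_trans _ (leqW Kk))// /K addnAC leq_addl.
  have k4 : (K4 <= k.+1)%N by rewrite (leq_trans _ (leqW Kk))// /K leq_addl.
  have := hK2 _ k2; have := hK3 _ k3; have := hK4 _ k4.
  move=> /= h4 h3 h2.
  set A1 := k.+2%:R `^ (- (2 * (1 - p))) in h2 *.
  set A2 := k.+2%:R `^ (- (2 * (p - q))) in h3 *.
  set Ti := k.+2%:R `^ (- (2 * (1 - q))).
  pose T : R := k.+2%:R `^ (2 * (1 - q)).
  have T0 : 0 < T by exact: powR_natS_gt0.
  have TiE : Ti = T^-1 by rewrite /Ti powRN.
  have X1 : k.+2%:R `^ (2 * (p - q)) = T * A1.
    by rewrite /T /A1 -natS_powRD; congr (_ `^ _); ring.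
  have X2 : k.+2%:R `^ (1 - p) ^+ 2 = T * A2.
    rewrite -powR_mulrn ?powR_ge0// -powRrM /T /A2 -natS_powRD.
    by congr (_ `^ _); ring.
  have A10 : 0 <= A1 by exact: powR_ge0.
  have A20 : 0 <= A2 by exact: powR_ge0.
  set S := \sum_l _ ^+ 2.
  pose H := \sum_l (2 * (D1 * k.+2%:R `^ (2 * (p - q))) + 2 * ymart e k.+1 l ^+ 2).
  have HE : H = n%:R * (2 * (D1 * (T * A1))) + 2 * S.
    by rewrite /H X1 big_split/= sumr_const card_ord -mulr_sumr [n%:R * _]mulr_natl.
  have SB : S <= n%:R * (D2 ^+ 2 * (T * A2)).
    rewrite mulr_natl -[X in _ *+ X](card_ord n) -sumr_const; apply: ler_sum => l _.
    rewrite -X2 -exprMn -real_normK ?num_real// ler_sqr ?nnegrE//.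
      exact: ymart_le.
    by apply: le_trans (ymart_le he k.+1 l).
  have HB : H <= B * e1 * T.
    have t1 : T * A1 <= T * e1 by rewrite ler_wpM2l// ltW.
    have t2 : T * A2 <= T * e1 by rewrite ler_wpM2l// ltW.
    have u1 := ler_wpM2l (mulr_ge0 (ler0n R n) (mulr_ge0 (ler0n R 2) D10)) t1.
    have u2 := ler_wpM2l (mulr_ge0 (ler0n R n) (sqr_ge0 D2)) t2.
    have u3 : 0 <= T * e1 by rewrite mulr_ge0// ltW.
    rewrite HE.
    have -> : B * e1 * T =
       n%:R * (2 * D1) * (T * e1) + 2 * (n%:R * D2 ^+ 2 * (T * e1)) + T * e1.
      by rewrite /B; ring.
    move: SB u1 u2 u3; move: (T * e1) (T * A1) (T * A2) => z1 z2 z3 SB u1 u2 u3.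
    have {}SB : S <= n%:R * D2 ^+ 2 * z3 by rewrite -mulrA.
    have {}u1 : n%:R * (2 * (D1 * z2)) <= n%:R * (2 * D1) * z1.
      by apply: le_trans u1; rewrite !mulrA.
    apply: le_trans (lerD u1 (ler_wpM2l (ler0n R 2) (le_trans SB u2))) _.
    by rewrite lerDl.
  have Be1 : B * e1 <= (rm * cG / 2) ^+ 2.
    by rewrite mulrC -ler_pdivlMr// ge_min lexx.
  have HT : H <= (rm * cG / 2) ^+ 2 * T.
    by apply: le_trans HB _; rewrite ler_wpM2r// ltW.
  have He : 2 * eps_kappa pr < rm * cG * k.+2%:R `^ (1 - q).
    move: h4; rewrite powRN.
    set t := _ `^ (1 - q); have t0 : 0 < t by exact: powR_natS_gt0.
    rewrite ler_pdivlMr ?mulr_gt0// mulrC ler_pdivrMr// => h.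
    by apply: lt_le_trans h; rewrite ltr_pM2r// ltr_nat.
  have Dle := kappa_error_le he hK hrm rm0 HT He.
  rewrite -/D -/H -/T -/cG -/Cr in Dle.
  have nCr0 : 0 <= n%:R * Cr by rewrite mulr_ge0.
  split; apply: le_trans Dle _.
    have HTi : H / T <= B * e1 by rewrite ler_pdivrMr.
    have e1d : e1 * (n%:R * Cr * B + 1) <= dl.
      by rewrite -ler_pdivlMr// ge_min lexx orbT.
    apply: le_trans e1d.
    have := ler_wpM2l nCr0 HTi.
    have -> : n%:R * (Cr / T * H) = n%:R * Cr * (H / T) by ring.
    move=> h; apply: le_trans h _.
    have := ltW e10; lra.
  have Ti0 : 0 <= Ti by exact: powR_ge0.
  have S0 : 0 <= S by apply: sumr_ge0 => l _; exact: sqr_ge0.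
  have -> : n%:R * (Cr / T * H) = n%:R * Cr * (2 * n%:R * D1 * A1 + 2 * (Ti * S)).
    by rewrite HE TiE; field; rewrite gt_eqF.
  have -> : n%:R * Cr * (2 * n%:R * D1 + 2) * (A1 + Ti * S) =
    n%:R * Cr * (2 * n%:R * D1 * A1 + 2 * (Ti * S)) +
    n%:R * Cr * (2 * n%:R * D1 * (Ti * S) + 2 * A1) by ring.
  rewrite lerDl; apply: mulr_ge0 => //; apply: addr_ge0; last exact: mulr_ge0.
  by apply: mulr_ge0; [apply: mulr_ge0 => //; exact: mulr_ge0|exact: mulr_ge0].
split; last by move=> k /main.
move=> k i; have [kK|] := leqP k K.
  apply: le_trans (kappa_crude he k i) _.
  rewrite /CK -[leLHS]addr0; apply: lerD => //.
  rewrite -!(big_mkord xpredT (fun j => ybound j / eps_kappa pr)).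
  rewrite (big_cat_nat (n := k.+1) (p := K.+2))//=; last by rewrite ltnS leqW.
  by rewrite lerDl; apply: sumr_ge0.
case: k => // k Kk; have [Dd _] := main k Kk.
set v := kappa_prev _ i; set w := 1 / (n%:R * r i 0).
have nr0 : 0 < n%:R * r i 0 by rewrite mulr_gt0.
have vw : (v - w) ^+ 2 <= dl.
  by apply: le_trans Dd; rewrite (bigD1 i)//= lerDl; apply: sumr_ge0 => j _; exact: sqr_ge0.
have {}vw : `|v - w| <= 1 + dl.
  rewrite -(ger0_norm (_ : 0 <= 1 + dl)); last by rewrite addr_ge0// ltW.
  rewrite -ler_sqr ?nnegrE// !real_normK ?num_real//.
  by apply: le_trans vw _; have := sqr_ge0 dl; lra.
have w1 : `|w| <= rm^-1.
  rewrite ger0_norm ?divr_ge0 ?(ltW nr0)// /w div1r lef_pV2 ?posrE//.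
  apply: le_trans (hrm i) _; rewrite ler_peMl ?(ltW (r0 i))// ler1n.
  by case: (i) => m /(leq_ltn_trans _); apply.
have -> : v = (v - w) + w by rewrite subrK.
apply: le_trans (ler_normD _ _) _.
rewrite /CK -[leLHS]add0r; apply: lerD; first exact: sumr_ge0.
by rewrite addrC lerD.
Qed.

End y_dynamics.

(** * Orthogonality to the noise *)

Section noise.
Context d (T : measurableType d) (R : realType) (P : probability T R) (n : nat).
Variables (sigma sigma_y : R)
  (ex : 'I_n -> nat -> {RV P >-> R})
  (ey : 'I_n -> nat -> {RV P >-> n.-tuple R})
  (ez : 'I_n -> nat -> {RV P >-> R}).
Hypothesis hnoise : noise_assumption sigma sigma_y ex ey ez.
Local Notation G := (noise_sigma_algebra ex ey ez).
Local Notation idx := ('I_n * nat + 'I_n * nat + 'I_n * nat)%type.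

(** The sample space with only the sigma-algebra of the noises other than [l0]: measurability on
    this type is how a variable is shown not to involve the noise [l0]. *)
Definition other_type (l0 : idx) : Type :=
  g_sigma_algebraType [set B | exists2 l, l != l0 & G l B].

HB.instance Definition _ (l0 : idx) := Measurable.on (other_type l0).

Lemma preimage_sigma_algebra d' (T' : measurableType d') (f : {mfun T >-> T'}) :
  [/\ g_sigma_algebra_preimage f `<=` @measurable _ T,
      setI_closed (g_sigma_algebra_preimage f) & g_sigma_algebra_preimage f setT].
Proof.
split.
- by move=> _ [B mB <-]; exact: measurable_funP.
- move=> _ _ [B mB <-] [C mC <-]; exists (B `&` C); first exact: measurableI.
  by rewrite !setTI preimage_setI.
- by exists setT => //; rewrite preimage_setT setTI.
Qed.

Lemma noise_sigma_algebraP l :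
  [/\ G l `<=` @measurable _ T, setI_closed (G l) & G l setT].
Proof. by case: l => [[[i k]|[i k]]|[i k]]; exact: preimage_sigma_algebra. Qed.

Lemma noise_orthogonal l0 (X Y : T -> R) :
  measurable_fun (setT : set (other_type l0)) (X : other_type l0 -> R) ->
  L2 P X -> L2 P Y -> mean P Y = 0 ->
  (forall B, measurable B -> G l0 (Y @^-1` B)) ->
  mean P (fun w => X w * Y w) = 0.
Proof.
move=> mX X2 Y2 Y0 GY.
have Y1 : L1 P Y.
  have := L2M_L1 (L2_cst P 1) Y2; apply: L1_ext => w; exact: mul1r.
have Y0' : (\int[P]_w (Y w)%:E = 0)%E.
  rewrite -[LHS]fineK ?integrable_fin_num//; congr EFin; exact: Y0.
rewrite /mean /Rintegral (indep_integral_mul0 _ _ _ _ _ Y0')//.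
- by case: X2.
- by case: Y2.
- move=> B C mB mC.
  have [h _ _ _ _] := hnoise.
  apply: (@indep_sigma_other _ _ _ P _ G l0) => //.
  + by move=> l; have [] := noise_sigma_algebraP l.
  + by move=> l; have [] := noise_sigma_algebraP l.
  + by move=> l; have [] := noise_sigma_algebraP l.
  + by have := mX measurableT B mB; rewrite setTI.
  + exact: GY.
- exact: L2M_L1.
Qed.

Lemma other_measurable l0 l (f : T -> R) : l != l0 ->
  (forall B, measurable B -> G l (f @^-1` B)) ->
  measurable_fun (setT : set (other_type l0)) (f : other_type l0 -> R).
Proof.
move=> ll0 Gf _ B mB; rewrite setTI; apply: sub_sigma_algebra.
by exists l => //; exact: Gf.
Qed.

Lemma sigma_ex i k B : measurable B -> G (inl (inl (i, k))) (ex i k @^-1` B).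
Proof. by move=> mB; exists B => //; rewrite setTI. Qed.

Lemma sigma_ez i k B : measurable B -> G (inr (i, k)) (ez i k @^-1` B).
Proof. by move=> mB; exists B => //; rewrite setTI. Qed.

Lemma sigma_ey i k l B : measurable B ->
  G (inl (inr (i, k))) ((fun w => tnth (ey i k w) l) @^-1` B).
Proof.
move=> mB; exists ((@tnth n R ^~ l) @^-1` B); last by rewrite setTI.
by have := @measurable_tnth _ R n l measurableT B mB; rewrite setTI.
Qed.

(** As the mean is zero, the variance is the integral of the square, so the variance bound yields
    square integrability. *)
Lemma centered_L2 (X : T -> R) s : measurable_fun setT X ->
  ('E_P[X] = 0)%E -> ('V_P[X] <= s%:E)%E ->
  [/\ L2 P X, mean P X = 0 & mean P (fun w => X w ^+ 2) <= s].
Proof.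
move=> mX EX VX.
have VE : ('V_P[X] = \int[P]_w (X w ^+ 2)%:E)%E.
  rewrite /variance unlock EX /= unlock; apply: eq_integral => w _ /=.
  by transitivity ((X w - 0) * (X w - 0))%:E => //; rewrite subr0 expr2.
have fX : (\int[P]_w (X w ^+ 2)%:E < +oo)%E by rewrite -VE (le_lt_trans VX)// ltry.
have X1 : L1 P (fun w => X w ^+ 2).
  apply/integrableP; split; first by apply/measurable_EFinP; exact: measurable_funX.
  by under eq_integral => w _ do rewrite /= ger0_norm ?sqr_ge0//.
split => //.
- by move: EX; rewrite unlock /mean /Rintegral => ->.
- rewrite -lee_fin /mean /Rintegral fineK -?VE//.
  by rewrite VE; exact: integrable_fin_num.
Qed.

Lemma ex_L2 i k : [/\ L2 P (ex i k), mean P (ex i k) = 0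
  & mean P (fun w => ex i k w ^+ 2) <= sigma].
Proof. by have [_ /(_ i k)[h1 h2] _ _ _] := hnoise; exact: centered_L2. Qed.

Lemma ez_L2 i k : [/\ L2 P (ez i k), mean P (ez i k) = 0
  & mean P (fun w => ez i k w ^+ 2) <= sigma].
Proof. by have [_ _ _ /(_ i k)[h1 h2] _] := hnoise; exact: centered_L2. Qed.

Lemma ey_measurable i k l : measurable_fun setT (fun w => tnth (ey i k w) l).
Proof. by apply: (measurableT_comp (measurable_tnth l)). Qed.

Lemma ey_L2 i k l : [/\ L2 P (fun w => tnth (ey i k w) l),
  mean P (fun w => tnth (ey i k w) l) = 0
  & mean P (fun w => tnth (ey i k w) l ^+ 2) <= sigma].
Proof.
have [_ _ /(_ i k)[h1 h2] _ _] := hnoise.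
apply: centered_L2; [exact: ey_measurable|exact: h1|].
apply: le_trans h2; rewrite (bigD1 l)//= leeDl// sume_ge0// => j _.
exact: variance_ge0.
Qed.

Local Notation N w := (noise_at ex ey ez w).

Section adapted.
Variable pr : RXi_parameters R n.
Hypothesis eps0 : 0 < eps_kappa pr.
Hypothesis mdf : forall i, measurable_fun setT (derive1 (objective pr i)).
Local Notation st w k := (RXi pr (N w) k).

Definition is_xz (k : nat) (l : idx) : bool :=
  match l with
  | inl (inl (_, j)) => j == k
  | inl (inr _) => false
  | inr (_, j) => j == k
  end.

(* Stated for each sigma-algebra omitting a single x- or z-noise of time [k], so
   it covers kappa_{i,k}, which depends on the y-noise of time [k]. *)
Definition adapted (k : nat) (X : T -> R) : Prop := forall l0, is_xz k l0 ->
  measurable_fun (setT : set (other_type l0)) (X : other_type l0 -> R).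

(** The y-iteration never reads an x- or z-noise, so even the state of index k+1 is allowed. *)
Lemma adapted_y k i l : adapted k (fun w => y_ (st w k.+1) i l 0) /\
  adapted k (fun w => kappa_prev (st w k.+1) i).
Proof.
have h l0 : is_xz k l0 ->
    (forall i l, measurable_fun (setT : set (other_type l0))
       (fun w : other_type l0 => y_ (st w k.+1) i l 0)) /\
    (forall i, measurable_fun (setT : set (other_type l0))
       (fun w : other_type l0 => kappa_prev (st w k.+1) i)).
  move=> kl0; apply: RXi_y_measurable => // i' j l' _.
  rewrite [X in measurable_fun _ X](_ : _ = fun w => tnth (ey i' j w) l'); last first.
    by apply/funext => w; rewrite /= mxE.
  apply: (@other_measurable l0 (inl (inr (i', j)))); last exact: sigma_ey.
  by apply: contraTneq kl0 => <-.
by split => l0 /h[].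
Qed.

(** At time k these have used x- and z-noises of times j < k only, and the omitted noise has time
    k. *)
Lemma adapted_xz k i : adapted k (fun w => x_ (st w k) i 0) /\
  adapted k (fun w => z_ (st w k) i 0).
Proof.
have h l0 : is_xz k l0 ->
    (forall i, measurable_fun (setT : set (other_type l0))
       (fun w : other_type l0 => x_ (st w k) i 0)) /\
    (forall i, measurable_fun (setT : set (other_type l0))
       (fun w : other_type l0 => z_ (st w k) i 0)).
  move=> kl0; apply: RXi_xz_measurable => //.
  - move=> i' j l' _.
    rewrite [X in measurable_fun _ X](_ : _ = fun w => tnth (ey i' j w) l'); last first.
      by apply/funext => w; rewrite /= mxE.
    apply: (@other_measurable l0 (inl (inr (i', j)))); last exact: sigma_ey.
    by apply: contraTneq kl0 => <-.
  - move=> i' j jk.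
    apply: (@other_measurable l0 (inl (inl (i', j)))); last exact: sigma_ex.
    by apply: contraTneq kl0 => <-; rewrite /= ltn_eqF.
  - move=> i' j jk.
    apply: (@other_measurable l0 (inr (i', j))); last exact: sigma_ez.
    by apply: contraTneq kl0 => <-; rewrite /= ltn_eqF.
by split => l0 /h[].
Qed.

End adapted.

Lemma adapted_sumZ k (I : Type) (s : seq I) (a : I -> R) (X : I -> T -> R) :
  (forall i, adapted k (X i)) -> adapted k (fun w => \sum_(i <- s) a i * X i w).
Proof.
move=> aX l0 kl0; apply: measurable_fun_sumR => i.
by apply: measurable_fun_Zl; exact: aX.
Qed.

Lemma adaptedD k (X Y : T -> R) : adapted k X -> adapted k Y ->
  adapted k (fun w => X w + Y w).
Proof. by move=> aX aY l0 kl0; apply: measurable_funD; [exact: aX|exact: aY]. Qed.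

Lemma adaptedM k (X Y : T -> R) : adapted k X -> adapted k Y ->
  adapted k (fun w => X w * Y w).
Proof. by move=> aX aY l0 kl0; apply: measurable_funM; [exact: aX|exact: aY]. Qed.

Lemma adapted_cst k c : adapted k (fun=> c).
Proof. by move=> l0 _; exact: measurable_cst. Qed.

Lemma adapted_comp k (g : R -> R) (X : T -> R) : measurable_fun setT g ->
  adapted k X -> adapted k (g \o X).
Proof. by move=> mg aX l0 kl0; apply: measurableT_comp => //; exact: aX. Qed.

Definition xz_noise k (a b : 'I_n -> R) (w : T) : R :=
  \sum_j a j * ex j k w + \sum_j b j * ez j k w.

Lemma xz_noise_L2 k a b : L2 P (xz_noise k a b).
Proof.
apply: L2D; apply: L2_sum => j; apply: L2Z.
- by have [] := ex_L2 j k.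
- by have [] := ez_L2 j k.
Qed.

(** Noises of the same time are combined by Cauchy-Schwarz; the lost factor n only affects
    constants. *)
Lemma mean_sqr_sumZ (F : 'I_n -> T -> R) (a : 'I_n -> R) :
  (forall i, L2 P (F i)) -> (forall i, mean P (fun w => F i w ^+ 2) <= sigma) ->
  mean P (fun w => (\sum_i a i * F i w) ^+ 2) <= n%:R * (\sum_i a i ^+ 2) * sigma.
Proof.
move=> F2 Fs.
have S2 : L2 P (fun w => \sum_i a i * F i w) by apply: L2_sum => i; exact: L2Z.
have Z1 i : L1 P (fun w => (a i * F i w) ^+ 2).
  have : L2 P (fun w => a i * F i w) by exact: L2Z.
  by case.
apply: (@le_trans _ _ (mean P (fun w => n%:R * \sum_i (a i * F i w) ^+ 2))).
  apply: mean_le; [exact: S2.2|exact/L1Z/L1_sum|].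
  by move=> w; apply: le_trans (sqr_sum_le _) _; rewrite card_ord.
rewrite meanZ; last exact: L1_sum.
rewrite mean_sum// -mulrA ler_wpM2l// mulr_suml; apply: ler_sum => i _.
have -> : (fun w => (a i * F i w) ^+ 2) = (fun w => a i ^+ 2 * F i w ^+ 2).
  by apply/funext => w; rewrite exprMn.
by rewrite meanZ ?ler_wpM2l ?sqr_ge0//; case: (F2 i).
Qed.

Lemma xz_noise_var k a b : mean P (fun w => xz_noise k a b w ^+ 2) <=
  2 * n%:R * (\sum_j a j ^+ 2 + \sum_j b j ^+ 2) * sigma.
Proof.
have x2 j : L2 P (ex j k) by have [] := ex_L2 j k.
have z2 j : L2 P (ez j k) by have [] := ez_L2 j k.
have X2 : L2 P (fun w => \sum_j a j * ex j k w) by apply: L2_sum => j; exact: L2Z.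
have Z2 : L2 P (fun w => \sum_j b j * ez j k w) by apply: L2_sum => j; exact: L2Z.
apply: (@le_trans _ _ (mean P (fun w => 2 * (\sum_j a j * ex j k w) ^+ 2 +
    2 * (\sum_j b j * ez j k w) ^+ 2))).
  apply: mean_le.
  - by case: (xz_noise_L2 k a b).
  - by apply: L1D; apply: L1Z; [case: X2|case: Z2].
  - move=> w; rewrite /xz_noise; set u := \sum_j _; set v := \sum_j _.
    rewrite -subr_ge0 (_ : _ - (u + v) ^+ 2 = (u - v) ^+ 2); last by ring.
    exact: sqr_ge0.
rewrite meanD ?meanZ; [|by case: Z2|by case: X2|by apply: L1Z; case: X2|by apply: L1Z; case: Z2].
have h1 := @mean_sqr_sumZ (fun j => ex j k) a x2 (fun j => let: And3 _ _ h := ex_L2 j k in h).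
have h2 := @mean_sqr_sumZ (fun j => ez j k) b z2 (fun j => let: And3 _ _ h := ez_L2 j k in h).
lra.
Qed.

(** The cross term is linear in the noise and vanishes one noise variable at a time. *)
Lemma mean_sqr_adapted_noise k (X : T -> R) a b : L2 P X -> adapted k X ->
  mean P (fun w => (X w + xz_noise k a b w) ^+ 2) <=
  mean P (fun w => X w ^+ 2) + 2 * n%:R * (\sum_j a j ^+ 2 + \sum_j b j ^+ 2) * sigma.
Proof.
move=> X2 aX.
have x2 j : L2 P (ex j k) by have [] := ex_L2 j k.
have z2 j : L2 P (ez j k) by have [] := ez_L2 j k.
rewrite mean_sqrD//; first by rewrite lerD2l xz_noise_var.
  exact: xz_noise_L2.
have -> : (fun w => X w * xz_noise k a b w) = (fun w =>
   X w * (\sum_j a j * ex j k w) + X w * (\sum_j b j * ez j k w)).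
  by apply/funext => w; rewrite -mulrDr.
rewrite meanD.
- rewrite !mean_sqrM_sum0 ?addr0// => j.
  + apply: (@noise_orthogonal (inr (j, k))) => //; first by apply: aX; rewrite /= eqxx.
      by have [] := ez_L2 j k.
    exact: sigma_ez.
  + apply: (@noise_orthogonal (inl (inl (j, k)))) => //; first by apply: aX; rewrite /= eqxx.
      by have [] := ex_L2 j k.
    exact: sigma_ex.
- by apply: L2M_L1 => //; apply: L2_sum => j; exact: L2Z.
- by apply: L2M_L1 => //; apply: L2_sum => j; exact: L2Z.
Qed.

Lemma mean_sqA_adapted_noise k (A B1 B2 : 'M[R]_n) (M : T -> 'cV[R]_n) :
  (forall i, L2 P (fun w => M w i 0)) -> (forall i, adapted k (fun w => M w i 0)) ->
  mean P (fun w => sqA A (M w + (B1 *m \col_i ex i k w + B2 *m \col_i ez i k w))) <=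
  mean P (fun w => sqA A (M w)) + 2 * (frob (A *m B1) + frob (A *m B2)) * sigma.
Proof.
move=> M2 aM.
pose X i w := (A *m M w) i 0.
have XE i : X i = fun w => \sum_j A i j * M w j 0.
  by apply/funext => w; rewrite /X mxE.
have X2 i : L2 P (X i) by rewrite XE; apply: L2_sum => j; exact: L2Z.
have aX i : adapted k (X i) by rewrite XE; exact: adapted_sumZ.
pose a i j := (A *m B1) i j; pose b i j := (A *m B2) i j.
have E w : sqA A (M w + (B1 *m \col_i ex i k w + B2 *m \col_i ez i k w)) =
    \sum_i (X i w + xz_noise k (a i) (b i) w) ^+ 2.
  apply: eq_bigr => i _; congr (_ ^+ 2).
  rewrite !mulmxDr !mulmxA mxE; congr (_ + _).
  by rewrite mxE /xz_noise; congr (_ + _); rewrite mxE; apply: eq_bigr => j _;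
    congr (_ * _); rewrite mxE.
have -> : (fun w => sqA A (M w + (B1 *m \col_i ex i k w + B2 *m \col_i ez i k w)))
  = (fun w => \sum_i (X i w + xz_noise k (a i) (b i) w) ^+ 2) by apply/funext.
rewrite mean_sum; last first.
  by move=> i; have [] := L2D (X2 i) (xz_noise_L2 k (a i) (b i)).
have -> : mean P (fun w => sqA A (M w)) = \sum_i mean P (fun w => X i w ^+ 2).
  by rewrite -mean_sum// => i; case: (X2 i).
apply: (@le_trans _ _ (\sum_i (mean P (fun w => X i w ^+ 2) +
   2 * n%:R * (\sum_j a i j ^+ 2 + \sum_j b i j ^+ 2) * sigma))).
  by apply: ler_sum => i _; exact: mean_sqr_adapted_noise.
rewrite big_split/= lerD2l -mulr_suml -mulr_sumr big_split/= /frob.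
by rewrite le_eqVlt; apply/orP; left; apply/eqP; ring.
Qed.

Section martingale.
Variables (pr : RXi_parameters R n) (r : 'cV[R]_n).
Hypotheses (r0 : forall i, 0 <= r i 0) (rle1 : forall i, r i 0 <= 1)
  (sigma0 : 0 <= sigma).

Lemma ymartE k l w : ymart pr r (N w) k l =
  \sum_(j < k) lambda pr j * \sum_i r i 0 * tnth (ey i j w) l.
Proof.
apply: eq_bigr => j _; congr (_ * _); apply: eq_bigr => i _; congr (_ * _).
by rewrite !mxE.
Qed.

Lemma ymart_L2 k l : L2 P (fun w => ymart pr r (N w) k l).
Proof.
apply: L2_ext (_ : L2 P (fun w => \sum_(j < k) lambda pr j *
    \sum_i r i 0 * tnth (ey i j w) l)).
  by move=> w; rewrite ymartE.
apply: L2_sum => j; apply: L2Z; apply: L2_sum => i; apply: L2Z.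
by have [] := ey_L2 i j l.
Qed.

(** Increments at different times are orthogonal: the partial sum up to k involves noises of earlier
    times, hence none of those added next. *)
Lemma ymart_var k l : mean P (fun w => ymart pr r (N w) k l ^+ 2) <=
  n%:R ^+ 2 * sigma * \sum_(j < k) lambda pr j ^+ 2.
Proof.
elim: k => [|k ih].
  rewrite big_ord0 mulr0 (_ : (fun _ => _) = fun=> 0) ?mean_cst//.
  by apply/funext => w; rewrite /ymart big_ord0 expr0n.
have y2 i : L2 P (fun w => tnth (ey i k w) l) by have [] := ey_L2 i k l.
have SE : (fun w => ymart pr r (N w) k.+1 l ^+ 2) = (fun w =>
    (ymart pr r (N w) k l + \sum_i (lambda pr k * r i 0) * tnth (ey i k w) l) ^+ 2).
  apply/funext => w; rewrite !ymartE big_ord_recr/= mulr_sumr; congr ((_ + _) ^+ 2).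
  by apply: eq_bigr => i _; rewrite mulrA.
rewrite SE mean_sqrD; last 3 first.
- exact: ymart_L2.
- by apply: L2_sum => i; exact: L2Z.
- apply: mean_sqrM_sum0 => //; first exact: ymart_L2.
  move=> i; apply: (@noise_orthogonal (inl (inr (i, k)))) => //.
  + rewrite [X in measurable_fun _ X](_ : _ = fun w => \sum_(j < k) lambda pr j *
      \sum_i r i 0 * tnth (ey i j w) l); last first.
      by apply/funext => w; rewrite ymartE.
    apply: measurable_fun_sumR => j; apply: measurable_fun_Zl.
    apply: measurable_fun_sumR => i'; apply: measurable_fun_Zl.
    apply: (@other_measurable _ (inl (inr (i', nat_of_ord j)))); last exact: sigma_ey.
    by apply/eqP => -[_ jk]; have := ltn_ord j; rewrite jk ltnn.
  + exact: ymart_L2.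
  + by have [] := ey_L2 i k l.
  + exact: sigma_ey.
rewrite big_ord_recr/= [leRHS]mulrDr; apply: lerD => //.
apply: le_trans (mean_sqr_sumZ _ y2 _) _.
  by move=> i; have [] := ey_L2 i k l.
have -> : n%:R ^+ 2 * sigma * lambda pr k ^+ 2 =
    n%:R * sigma * (n%:R * lambda pr k ^+ 2) by ring.
rewrite mulrAC ler_wpM2l ?mulr_ge0//.
rewrite mulr_natl -[X in _ *+ X](card_ord n) -sumr_const; apply: ler_sum => i _.
by rewrite exprMn ler_piMr ?sqr_ge0// expr_le1.
Qed.

End martingale.
End noise.

(** * The coupled recursion of the three mean squares *)

Section coupled_recursion.
Context {R : realType}.

(* [V = U + X + (2 C / c2) Z] contracts at the rate of the slow gain [al]. *)
Lemma coupled_recursion (U X Z D : nat -> R) (K : nat)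
    (ca cb a b m c1 c2 C : R) :
  let al := power_gain ca a in let be := power_gain cb b in
  0 < ca -> 0 < cb -> 0 < a -> a < 1 -> b < a -> 0 <= m <= 1 ->
  m <= a - b -> m <= 2 * b - a ->
  0 < c1 -> 0 < c2 -> 0 <= C ->
  (forall k, 0 <= U k) -> (forall k, 0 <= X k) -> (forall k, 0 <= Z k) ->
  (forall k, (K <= k)%N -> D k <= C * k.+1%:R `^ (- m)) ->
  (forall k, (K <= k)%N -> U k.+1 <=
     (1 - al k * c1) * U k + al k * C * (X k + D k) + C * be k ^+ 2) ->
  (forall k, (K <= k)%N -> X k.+1 <=
     (1 - be k * c2) * X k + be k * C * Z k
     + C * (al k ^+ 2 / be k) * (1 + U k + X k) + C * be k ^+ 2) ->
  (forall k, (K <= k)%N -> Z k.+1 <=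
     (1 - be k * c2) * Z k
     + C * (al k ^+ 2 / be k) * (1 + U k + X k) + C * be k ^+ 2) ->
  exists B, exists K', forall k, (K' <= k)%N ->
    [/\ U k <= B * k.+1%:R `^ (- m), X k <= B * k.+1%:R `^ (- m)
      & Z k <= B * k.+1%:R `^ (- m)].
Proof.
move=> al be ca0 cb0 a0 a1 ba m01 mab mba c10 c20 C0 U0 X0 Z0 DC recU recX recZ.
have m0 : 0 <= m by case/andP: m01.
have alE0 k : al k = ca * k.+1%:R `^ (- a) by exact: power_gainE.
have beE0 k : be k = cb * k.+1%:R `^ (- b) by exact: power_gainE.
clearbody al be.
(* Large enough that half the contraction of [tau Z] absorbs the coupling term C Z in the recursion
   of [X]; the added 1 keeps it positive when C = 0. *)
pose tau := 2 * C / c2 + 1.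
have tau0 : 0 < tau by rewrite ltr_wpDl// divr_ge0 ?mulr_ge0// ltW.
have tauC : C <= tau * c2 / 2.
  have -> : tau * c2 / 2 = C + c2 / 2 by rewrite /tau; field; rewrite gt_eqF.
  by rewrite lerDl divr_ge0// ltW.
(* The total coefficient in [V] of the forcing (al^2 / be)(1 + U + X): C from [X] and tau C from
   [Z]. *)
pose eta := C * (1 + tau).
have eta0 : 0 <= eta by rewrite mulr_ge0// addr_ge0// ltW.
pose c := Num.min (c1 / 2) 1.
have c0 : 0 < c by rewrite lt_min ltr01 divr_gt0.
(* An upper bound for al / be at late times. The three entries make the forcing small against the
   contraction of [U], the terms in [X] small against that of [X], and the slow rate at most half
   the fast one. *)
pose th := Num.min (c1 / (2 * (eta + 1))) (Num.min (c2 / (2 * (C + c1 + 1))) (c2 / 2)).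
have d1 : 0 < 2 * (eta + 1) by rewrite mulr_gt0// ltr_wpDl.
have d2 : 0 < 2 * (C + c1 + 1) by rewrite mulr_gt0// ltr_wpDl// addr_ge0// ltW.
have th0 : 0 < th by rewrite !lt_min !divr_gt0.
have ab0 : 0 < a - b by rewrite subr_gt0.
have tc0 : 0 < th * cb / ca by rewrite divr_gt0// mulr_gt0.
have cc0 : 0 < 1 / (c * ca) by rewrite divr_gt0// mulr_gt0.
have [K1 _ hK1] := near_powR_natSN_le ab0 tc0.
have [K2 _ hK2] := near_powR_natSN_le a0 cc0.
pose K' := (K + K1 + K2)%N.
pose V k := U k + X k + tau * Z k.
have V0 k : 0 <= V k by rewrite !addr_ge0// mulr_ge0// ltW.
pose C' := ca * (C * C) + (2 + tau) * C * cb ^+ 2 + eta * (ca ^+ 2 / cb).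
have C'0 : 0 <= C'.
  apply: addr_ge0; first apply: addr_ge0.
  - by rewrite mulr_ge0 ?mulr_ge0// ltW.
  - by rewrite mulr_ge0 ?sqr_ge0// mulr_ge0// addr_ge0// ltW.
  - by rewrite mulr_ge0// divr_ge0 ?sqr_ge0// ltW.
have cca0 : 0 < c * ca by rewrite mulr_gt0.
have [B hB] : exists B, forall k, (K' <= k)%N -> V k <= B * k.+1%:R `^ (- m).
  apply: (@chung _ V K' a m (c * ca) C') => // k Kk.
  have kK : (K <= k)%N by rewrite (leq_trans _ Kk)// /K' -addnA leq_addr.
  have kK1 : (K1 <= k)%N by rewrite (leq_trans _ Kk)// /K' addnAC leq_addl.
  have kK2 : (K2 <= k)%N by rewrite (leq_trans _ Kk)// /K' leq_addl.
  have := hK1 _ kK1; have := hK2 _ kK2; move=> /= h2 h1.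
  split; first by move: h2; rewrite ler_pdivlMr// mulrC.
  have alE := alE0 k.
  have beE := beE0 k.
  set M := k.+1%:R `^ (- m); set pa := k.+1%:R `^ (- a) in alE h2 *.
  set pb := k.+1%:R `^ (- b) in beE.
  have M0 : 0 < M by exact: powR_natS_gt0.
  have pa0 : 0 < pa by exact: powR_natS_gt0.
  have pb0 : 0 < pb by exact: powR_natS_gt0.
  have al0 : 0 < al k by rewrite alE mulr_gt0.
  have be0 : 0 < be k by rewrite beE mulr_gt0.
  have leM s : m <= s -> k.+1%:R `^ (- s) <= M.
    by move=> ms; rewrite /M ler_powR// ?lerN2// ler1n.
  have papb : pa = pb * k.+1%:R `^ (- (a - b)).
    by rewrite /pa /pb -natS_powRD; congr (_ `^ _); ring.
  have albe : al k <= th * be k.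
    rewrite alE beE papb.
    move: h1; set y := _ `^ (- (a - b)) => h1.
    have := ler_wpM2l (ltW (mulr_gt0 ca0 pb0)) h1.
    have -> : ca * pb * (th * cb / ca) = th * (cb * pb) by field; rewrite gt_eqF.
    by rewrite mulrA.
  pose g := al k ^+ 2 / be k.
  have g0 : 0 <= g by rewrite divr_ge0 ?sqr_ge0// ltW.
  have gal : g <= al k * th.
    rewrite /g ler_pdivrMr//; have := ler_wpM2l (ltW al0) albe.
    by rewrite mulrA -expr2.
  have gM : eta * g <= eta * (ca ^+ 2 / cb) * (pa * M).
    rewrite -mulrA ler_wpM2l// /g alE beE.
    have -> : (ca * pa) ^+ 2 / (cb * pb) = ca ^+ 2 / cb * (pa * k.+1%:R `^ (- (a - b))).
      by rewrite papb; field; rewrite !gt_eqF.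
    rewrite ler_wpM2l//; first by rewrite divr_ge0 ?sqr_ge0// ltW.
    by rewrite ler_wpM2l ?leM// ltW.
  have bM : be k ^+ 2 <= cb ^+ 2 * (pa * M).
    rewrite beE exprMn ler_wpM2l ?sqr_ge0//.
    have -> : pb ^+ 2 = pa * k.+1%:R `^ (- (2 * b - a)).
      by rewrite expr2 /pa /pb -!natS_powRD; congr (_ `^ _); ring.
    by rewrite ler_wpM2l ?leM// ltW.
  have t1 : eta * th <= c1 / 2.
    have : th <= c1 / (2 * (eta + 1)) by rewrite ge_min lexx.
    rewrite ler_pdivlMr// => h; have := ltW th0; lra.
  have t2 : th * (C + c1) <= c2 / 2.
    have : th <= c2 / (2 * (C + c1 + 1)) by rewrite !ge_min lexx orbT.
    rewrite ler_pdivlMr// => h; have := ltW th0; lra.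
  have t3 : th <= c2 / 2 by rewrite !ge_min lexx !orbT.
  have cc1 : c <= c1 / 2 by rewrite ge_min lexx.
  have cle1 : c <= 1 by rewrite ge_min lexx orbT.
  have eg : eta * g <= al k * (c1 / 2).
    apply: le_trans (ler_wpM2l eta0 gal) _.
    by rewrite mulrCA ler_wpM2l// ltW.
  have alc : al k * c <= be k * (c2 / 2).
    apply: (@le_trans _ _ (al k)); first by rewrite ler_piMr// ltW.
    by apply: le_trans albe _; rewrite mulrC ler_wpM2l// ltW.
  have uU : (1 - al k * c1) * U k + eta * g * U k <= (1 - al k * c) * U k.
    rewrite -mulrDl ler_wpM2r//.
    have : al k * c <= al k * (c1 / 2) by rewrite ler_wpM2l// ltW.
    lra.
  have alX : al k * C + eta * g <= be k * (c2 / 2).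
    apply: (@le_trans _ _ (al k * (C + c1))).
      by rewrite mulrDr lerD2l (le_trans eg)// ler_wpM2l ?(ltW al0)//; lra.
    apply: (@le_trans _ _ (th * be k * (C + c1))).
      have Cc0 : 0 <= C + c1 by apply: addr_ge0 => //; exact: ltW.
      exact: (ler_wpM2r Cc0 albe).
    by rewrite mulrAC mulrC ler_wpM2l// ltW.
  have uX : (1 - be k * c2) * X k + al k * C * X k + eta * g * X k <= (1 - al k * c) * X k.
    rewrite -!mulrDl ler_wpM2r//; lra.
  have uZ : tau * ((1 - be k * c2) * Z k) + be k * C * Z k <= (1 - al k * c) * (tau * Z k).
    have h3 : be k * C * Z k <= be k * (tau * c2 / 2) * Z k.
      by rewrite ler_wpM2r// ler_wpM2l// ltW.
    have h4 : al k * c * (tau * Z k) <= be k * (c2 / 2) * (tau * Z k).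
      by rewrite ler_wpM2r// mulr_ge0// ltW.
    have -> : (1 - al k * c) * (tau * Z k) = tau * Z k - al k * c * (tau * Z k) by ring.
    have -> : tau * ((1 - be k * c2) * Z k) =
      tau * Z k - 2 * (be k * (c2 / 2) * (tau * Z k)) by field.
    have e3 : be k * (tau * c2 / 2) * Z k = be k * (c2 / 2) * (tau * Z k) by ring.
    rewrite e3 in h3; lra.
  have uD : al k * C * D k <= ca * (C * C) * (pa * M).
    have -> : ca * (C * C) * (pa * M) = al k * C * (C * M) by rewrite alE; ring.
    by rewrite ler_wpM2l ?DC// mulr_ge0// ltW.
  have uB : (2 + tau) * C * be k ^+ 2 <= (2 + tau) * C * cb ^+ 2 * (pa * M).
    by rewrite -[leRHS]mulrA ler_wpM2l// mulr_ge0// addr_ge0// ltW.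
  have rZ := ler_wpM2l (ltW tau0) (recZ k kK).
  have := lerD (lerD (recU k kK) (recX k kK)) rZ.
  rewrite -/(V k.+1) -/g => hV; apply: le_trans hV _.
  have -> : c * ca * pa = al k * c by rewrite alE; ring.
  have -> : (1 - al k * c1) * U k + al k * C * (X k + D k) + C * be k ^+ 2 +
    ((1 - be k * c2) * X k + be k * C * Z k + C * g * (1 + U k + X k) + C * be k ^+ 2) +
    tau * ((1 - be k * c2) * Z k + C * g * (1 + U k + X k) + C * be k ^+ 2) =
    ((1 - al k * c1) * U k + eta * g * U k) +
    ((1 - be k * c2) * X k + al k * C * X k + eta * g * X k) +
    (tau * ((1 - be k * c2) * Z k) + be k * C * Z k) +
    (al k * C * D k + (2 + tau) * C * be k ^+ 2 + eta * g).
    by rewrite /eta; ring.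
  rewrite /V [in leRHS]mulrDr [in leRHS]mulrDr; apply: lerD.
    by apply: lerD => //; apply: lerD.
  rewrite /C' [in leRHS]mulrDl [in leRHS]mulrDl.
  by apply: lerD => //; apply: lerD.
(* [Z] enters [V] with weight tau, so its own bound is [B / tau]. *)
exists (B + B / tau), K' => k Kk.
have := hB k Kk; rewrite /V; set M := k.+1%:R `^ (- m) => h.
have M0 : 0 < M by exact: powR_natS_gt0.
have tZ0 : 0 <= tau * Z k by rewrite mulr_ge0// ltW.
have B0 : 0 <= B by rewrite -(pmulr_lge0 _ M0) (le_trans (V0 k)).
have Bt0 : 0 <= B / tau * M by rewrite mulr_ge0 ?(ltW M0)// divr_ge0// ltW.
have BM0 : 0 <= B * M by rewrite mulr_ge0// ltW.
have UX := U0 k; have XX := X0 k.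
rewrite mulrDl; split; [lra|lra|].
have : Z k <= B / tau * M.
  rewrite mulrAC ler_pdivlMr// mulrC; lra.
by lra.
Qed.

End coupled_recursion.

(** * One-step bounds and mean recursions *)

Section iteration_bounds.
Context {R : realType} {n : nat}.
Variables (W : 'M[R]_n) (r : 'cV[R]_n) (f : 'I_n -> R -> R) (mu L xstar : R)
  (A : 'M[R]_n) (rho c : R).
Hypotheses (n0 : (0 < n)%N) (W1 : W *m ones R n = ones R n)
  (rW : r^T *m W = r^T) (r0 : forall i, 0 < r i 0) (r1 : \sum_(i < n) r i 0 = 1)
  (rle1 : forall i, r i 0 <= 1)
  (mu0 : 0 < mu) (L0 : 0 < L)
  (fc : forall i, strongly_convex mu (f i)) (fs : forall i, smooth L (f i))
  (xmin : forall x, mean_objective f xstar <= mean_objective f x)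
  (Au : A \in unitmx) (c0 : 0 < c) (rho0 : 0 < rho)
  (contr : mxnormA A (lazy_mx W c - ones R n *m r^T) <= 1 - c * rho)
  (scaleA : forall v : 'cV[R]_n, norm2 v <= normA A v).

Lemma sqn_le_sqA (v : 'cV[R]_n) : sqn v <= sqA A v.
Proof. by rewrite /sqA -!norm2_sqr ler_sqr ?nnegrE ?norm2_ge0//; exact: scaleA. Qed.

(** Individual gradients need not vanish at the minimizer of the mean; this is the part of the drive
    that persists there. *)
Definition grad_energy : R := \sum_i derive1 (f i) xstar ^+ 2.

Lemma grad_energy_ge0 : 0 <= grad_energy.
Proof. by apply: sumr_ge0 => i _; exact: sqr_ge0. Qed.

Lemma grad_sqr_le i y :
  derive1 (f i) y ^+ 2 <= 2 * derive1 (f i) xstar ^+ 2 + 2 * L ^+ 2 * (y - xstar) ^+ 2.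
Proof.
have h : (derive1 (f i) y - derive1 (f i) xstar) ^+ 2 <= L ^+ 2 * (y - xstar) ^+ 2.
  rewrite -exprMn -[leLHS]real_normK ?num_real// -[leRHS]real_normK ?num_real//.
  by rewrite ler_sqr ?nnegrE// normrM (gtr0_norm L0); exact: (fs i).2.
have := sqr_ge0 (derive1 (f i) y - 2 * derive1 (f i) xstar).
move: h; set a := derive1 (f i) y; set b := derive1 (f i) xstar; set D := (y - _) ^+ 2.
have -> : (a - b) ^+ 2 = a ^+ 2 - 2 * (a * b) + b ^+ 2 by ring.
have -> : (a - 2 * b) ^+ 2 = a ^+ 2 - 4 * (a * b) + 4 * b ^+ 2 by ring.
by move=> h1 h2; lra.
Qed.

(** One bound for both consensus errors: s = 1 for x, whose update contains the increment of z, and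
    s = 0 for z. The factor 3/(b rho) of the perturbed contraction turns b^2 into b and a^2 into
    a^2/b. *)
Lemma consensus_step_le (x z h : 'cV[R]_n) (a b s : R) : 0 < b <= c -> s ^+ 2 <= 1 ->
  sqA A (lazy_mx W b *m (Qmx r *m x)
         - (s *: (b *: ((W - 1%:M) *m (Qmx r *m z))) + a *: (Qmx r *m h))) <=
  (1 - b * (rho / 2)) * sqA A (Qmx r *m x)
  + b * (6 / rho * frob (A *m (W - 1%:M))) * (s ^+ 2 * sqA A (Qmx r *m z))
  + 6 / rho * frob (A *m Qmx r) * (a ^+ 2 / b) * sqn h.
Proof.
move=> /andP[b0 bc] s1.
have bb : 0 < b <= c by rewrite b0.
apply: le_trans (contraction_perturbed r1 Au c0 rho0 contr x _ bb) _.
rewrite -addrA; apply: lerD; first by rewrite mulrA.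
have k0 : 0 <= 3 / (b * rho) by rewrite divr_ge0// mulr_ge0// ltW.
have wb : sqA A (- (s *: (b *: ((W - 1%:M) *m (Qmx r *m z))) + a *: (Qmx r *m h))) <=
   2 * (s ^+ 2 * b ^+ 2 * (frob (A *m (W - 1%:M)) * sqA A (Qmx r *m z))) +
   2 * (a ^+ 2 * (frob (A *m Qmx r) * sqn h)).
  rewrite /sqA mulmxN sqnN mulmxDr; apply: le_trans (sqnD2 _ _) _.
  rewrite scalerA -!scalemxAr !sqnZ exprMn.
  have sb0 : 0 <= s ^+ 2 * b ^+ 2 by rewrite -exprMn sqr_ge0.
  apply: lerD; rewrite ler_wpM2l// ler_wpM2l ?sqr_ge0//.
    rewrite (mulmxA A (W - 1%:M)); apply: le_trans (sqn_mulmx _ _) _.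
    by apply: ler_wpM2l; [exact: frob_ge0|exact: sqn_le_sqA].
  by rewrite mulmxA sqn_mulmx.
apply: le_trans (ler_wpM2l k0 wb) _.
by rewrite le_eqVlt; apply/orP; left; apply/eqP; field; rewrite !gt_eqF.
Qed.

Section step.
Variables (x : 'cV[R]_n) (kap : 'I_n -> R) (CK : R).
Hypothesis kapb : forall i, `|kap i| <= CK.

Definition drive : 'cV[R]_n := \col_i (kap i * derive1 (f i) (x i 0)).

Let u := wavg r x - xstar.
Let xc := Qmx r *m x.
Let Dl := \sum_i (kap i - 1 / (n%:R * r i 0)) ^+ 2.

Let kap2 i : kap i ^+ 2 <= CK ^+ 2.
Proof.
rewrite -[leLHS]real_normK ?num_real// ler_sqr ?nnegrE//.
exact: le_trans (kapb i).
Qed.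

Lemma sqn_drive_le : sqn drive <=
  CK ^+ 2 * (2 * grad_energy + 4 * L ^+ 2 * (n%:R * u ^+ 2 + sqn xc)).
Proof.
have -> : CK ^+ 2 * (2 * grad_energy + 4 * L ^+ 2 * (n%:R * u ^+ 2 + sqn xc)) =
  \sum_i CK ^+ 2 * (2 * derive1 (f i) xstar ^+ 2 +
    4 * L ^+ 2 * (u ^+ 2 + xc i 0 ^+ 2)).
  rewrite -mulr_sumr big_split/= -!mulr_sumr big_split/= sumr_const card_ord.
  by rewrite -[u ^+ 2 *+ n]mulr_natl.
apply: ler_sum => i _; rewrite mxE exprMn; apply: ler_pM; rewrite ?sqr_ge0//.
apply: le_trans (grad_sqr_le _ _) _; rewrite lerD2l.
have -> : x i 0 - xstar = u + xc i 0 by rewrite /xc Qmx_coord /u; ring.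
have -> : 4 * L ^+ 2 * (u ^+ 2 + xc i 0 ^+ 2) =
  2 * L ^+ 2 * (u + xc i 0) ^+ 2 + 2 * L ^+ 2 * (u - xc i 0) ^+ 2 by ring.
by rewrite lerDl mulr_ge0 ?sqr_ge0// mulr_ge0// sqr_ge0.
Qed.

(** The ideal weight 1/(n r_i) cancels the Perron weight r_i and gives the plain mean gradient. What
    remains splits into a consensus part [p1] and a weight part [p2]. *)
Lemma drive_error_le : (wavg r drive - mean_grad f (wavg r x)) ^+ 2 <=
  2 * n%:R * (CK ^+ 2 * L ^+ 2 * sqn xc
              + Dl * (2 * grad_energy + 2 * L ^+ 2 * u ^+ 2)).
Proof.
set xt := wavg r x.
have nR : 0 < n%:R :> R by rewrite ltr0n.
pose p1 i := r i 0 * kap i * (derive1 (f i) (x i 0) - derive1 (f i) xt).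
pose p2 i := r i 0 * (kap i - 1 / (n%:R * r i 0)) * derive1 (f i) xt.
have -> : wavg r drive - mean_grad f xt = \sum_i (p1 i + p2 i).
  rewrite /wavg /mean_grad mulr_sumr -sumrB; apply: eq_bigr => i _.
  rewrite mxE /p1 /p2; field.
  by rewrite !gt_eqF.
apply: le_trans (sqr_sum_le _) _; rewrite card_ord.
have yE (Y : R) : 2 * n%:R * Y = n%:R * (2 * Y) by ring.
rewrite yE ler_wpM2l//.
rewrite mulrDr /Dl mulr_suml !mulr_sumr -big_split/=; apply: ler_sum => i _.
apply: (@le_trans _ _ (2 * p1 i ^+ 2 + 2 * p2 i ^+ 2)).
  rewrite -subr_ge0 (_ : _ - (p1 i + p2 i) ^+ 2 = (p1 i - p2 i) ^+ 2); last by ring.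
  exact: sqr_ge0.
have ri2 : r i 0 ^+ 2 <= 1 by rewrite expr_le1// ltW.
apply: lerD; rewrite ler_wpM2l//.
  rewrite /p1 !exprMn -[leRHS]mulrA; apply: ler_pM;
    rewrite ?(mulr_ge0 (sqr_ge0 _) (sqr_ge0 _)) ?sqr_ge0//.
    by apply: le_trans (kap2 i); rewrite ler_piMl ?sqr_ge0.
  rewrite -exprMn -[leLHS]real_normK ?num_real// -[leRHS]real_normK ?num_real//.
  rewrite ler_sqr ?nnegrE// normrM (gtr0_norm L0) /xc Qmx_coord; exact: (fs i).2.
rewrite /p2 !exprMn; apply: ler_pM;
    rewrite ?(mulr_ge0 (sqr_ge0 _) (sqr_ge0 _)) ?sqr_ge0//.
  by rewrite ler_piMl ?sqr_ge0.
apply: le_trans (grad_sqr_le _ _) _; apply: lerD; last by [].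
rewrite -mulr_sumr; apply: ler_wpM2l => //.
by rewrite (bigD1 i)//= lerDl; apply: sumr_ge0 => j _; exact: sqr_ge0.
Qed.

(** The product of the weight error [Dl] and u^2 is absorbed pathwise by half of the strong
    convexity, thanks to the smallness of [dl]. Only terms linear in [Dl] or in the consensus error
    remain to be averaged. *)
Lemma avg_step_le (a dl : R) : 0 < a -> a * L <= 1 -> a * mu < 1 ->
  0 <= dl -> Dl <= dl -> 4 * n%:R * L ^+ 2 * dl <= mu ^+ 2 / 2 ->
  (u - a * wavg r drive) ^+ 2 <=
  (1 - a * (mu / 2)) * u ^+ 2 + a * (2 * n%:R * CK ^+ 2 * L ^+ 2 / mu * sqA A xc
                                  + 4 * n%:R * grad_energy / mu * Dl).
Proof.
move=> a0 aL am dl0 Ddl hdl.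
pose dlt := wavg r drive - mean_grad f (wavg r x).
have -> : u - a * wavg r drive =
    wavg r x - xstar - a * (mean_grad f (wavg r x) + dlt) by rewrite /dlt /u; ring.
apply: le_trans (mean_grad_step n0 mu0 L0 fc fs xmin (wavg r x) dlt a0 aL am) _.
rewrite -/u.
have am0 : 0 <= a / mu by rewrite divr_ge0// ltW.
have := ler_wpM2l am0 drive_error_le; rewrite -/dlt => h.
apply: le_trans (lerD (lexx _) h) _.
have nL0 : 0 <= 2 * n%:R * CK ^+ 2 * L ^+ 2 / mu * a.
  have -> : 2 * n%:R * CK ^+ 2 * L ^+ 2 / mu * a = 2 * n%:R / mu * a * (CK * L) ^+ 2.
    by ring.
  apply: mulr_ge0; last exact: sqr_ge0.
  by rewrite mulr_ge0 ?(ltW a0)// divr_ge0 ?(ltW mu0)// mulr_ge0.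
have h1 := ler_wpM2l nL0 (sqn_le_sqA xc).
have u20 : 0 <= u ^+ 2 by exact: sqr_ge0.
have h2 : a / mu * (4 * n%:R * L ^+ 2 * Dl) * u ^+ 2 <= a * (mu / 2) * u ^+ 2.
  rewrite ler_wpM2r//.
  have -> : a * (mu / 2) = a / mu * (mu ^+ 2 / 2) by field; rewrite gt_eqF.
  rewrite ler_wpM2l//; apply: le_trans hdl; rewrite ler_wpM2l//.
  by apply: mulr_ge0; [exact: mulr_ge0|exact: sqr_ge0].
have -> : (1 - a * mu) * u ^+ 2 + a / mu * (2 * n%:R * (CK ^+ 2 * L ^+ 2 * sqn xc +
    Dl * (2 * grad_energy + 2 * L ^+ 2 * u ^+ 2))) =
  (1 - a * mu) * u ^+ 2 + 2 * n%:R * CK ^+ 2 * L ^+ 2 / mu * a * sqn xc +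
  (a * (4 * n%:R * grad_energy / mu * Dl) + a / mu * (4 * n%:R * L ^+ 2 * Dl) * u ^+ 2).
  by field; rewrite gt_eqF.
have -> : (1 - a * (mu / 2)) * u ^+ 2 + a * (2 * n%:R * CK ^+ 2 * L ^+ 2 / mu * sqA A xc
    + 4 * n%:R * grad_energy / mu * Dl) =
  (1 - a * mu) * u ^+ 2 + 2 * n%:R * CK ^+ 2 * L ^+ 2 / mu * a * sqA A xc +
  (a * (4 * n%:R * grad_energy / mu * Dl) + a * (mu / 2) * u ^+ 2).
  by field; rewrite gt_eqF.
by apply: lerD; rewrite lerD2l.
Qed.

End step.

Section recursion_identities.
Variables (pr : RXi_parameters R n) (e : noise_realization R n) (k : nat).
Hypotheses (WE : weights pr = W) (fE : objective pr = f).
Let s := RXi pr e k.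
Let s' := RXi pr e k.+1.
Let be := beta pr k.
Let al := alpha pr k.
Let h := drive (x_ s) (kappa_prev s').
Let nx : 'cV[R]_n := \col_i noise_x e i k.
Let nz : 'cV[R]_n := \col_i noise_z e i k.

Lemma z_next : z_ s' = lazy_mx W be *m z_ s + (be *: nz + al *: h).
Proof.
apply/colP => i.
have -> : z_ s' i 0 = (1 - be) * z_ s i 0 + be * (\sum_j W i j * z_ s j 0 + noise_z e i k)
    + al * kappa_prev s' i * derive1 (f i) (x_ s i 0).
  by rewrite /s' /= mxE -/s WE fE.
rewrite /lazy_mx mulmxDl -!scalemxAl mul1mx !mxE mulrDr -!addrA.
by congr (_ + (_ + (_ + _))); rewrite mulrA.
Qed.

Lemma x_next : x_ s' = lazy_mx W be *m x_ s + be *: nx - (z_ s' - z_ s).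
Proof.
apply/colP => i.
have -> : x_ s' i 0 = (1 - be) * x_ s i 0 + be * (\sum_j W i j * x_ s j 0 + noise_x e i k)
    - (z_ s' i 0 - z_ s i 0).
  by rewrite /s' /= mxE -/s WE.
move: (z_ s') => zs'; rewrite /lazy_mx mulmxDl -!scalemxAl mul1mx !mxE.
by rewrite mulrDr addrA.
Qed.

Lemma zc_next : Qmx r *m z_ s' =
  (lazy_mx W be *m (Qmx r *m z_ s) + al *: (Qmx r *m h))
  + (0 *m nx + (be *: Qmx r) *m nz).
Proof.
rewrite z_next !mulmxDr (Qmx_lazy W1 rW) mul0mx add0r -scalemxAl -!scalemxAr.
by rewrite addrA addrAC.
Qed.

(** The trivial scalar 1 matches the parameter s of [consensus_step_le]. The matrix [W - 1%:M] comes
    from replacing the increment of z by its own update. *)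
Lemma xc_next : Qmx r *m x_ s' =
  (lazy_mx W be *m (Qmx r *m x_ s)
    - (1 *: (be *: ((W - 1%:M) *m (Qmx r *m z_ s))) + al *: (Qmx r *m h)))
  + ((be *: Qmx r) *m nx + (- be *: Qmx r) *m nz).
Proof.
rewrite x_next mulmxBr mulmxDr mulmxBr zc_next (Qmx_lazy W1 rW) mul0mx add0r.
rewrite -[Qmx r *m (be *: nx)]scalemxAr -!scalemxAl.
move: (Qmx r *m x_ s) (Qmx r *m z_ s) (Qmx r *m h) (Qmx r *m nx) (Qmx r *m nz).
move=> X Z H NX NZ; rewrite scale1r mulmxBl /lazy_mx !mulmxDl -!scalemxAl !mul1mx.
move: (W *m X) (W *m Z) => WX WZ.
by apply/colP => i; rewrite !mxE; ring.
Qed.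

(** Mixing leaves averages unchanged, so the average of the increment of z is the current drive plus
    noise: the average of x makes a noisy gradient step. *)
Lemma avg_next : wavg r (x_ s') - xstar =
  (wavg r (x_ s) - xstar - al * wavg r h) + (be * wavg r nx - be * wavg r nz).
Proof.
have zE : wavg r (z_ s') = wavg r (z_ s) + (be * wavg r nz + al * wavg r h).
  by rewrite z_next !wavgD !wavgZ (wavg_lazy rW).
have := x_next; rewrite -scaleN1r => ->.
by rewrite wavgD wavgZ -(scaleN1r (z_ s)) !wavgD !wavgZ (wavg_lazy rW) zE; ring.
Qed.

End recursion_identities.
End iteration_bounds.

Lemma frobZ (R : realType) m p (s : R) (M : 'M[R]_(m, p)) :
  frob (s *: M) = s ^+ 2 * frob M.
Proof.
rewrite /frob mulrCA; congr (_ * _); rewrite mulr_sumr; apply: eq_bigr => i _.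
by rewrite mulr_sumr; apply: eq_bigr => j _; rewrite mxE exprMn.
Qed.

Section vector_L2.
Context d (T : measurableType d) (R : realType) (P : probability T R).

Lemma L2_mulmx m n (M : 'M[R]_(m, n)) (v : T -> 'cV[R]_n) i :
  (forall j, L2 P (fun w => v w j 0)) -> L2 P (fun w => (M *m v w) i 0).
Proof.
move=> v2; apply: (@L2_ext _ _ _ P (fun w => \sum_j M i j * v w j 0)).
  by move=> w; rewrite mxE.
by apply: L2_sum => j; exact: L2Z.
Qed.

Lemma L1_sqn n (v : T -> 'cV[R]_n) :
  (forall j, L2 P (fun w => v w j 0)) -> L1 P (fun w => sqn (v w)).
Proof. by move=> v2; apply: L1_sum => i; case: (v2 i). Qed.

Lemma L1_sqA n (A : 'M[R]_n) (v : T -> 'cV[R]_n) :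
  (forall j, L2 P (fun w => v w j 0)) -> L1 P (fun w => sqA A (v w)).
Proof. by move=> v2; apply: L1_sqn => j; exact: L2_mulmx. Qed.

Lemma L2_wavg n (r : 'cV[R]_n) (v : T -> 'cV[R]_n) :
  (forall j, L2 P (fun w => v w j 0)) -> L2 P (fun w => wavg r (v w)).
Proof. by move=> v2; apply: L2_sum => i; exact: L2Z. Qed.

Lemma expectation_mean (g : T -> R) : L1 P g -> ('E_P[g] = (mean P g)%:E)%E.
Proof. by move=> g1; rewrite unlock /mean /Rintegral fineK// integrable_fin_num. Qed.

End vector_L2.

(** * Recursions for the mean squares of the iterates *)

Section mean_recursions.
Context (R : realType) (d : measure_display) (T : measurableType d)
    (P : probability T R) (n : nat).
Variables
    (edge : rel 'I_n) (W : 'M[R]_n) (r : 'cV[R]_n)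
    (f : 'I_n -> R -> R) (mu L xstar : R)
    (sigma sigma_y : R)
    (ex : 'I_n -> nat -> {RV P >-> R})
    (ey : 'I_n -> nat -> {RV P >-> n.-tuple R})
    (ez : 'I_n -> nat -> {RV P >-> R})
    (c_lambda c_gamma c_alpha c_beta p q a b eps : R)
    (x0 z0 : 'cV[R]_n) (A : 'M[R]_n) (rhoA : R).
Hypotheses
    (hW : weight_mx edge W) (hr : left_perron W r)
    (hmu : 0 < mu) (hL : 0 < L)
    (hf_convex : forall i, strongly_convex mu (f i))
    (hf_smooth : forall i, smooth L (f i))
    (hxstar : forall x, mean_objective f xstar <= mean_objective f x)
    (hsigma : 0 < sigma)
    (hnoise : noise_assumption sigma sigma_y ex ey ez)
    (hc_lambda : 0 < c_lambda <= 1) (hc_beta : 0 < c_beta <= 1)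
    (hc_gamma : 0 < c_gamma) (hc_alpha : 0 < c_alpha)
    (hq : 0 < q) (hqp : q < p) (hp : p < 1)
    (hb : 1 / 2 < b) (hba : b < a) (ha : a < 1)
    (heps : 0 < eps)
    (hA : A \in unitmx) (hrhoA : 0 < rhoA)
    (hA_contract : forall k : nat,
       mxnormA A (lazy_mx W (power_gain c_beta b k) - ones R n *m r^T)
         <= 1 - power_gain c_beta b k * rhoA < 1)
    (hA_scale : forall v : 'cV[R]_n, norm2 v <= normA A v).

Let pr := {| weights := W; objective := f;
             lambda := power_gain c_lambda p;
             gamma := power_gain c_gamma q;
             alpha := power_gain c_alpha a;
             beta := power_gain c_beta b;
             eps_kappa := eps; x_init := x0; z_init := z0 |}.
Let m : R := Num.min (2 * (1 - p)) (Num.min (a - b) (2 * b - a)).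
Local Notation N w := (noise_at ex ey ez w).
Local Notation st w k := (RXi pr (N w) k).
Local Notation al k := (power_gain c_alpha a k).
Local Notation be k := (power_gain c_beta b k).

Let W0 i j : 0 <= W i j. Proof. by have [_ _ [h _] _] := hW; exact: h. Qed.
Let W1 : W *m ones R n = ones R n. Proof. by have [_ _ _] := hW. Qed.
Let rW : r^T *m W = r^T. Proof. by have [_ h _] := hr. Qed.
Let r0 i : 0 < r i 0. Proof. by have [h _ _] := hr; exact: h. Qed.
Let r1 : \sum_(i < n) r i 0 = 1. Proof. by have [_ _] := hr. Qed.
Let rle1 i : r i 0 <= 1. Proof. exact: (perron_le1 r0 r1). Qed.
Let n0 : (0 < n)%N.
Proof. exact: sum_ord_eq1_gt0 r1. Qed.
Let nR : 0 < n%:R :> R. Proof. by rewrite ltr0n. Qed.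
Let cb0 : 0 < c_beta. Proof. by case/andP: hc_beta. Qed.
Let b0 : 0 < b. Proof. by apply: lt_trans hb; rewrite divr_gt0. Qed.
Let a0 : 0 < a. Proof. exact: lt_trans hba. Qed.
(** The contraction at beta_0 = [c_beta], the largest of the gains, from which [contraction] covers
    all smaller ones. *)
Let contr : mxnormA A (lazy_mx W c_beta - ones R n *m r^T) <= 1 - c_beta * rhoA.
Proof. by have := hA_contract 0; rewrite power_gain0 => /andP[]. Qed.
Let be_bd k : 0 < be k <= c_beta.
Proof. by rewrite power_gain_gt0//= power_gain_le// ltW. Qed.

Let m_bounds : [/\ 0 < m, m <= 1, m <= 2 * (1 - p), m <= a - b & m <= 2 * b - a].
Proof.
have h1 : m <= 2 * (1 - p) by rewrite /m ge_min lexx.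
have h2 : m <= a - b by rewrite /m !ge_min lexx orbT.
have h3 : m <= 2 * b - a by rewrite /m !ge_min lexx !orbT.
split => //; last first.
  by apply: le_trans h2 _; have := ltW b0; have := ltW ha; lra.
rewrite /m !lt_min subr_gt0 hba mulr_gt0 ?subr_gt0//=.
by apply: lt_trans ha _; move: hb; rewrite ltr_pdivrMr// mulrC.
Qed.

Let mdf i : measurable_fun setT (derive1 (f i)).
Proof. by apply: continuous_measurable_fun; exact: smooth_continuous_derive hL (hf_smooth i). Qed.

(** Nonnegative whatever the sign of [sigma_y]. *)
Let sy := Num.max sigma_y 0.

(** Countably many almost-sure bounds hold simultaneously, so on one event of full measure the
    pathwise estimates apply at all times. *)
Lemma noise_y_bounded :
  {ae P, forall w, forall i k, norm2 (noise_y (N w) i k) <= sy}.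
Proof.
have [_ _ _ _ h] := hnoise.
have : {ae P, forall w, forall j (jn : (j < n)%N) k,
    norm2 (noise_y (N w) (Ordinal jn) k) <= sy}.
  apply: ae_foralln => j; have [jn|nj] := pselect (is_true (j < n)%N); last first.
    by apply: nearW => w jn; have := nj jn.
  have : {ae P, forall w, forall k, norm2 (noise_y (N w) (Ordinal jn) k) <= sy}.
    apply: ae_foralln => k; apply: filterS (h (Ordinal jn) k) => w hw.
    by apply: le_trans hw _; rewrite le_max lexx.
  by apply: filterS => w hw jn' k; rewrite (bool_irrelevance jn' jn).
by apply: filterS => w hw [j jn] k; exact: hw.
Qed.

(** Solves 4 n L^2 dl = mu^2 / 2, the smallness required by [avg_step_le]. *)
Let dl := mu ^+ 2 / (8 * n%:R * L ^+ 2).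
Let dl0 : 0 < dl.
Proof. by rewrite divr_gt0 ?exprn_gt0// mulr_gt0 ?exprn_gt0// mulr_gt0. Qed.

Section with_kappa_bounds.
Variables (CK CD : R) (K0 : nat).
Hypotheses (CD0 : 0 <= CD)
  (kapE : forall e : noise_realization R n,
    (forall i k, norm2 (noise_y e i k) <= sy) ->
    (forall k i, `|kappa_prev (RXi pr e k) i| <= CK) /\
    (forall k, (K0 <= k)%N ->
      let D := \sum_i (kappa_prev (RXi pr e k.+1) i - 1 / (n%:R * r i 0)) ^+ 2 in
      D <= dl /\
      D <= CD * (k.+2%:R `^ (- (2 * (1 - p)))
                 + k.+2%:R `^ (- (2 * (1 - q))) * \sum_l ymart pr r e k.+1 l ^+ 2))).

Let kbd k i : {ae P, forall w, `|kappa_prev (st w k) i| <= CK}.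
Proof. by apply: filterS noise_y_bounded => w /kapE[h _]. Qed.

Let mNy i j l : measurable_fun setT (fun w => noise_y (N w) i j l 0).
Proof.
rewrite [X in measurable_fun _ X](_ : _ = fun w => tnth (ey i j w) l).
  exact: ey_measurable.
by apply/funext => w; rewrite /= mxE.
Qed.

Let xz_L2 k : (forall i, L2 P (fun w => x_ (st w k) i 0)) /\
  (forall i, L2 P (fun w => z_ (st w k) i 0)).
Proof.
have H := @RXi_xz_L2 _ _ _ _ pr (fun w => N w) heps mdf P L CK.
apply: H => //.
- by move=> i; exact: (hf_smooth i).2.
- by move=> i j; have [] := ex_L2 hnoise i j.
- by move=> i j; have [] := ez_L2 hnoise i j.
Qed.

Let x_L2 k i : L2 P (fun w => x_ (st w k) i 0). Proof. by have [] := xz_L2 k. Qed.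
Let z_L2 k i : L2 P (fun w => z_ (st w k) i 0). Proof. by have [] := xz_L2 k. Qed.

(** The state of index k+1 stores the weight kappa_{i,k}, so this is the gradient forcing of step
    k. *)
Definition hvec k w := drive f (x_ (st w k)) (kappa_prev (st w k.+1)).

Let h_L2 k i : L2 P (fun w => hvec k w i 0).
Proof.
apply: (@L2_ext _ _ _ P (fun w => kappa_prev (st w k.+1) i * derive1 (f i) (x_ (st w k) i 0))).
  by move=> w; rewrite mxE.
have H := @L2_kappa_grad _ _ _ _ pr (fun w => N w) heps mdf P L CK.
apply: H => //.
by move=> j; exact: (hf_smooth j).2.
Qed.

Let h_adapted k i : adapted ex ey ez k (fun w => hvec k w i 0).
Proof.
rewrite [X in adapted _ _ _ _ X](_ : _ =
    fun w => kappa_prev (st w k.+1) i * derive1 (f i) (x_ (st w k) i 0)); last first.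
  by apply/funext => w; rewrite mxE.
apply: adaptedM.
  by have [] := @adapted_y _ _ _ _ _ ex ey ez pr heps k i i.
apply: (adapted_comp (X := fun w => x_ (st w k) i 0) (mdf i)).
by have [] := @adapted_xz _ _ _ _ _ ex ey ez pr heps mdf k i.
Qed.

Let x_adapted k i : adapted ex ey ez k (fun w => x_ (st w k) i 0).
Proof. by have [] := @adapted_xz _ _ _ _ _ ex ey ez pr heps mdf k i. Qed.
Let z_adapted k i : adapted ex ey ez k (fun w => z_ (st w k) i 0).
Proof. by have [] := @adapted_xz _ _ _ _ _ ex ey ez pr heps mdf k i. Qed.

Lemma adapted_mulmx k (M : 'M[R]_n) (v : T -> 'cV[R]_n) i :
  (forall j, adapted ex ey ez k (fun w => v w j 0)) ->
  adapted ex ey ez k (fun w => (M *m v w) i 0).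
Proof.
move=> av; rewrite [X in adapted _ _ _ _ X](_ : _ = fun w => \sum_j M i j * v w j 0).
  exact: adapted_sumZ.
by apply/funext => w; rewrite mxE.
Qed.

Definition dist_sqr k := mean P (fun w => (wavg r (x_ (st w k)) - xstar) ^+ 2).
Definition x_cons k := mean P (fun w => sqA A (Qmx r *m x_ (st w k))).
Definition z_cons k := mean P (fun w => sqA A (Qmx r *m z_ (st w k))).
Definition kappa_mse k := mean P (fun w =>
  \sum_i (kappa_prev (st w k.+1) i - 1 / (n%:R * r i 0)) ^+ 2).

Let u_L2 k : L2 P (fun w => wavg r (x_ (st w k)) - xstar).
Proof. by apply: L2B; [exact: L2_wavg|exact: L2_cst]. Qed.

Let xc_L1 k : L1 P (fun w => sqA A (Qmx r *m x_ (st w k))).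
Proof. by apply: L1_sqA => j; exact: L2_mulmx. Qed.
Let zc_L1 k : L1 P (fun w => sqA A (Qmx r *m z_ (st w k))).
Proof. by apply: L1_sqA => j; exact: L2_mulmx. Qed.

Let kappa_L1 k : L1 P (fun w =>
  \sum_i (kappa_prev (st w k.+1) i - 1 / (n%:R * r i 0)) ^+ 2).
Proof.
apply: L1_sum => i.
have : L2 P (fun w => kappa_prev (st w k.+1) i - 1 / (n%:R * r i 0)).
  apply: L2B; last exact: L2_cst.
  apply: (L2_le_ae _ (L2_cst P CK)); last exact: kbd.
  by have [] := @RXi_y_measurable _ _ _ _ pr (fun w => N w) heps k.+1 (fun i j l _ => mNy i j l).
by case.
Qed.

Definition drive_const := CK ^+ 2 * (2 * grad_energy f xstar + 4 * L ^+ 2 * (n%:R + 1)).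

Lemma drive_const_ge0 : 0 <= drive_const.
Proof.
apply: mulr_ge0; first exact: sqr_ge0.
apply: addr_ge0; first by rewrite mulr_ge0// grad_energy_ge0.
by apply: mulr_ge0; [apply: mulr_ge0 => //; exact: sqr_ge0|exact: addr_ge0].
Qed.

Let drive_le w k : (forall i, `|kappa_prev (st w k.+1) i| <= CK) ->
  sqn (hvec k w) <= drive_const *
   (1 + (wavg r (x_ (st w k)) - xstar) ^+ 2 + sqA A (Qmx r *m x_ (st w k))).
Proof.
move=> hk; apply: le_trans (sqn_drive_le r xstar hL hf_smooth _ hk) _.
rewrite /drive_const -[leRHS]mulrA ler_wpM2l ?sqr_ge0//.
set u := (wavg r (x_ (st w k)) - xstar) ^+ 2.
set X := sqA A (Qmx r *m x_ (st w k)).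
have sX := sqn_le_sqA hA_scale (Qmx r *m x_ (st w k)); rewrite -/X in sX.
set S := sqn _ in sX *.
have u0 : 0 <= u by exact: sqr_ge0.
have S0 : 0 <= S by exact: sqn_ge0.
have G0 := grad_energy_ge0 f xstar; set G := grad_energy _ _ in G0 *.
have L20 : 0 <= 4 * L ^+ 2 by rewrite mulr_ge0// sqr_ge0.
set l := 4 * L ^+ 2 in L20 *.
have h1 : l * S <= l * X by rewrite ler_wpM2l.
have h2 : 0 <= G * u by rewrite mulr_ge0.
have h3 : 0 <= G * X by rewrite mulr_ge0// (le_trans S0).
have h4 : 0 <= l * n%:R by rewrite mulr_ge0.
have h5 : 0 <= l * n%:R * X by rewrite mulr_ge0// (le_trans S0).
have h6 : 0 <= l * u by rewrite mulr_ge0.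
have -> : (2 * G + l * (n%:R + 1)) * (1 + u + X) =
  (2 * G + l * (n%:R * u + S)) + (l * X - l * S) + (2 * (G * u) + 2 * (G * X)
     + l * n%:R + l + l * n%:R * X + l * u) by ring.
rewrite -addrA lerDl; apply: addr_ge0; first by rewrite subr_ge0.
have X0 : 0 <= X by exact: sqA_ge0.
by do 5! [apply: addr_ge0 => //]; exact: mulr_ge0.
Qed.

(** The noise of step k is split off by orthogonality before the pathwise inequality is used, so it
    adds only a multiple of be^2. *)
Lemma dist_sqr_step : exists2 C, 0 <= C & exists K, forall k, (K <= k)%N ->
  dist_sqr k.+1 <= (1 - al k * (mu / 2)) * dist_sqr k
     + al k * C * (x_cons k + kappa_mse k) + C * be k ^+ 2.
Proof.
(* These thresholds give al L <= 1 and al mu <= 1/2 at late times. *)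
have e1 : 0 < L^-1 / c_alpha by rewrite divr_gt0 ?invr_gt0.
have e2 : 0 < mu^-1 / 2 / c_alpha by rewrite !divr_gt0 ?invr_gt0.
have [K1 _ hK1] := near_powR_natSN_le a0 e1.
have [K2 _ hK2] := near_powR_natSN_le a0 e2.
pose CX := 2 * n%:R * CK ^+ 2 * L ^+ 2 / mu.
pose CG := 4 * n%:R * grad_energy f xstar / mu.
pose CS := 4 * n%:R * n%:R * sigma.
have CX0 : 0 <= CX.
  apply: divr_ge0; last exact: ltW.
  by rewrite -mulrA -exprMn; apply: mulr_ge0; [exact: mulr_ge0|exact: sqr_ge0].
have CG0 : 0 <= CG.
  apply: divr_ge0; last exact: ltW.
  by apply: mulr_ge0; [exact: mulr_ge0|exact: grad_energy_ge0].
have CS0 : 0 <= CS by rewrite mulr_ge0 ?(ltW hsigma)// mulr_ge0// mulr_ge0.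
exists (CX + CG + CS); first by rewrite !addr_ge0.
exists (K0 + K1 + K2)%N => k Kk.
have kK0 : (K0 <= k)%N by rewrite (leq_trans _ Kk)// -addnA leq_addr.
have kK1 : (K1 <= k)%N by rewrite (leq_trans _ Kk)// addnAC leq_addl.
have kK2 : (K2 <= k)%N by rewrite (leq_trans _ Kk)// leq_addl.
have := hK1 _ kK1; have := hK2 _ kK2; move=> /= h2 h1.
have al0 : 0 < al k by rewrite power_gain_gt0.
have be0 : 0 < be k by rewrite power_gain_gt0.
have alL : al k * L <= 1.
  move: h1; rewrite ler_pdivlMr// -(ler_pM2r hL) mulVf ?gt_eqF//.
  by rewrite power_gainE [c_alpha * _]mulrC.
have alm : al k * mu < 1.
  move: h2; rewrite ler_pdivlMr// -(ler_pM2r hmu).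
  have -> : mu^-1 / 2 * mu = 2^-1 by field; rewrite gt_eqF.
  rewrite power_gainE [c_alpha * _]mulrC => h; apply: le_lt_trans h _.
  by rewrite invf_lt1// ltr1n.
pose Xu w := wavg r (x_ (st w k)) - xstar - al k * wavg r (hvec k w).
have Xu2 : L2 P Xu by apply: L2B => //; apply: L2Z; apply: L2_wavg; exact: h_L2.
have Xua : adapted ex ey ez k Xu.
  rewrite [X in adapted _ _ _ _ X](_ : _ = fun w =>
    (\sum_i r i 0 * x_ (st w k) i 0) + ((- xstar) + \sum_i (- al k * r i 0) * hvec k w i 0)).
    apply: adaptedD; first exact: adapted_sumZ.
    by apply: adaptedD; [exact: adapted_cst|exact: adapted_sumZ].
  apply/funext => w; rewrite /Xu addrA; congr (_ + _).
  by rewrite -mulNr mulr_sumr; apply: eq_bigr => i _; rewrite mulrA.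
have E : dist_sqr k.+1 = mean P (fun w => (Xu w + xz_noise ex ez k
    (fun j => be k * r j 0) (fun j => - be k * r j 0) w) ^+ 2).
  congr mean; apply/funext => w; congr (_ ^+ 2).
  rewrite (avg_next xstar rW (f := f) (N w) k (pr := pr))//; congr (_ + _).
  rewrite /xz_noise /wavg -!mulNr !mulr_sumr; congr (_ + _).
    by apply: eq_bigr => j _; rewrite mxE mulrA.
  by apply: eq_bigr => j _; rewrite mxE mulrA.
rewrite E; apply: le_trans (mean_sqr_adapted_noise hnoise _ _ Xu2 Xua) _.
apply: lerD.
  apply: (@le_trans _ _ (mean P (fun w =>
     (1 - al k * (mu / 2)) * (wavg r (x_ (st w k)) - xstar) ^+ 2
     + al k * (CX * sqA A (Qmx r *m x_ (st w k)) + CG *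
        \sum_i (kappa_prev (st w k.+1) i - 1 / (n%:R * r i 0)) ^+ 2)))).
    apply: mean_le_ae; first by case: Xu2.
      apply: L1D; first by apply: L1Z; case: (u_L2 k).
      by apply: L1Z; apply: L1D; exact: L1Z.
    apply: filterS noise_y_bounded => w /kapE[hk hD].
    have [hdl _] := hD _ kK0.
    apply: (@avg_step_le _ _ r f mu L xstar A n0 r0 rle1 hmu hL hf_convex hf_smooth
      hxstar hA_scale (x_ (st w k)) (kappa_prev (st w k.+1)) CK (hk k.+1) (al k) dl) => //.
      exact: ltW.
    rewrite /dl le_eqVlt; apply/orP; left; apply/eqP; field.
    by rewrite !gt_eqF.
  have u1 : L1 P (fun w => (wavg r (x_ (st w k)) - xstar) ^+ 2) by case: (u_L2 k).
  have i1 : L1 P (fun w => CX * sqA A (Qmx r *m x_ (st w k)) + CG *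
      \sum_i (kappa_prev (st w k.+1) i - 1 / (n%:R * r i 0)) ^+ 2).
    by apply: L1D; exact: L1Z.
  rewrite meanD; [|exact: L1Z|exact: L1Z].
  rewrite (meanZ _ u1) (meanZ _ i1).
  rewrite meanD; [|exact: L1Z|exact: L1Z].
  rewrite !meanZ// lerD2l -mulrA ler_wpM2l ?(ltW al0)//.
  have X0 : 0 <= x_cons k by apply: mean_ge0 => w; exact: sqA_ge0.
  have D0 : 0 <= kappa_mse k.
    by apply: mean_ge0 => w; apply: sumr_ge0 => i _; exact: sqr_ge0.
  rewrite -/(x_cons k) -/(kappa_mse k).
  have -> : (CX + CG + CS) * (x_cons k + kappa_mse k) =
    CX * x_cons k + CG * kappa_mse k +
    (CX * kappa_mse k + CG * x_cons k + CS * (x_cons k + kappa_mse k)) by ring.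
  by rewrite lerDl !addr_ge0// mulr_ge0// addr_ge0.
apply: (@le_trans _ _ (CS * be k ^+ 2)); last first.
  by rewrite ler_wpM2r ?sqr_ge0// lerDr addr_ge0.
have rs s : s ^+ 2 = be k ^+ 2 -> \sum_j (s * r j 0) ^+ 2 <= n%:R * be k ^+ 2.
  move=> sE; have -> : n%:R * be k ^+ 2 = \sum_(j < n) be k ^+ 2.
    by rewrite sumr_const card_ord -[RHS]mulr_natl.
  by apply: ler_sum => j _; rewrite exprMn sE ler_piMr ?sqr_ge0// expr_le1// ltW.
have h3 := rs _ (erefl _); have h4 := rs _ (sqrrN (be k)).
have -> : CS * be k ^+ 2 = 2 * n%:R * (n%:R * be k ^+ 2 + n%:R * be k ^+ 2) * sigma.
  by rewrite /CS; ring.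
by rewrite ler_wpM2r ?(ltW hsigma)// ler_wpM2l ?mulr_ge0// lerD.
Qed.

(** Common to x and z: [y'] is the next iterate, [s] switches the coupling to z on or off, and [t]
    is the gain up to sign. *)
Let consensus_mean_step s t k (y : T -> 'cV[R]_n) (B1 B2 : 'M[R]_n) (y' : T -> 'cV[R]_n) :
  s ^+ 2 <= 1 -> t ^+ 2 = al k ^+ 2 -> (K0 <= k)%N ->
  (forall i, L2 P (fun w => y w i 0)) ->
  (forall i, adapted ex ey ez k (fun w => y w i 0)) ->
  (forall w, Qmx r *m y' w =
    (lazy_mx W (be k) *m (Qmx r *m y w)
     - (s *: (be k *: ((W - 1%:M) *m (Qmx r *m z_ (st w k)))) + t *: (Qmx r *m hvec k w)))
    + (B1 *m \col_i ex i k w + B2 *m \col_i ez i k w)) ->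
  mean P (fun w => sqA A (Qmx r *m y' w)) <=
  (1 - be k * (rhoA / 2)) * mean P (fun w => sqA A (Qmx r *m y w))
  + be k * (6 / rhoA * frob (A *m (W - 1%:M))) * (s ^+ 2 * z_cons k)
  + 6 / rhoA * frob (A *m Qmx r) * drive_const * (al k ^+ 2 / be k)
      * (1 + dist_sqr k + x_cons k)
  + 2 * (frob (A *m B1) + frob (A *m B2)) * sigma.
Proof.
move=> s1 tE kK0 y2 ya yE.
pose M w := lazy_mx W (be k) *m (Qmx r *m y w)
     - (s *: (be k *: ((W - 1%:M) *m (Qmx r *m z_ (st w k)))) + t *: (Qmx r *m hvec k w)).
pose M1 := lazy_mx W (be k) *m Qmx r.
pose M2 := - (s * be k) *: ((W - 1%:M) *m Qmx r).
pose M3 := - t *: Qmx r.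
have ME w : M w = M1 *m y w + (M2 *m z_ (st w k) + M3 *m hvec k w).
  by rewrite /M /M1 /M2 /M3 -!scalemxAl -!mulmxA opprD !scaleNr scalerA.
have M_L2 i : L2 P (fun w => M w i 0).
  apply: (@L2_ext _ _ _ P (fun w => (M1 *m y w) i 0 +
    ((M2 *m z_ (st w k)) i 0 + (M3 *m hvec k w) i 0))).
    by move=> w; rewrite ME [RHS]mxE [X in _ = _ + X]mxE.
  apply: L2D; first exact: L2_mulmx.
  apply: L2D; apply: L2_mulmx; [exact: z_L2|exact: h_L2].
have M_ad i : adapted ex ey ez k (fun w => M w i 0).
  rewrite [X in adapted _ _ _ _ X](_ : _ = fun w => (M1 *m y w) i 0 +
    ((M2 *m z_ (st w k)) i 0 + (M3 *m hvec k w) i 0)).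
    apply: adaptedD; first exact: adapted_mulmx.
    by apply: adaptedD; apply: adapted_mulmx; [exact: z_adapted|exact: h_adapted].
  by apply/funext => w; rewrite ME [LHS]mxE [X in _ + X = _]mxE.
have -> : (fun w => sqA A (Qmx r *m y' w)) = (fun w => sqA A (M w +
   (B1 *m \col_i ex i k w + B2 *m \col_i ez i k w))).
  by apply/funext => w; rewrite yE.
apply: le_trans (mean_sqA_adapted_noise hnoise A B1 B2 M_L2 M_ad) _.
rewrite lerD2r.
have yc1 : L1 P (fun w => sqA A (Qmx r *m y w)).
  by apply: L1_sqA => j; exact: L2_mulmx.
set F1 := be k * (6 / rhoA * frob (A *m (W - 1%:M))); set F2 := 6 / rhoA * frob (A *m Qmx r).
have be0 : 0 < be k by rewrite power_gain_gt0.
have F20 : 0 <= F2 by rewrite mulr_ge0 ?frob_ge0// divr_ge0// ltW.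
have ab0 : 0 <= al k ^+ 2 / be k by rewrite divr_ge0 ?sqr_ge0// ltW.
have one1 : L1 P (fun=> 1) by exact: L1_cst.
have u1 : L1 P (fun w => (wavg r (x_ (st w k)) - xstar) ^+ 2) by case: (u_L2 k).
apply: (@le_trans _ _ (mean P (fun w =>
   (1 - be k * (rhoA / 2)) * sqA A (Qmx r *m y w)
  + F1 * (s ^+ 2 * sqA A (Qmx r *m z_ (st w k)))
  + F2 * drive_const * (al k ^+ 2 / be k)
      * (1 + (wavg r (x_ (st w k)) - xstar) ^+ 2 + sqA A (Qmx r *m x_ (st w k)))))).
  apply: mean_le_ae; first exact: L1_sqA.
    apply: L1D; first by apply: L1D; apply: L1Z => //; exact: L1Z.
    by apply: L1Z; apply: L1D => //; exact: L1D.
  apply: filterS noise_y_bounded => w /kapE[hk _].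
  apply: le_trans (consensus_step_le r1 hA cb0 hrhoA contr hA_scale (y w)
    (z_ (st w k)) (hvec k w) t (be_bd k) s1) _.
  rewrite lerD2l tE -/F2.
  set S := 1 + (wavg r (x_ (st w k)) - xstar) ^+ 2 + sqA A (Qmx r *m x_ (st w k)).
  have -> : F2 * drive_const * (al k ^+ 2 / be k) * S =
    F2 * (al k ^+ 2 / be k) * (drive_const * S) by ring.
  apply: ler_wpM2l; first exact: mulr_ge0.
  exact: (drive_le (fun i => hk k.+1 i)).
rewrite meanD; [|by apply: L1D; apply: L1Z => //; exact: L1Z
                |by apply: L1Z; apply: L1D => //; exact: L1D].
rewrite meanD; [|exact: L1Z|by apply: L1Z; exact: L1Z].
rewrite !meanZ//; [|by apply: L1D => //; exact: L1D|exact: L1Z].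
rewrite meanD//; last exact: L1D.
by rewrite meanD// mean_cst.
Qed.

Lemma x_cons_step : exists2 C, 0 <= C & forall k, (K0 <= k)%N ->
  x_cons k.+1 <= (1 - be k * (rhoA / 2)) * x_cons k + be k * C * z_cons k
    + C * (al k ^+ 2 / be k) * (1 + dist_sqr k + x_cons k) + C * be k ^+ 2.
Proof.
pose C1 := 6 / rhoA * frob (A *m (W - 1%:M)).
pose C2 := 6 / rhoA * frob (A *m Qmx r) * drive_const.
pose C3 := 4 * frob (A *m Qmx r) * sigma.
have r60 : 0 <= 6 / rhoA by rewrite divr_ge0// ltW.
have C10 : 0 <= C1 by rewrite mulr_ge0// frob_ge0.
have C20 : 0 <= C2 by rewrite mulr_ge0 ?drive_const_ge0// mulr_ge0// frob_ge0.
have C30 : 0 <= C3 by rewrite mulr_ge0 ?(ltW hsigma)// mulr_ge0// frob_ge0.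
exists (C1 + C2 + C3); first by rewrite !addr_ge0.
move=> k kK0.
have be0 : 0 < be k by rewrite power_gain_gt0.
have := @consensus_mean_step 1 (al k) k (fun w => x_ (st w k)) (be k *: Qmx r)
  (- be k *: Qmx r) (fun w => x_ (st w k.+1)).
rewrite !expr1n lexx => /(_ isT erefl kK0 (x_L2 k) (@x_adapted k)) h.
have {}h := h (fun w => xc_next W1 rW (pr := pr) (f := f) (N w) k erefl erefl).
apply: le_trans h _; rewrite -/(x_cons k) mul1r -/C1 -/C2.
rewrite -!scalemxAr !frobZ sqrrN.
have Z0 : 0 <= z_cons k by apply: mean_ge0 => w; exact: sqA_ge0.
have X0 : 0 <= x_cons k by apply: mean_ge0 => w; exact: sqA_ge0.
have U0 : 0 <= dist_sqr k by apply: mean_ge0 => w; exact: sqr_ge0.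
have ab0 : 0 <= al k ^+ 2 / be k by rewrite divr_ge0 ?sqr_ge0// ltW.
set S := 1 + _ + _; have S0 : 0 <= S by rewrite !addr_ge0.
have bZ0 : 0 <= be k * z_cons k by rewrite mulr_ge0// ltW.
have gS0 : 0 <= al k ^+ 2 / be k * S by rewrite mulr_ge0.
have b20 : 0 <= be k ^+ 2 by exact: sqr_ge0.
apply: lerD; first (apply: lerD; first (rewrite lerD2l)).
- have -> : be k * (C1 + C2 + C3) * z_cons k = be k * C1 * z_cons k + (C2 + C3) * (be k * z_cons k).
    by ring.
  by rewrite lerDl mulr_ge0// addr_ge0.
- rewrite -[leLHS]mulrA -[leRHS]mulrA ler_wpM2r// addrAC lerDr addr_ge0//.
- have -> : 2 * (be k ^+ 2 * frob (A *m Qmx r) + be k ^+ 2 * frob (A *m Qmx r)) * sigma =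
    C3 * be k ^+ 2 by rewrite /C3; ring.
  by rewrite ler_wpM2r// lerDr addr_ge0.
Qed.

Lemma z_cons_step : exists2 C, 0 <= C & forall k, (K0 <= k)%N ->
  z_cons k.+1 <= (1 - be k * (rhoA / 2)) * z_cons k
    + C * (al k ^+ 2 / be k) * (1 + dist_sqr k + x_cons k) + C * be k ^+ 2.
Proof.
pose C2 := 6 / rhoA * frob (A *m Qmx r) * drive_const.
pose C3 := 2 * frob (A *m Qmx r) * sigma.
have r60 : 0 <= 6 / rhoA by rewrite divr_ge0// ltW.
have C20 : 0 <= C2 by rewrite mulr_ge0 ?drive_const_ge0// mulr_ge0// frob_ge0.
have C30 : 0 <= C3 by rewrite mulr_ge0 ?(ltW hsigma)// mulr_ge0// frob_ge0.
exists (C2 + C3); first by rewrite !addr_ge0.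
move=> k kK0.
have be0 : 0 < be k by rewrite power_gain_gt0.
(* The sign of al is reversed because the common form subtracts the drive while the z-update adds
   it. *)
have := @consensus_mean_step 0 (- al k) k (fun w => z_ (st w k)) 0
  (be k *: Qmx r) (fun w => z_ (st w k.+1)).
have z2 : (0 : R) ^+ 2 = 0 by rewrite expr0n.
rewrite z2 sqrrN ler01 => /(_ isT erefl kK0 (z_L2 k) (@z_adapted k)) h.
have {}h := h (fun w => _).
apply: le_trans (h _) _.
  move=> w; rewrite scale0r add0r scaleNr opprK.
  exact: (zc_next W1 rW (pr := pr) (f := f) (N w) k erefl erefl).
rewrite -/(z_cons k) mul0r mulr0 addr0 -/C2.
have f0 : frob (A *m 0 : 'M[R]_n) = 0.
  by rewrite mulmx0 -[X in frob X](scale0r 0) frobZ expr0n mul0r.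
rewrite f0 add0r -!scalemxAr !frobZ.
have X0 : 0 <= x_cons k by apply: mean_ge0 => w; exact: sqA_ge0.
have U0 : 0 <= dist_sqr k by apply: mean_ge0 => w; exact: sqr_ge0.
have ab0 : 0 <= al k ^+ 2 / be k by rewrite divr_ge0 ?sqr_ge0// ltW.
set S := 1 + _ + _; have S0 : 0 <= S by rewrite !addr_ge0.
have gS0 : 0 <= al k ^+ 2 / be k * S by rewrite mulr_ge0.
have b20 : 0 <= be k ^+ 2 by exact: sqr_ge0.
apply: lerD; first (rewrite lerD2l).
- by rewrite -[leLHS]mulrA -[leRHS]mulrA ler_wpM2r// lerDl.
- have -> : 2 * (be k ^+ 2 * frob (A *m Qmx r)) * sigma = C3 * be k ^+ 2.
    by rewrite /C3; ring.
  by rewrite ler_wpM2r// lerDr.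
Qed.

(** Here the martingale is averaged; its pathwise bound would only give the rate k^(-2(p-q)). *)
Lemma kappa_mse_le : exists2 C, 0 <= C & forall k, (K0 <= k)%N ->
  kappa_mse k <= C * k.+1%:R `^ (- m).
Proof.
have [m0 m1 mp mab mba] := m_bounds.
(* [e] is such that k^e / k^(2 (1 - q)) = k^-m; moreover 2 p >= 1 - e because
   q < p and m <= 1. *)
pose e := 2 * (1 - q) - m.
have e0 : 0 < e by rewrite /e subr_gt0; apply: le_lt_trans mp _; rewrite ltr_pM2l// ltrD2l ltrN2.
pose CS := n%:R ^+ 2 * sigma * (c_lambda ^+ 2 * ((1 + e) / e)).
have cl0 : 0 < c_lambda by case/andP: hc_lambda.
have CS0 : 0 <= CS.
  apply: mulr_ge0; first by rewrite mulr_ge0 ?sqr_ge0// ltW.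
  by apply: mulr_ge0; [exact: sqr_ge0|rewrite divr_ge0 ?(ltW e0)// addr_ge0// ltW].
have mart k l : mean P (fun w => ymart pr r (N w) k.+1 l ^+ 2) <= CS * k.+2%:R `^ e.
  apply: le_trans (ymart_var hnoise pr (fun i => ltW (r0 i)) rle1 (ltW hsigma) k.+1 l) _.
  rewrite /CS -[leRHS]mulrA ler_wpM2l ?mulr_ge0 ?sqr_ge0 ?(ltW hsigma)//.
  rewrite -[leRHS]mulrA.
  apply: (@le_trans _ _ (c_lambda ^+ 2 * \sum_(j < k.+1) j.+1%:R `^ (e - 1))).
    rewrite mulr_sumr; apply: ler_sum => j _.
    rewrite /= power_gainE exprMn ler_wpM2l ?sqr_ge0//.
    rewrite -powR_mulrn ?powR_ge0// -powRrM ler_powR ?ler1n// /e.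
    by move: hqp m1; lra.
  rewrite ler_wpM2l ?sqr_ge0//; apply: le_trans (sum_powR_le _ e0) _.
  rewrite ler_wpM2l//; first by rewrite divr_ge0 ?(ltW e0)// addr_ge0// ltW.
  by apply: ge0_ler_powR; rewrite ?nnegrE ?ler0n ?(ltW e0)// ler_nat.
have S1 k : L1 P (fun w => \sum_l ymart pr r (N w) k.+1 l ^+ 2).
  by apply: L1_sum => l; case: (ymart_L2 hnoise pr r k.+1 l).
exists (CD * (1 + n%:R * CS)).
  by rewrite mulr_ge0// addr_ge0// mulr_ge0.
move=> k kK0.
have leM : k.+2%:R `^ (- m) <= k.+1%:R `^ (- m) :> R.
  rewrite !powRN lef_pV2 ?posrE ?powR_natS_gt0//.
  by apply: ge0_ler_powR; rewrite ?nnegrE ?ler0n ?(ltW m0)// ler_nat.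
set A1 := k.+2%:R `^ (- (2 * (1 - p))) : R.
set A2 := k.+2%:R `^ (- (2 * (1 - q))) : R.
apply: (@le_trans _ _ (mean P (fun w => CD * (A1 + A2 *
    \sum_l ymart pr r (N w) k.+1 l ^+ 2)))).
  apply: mean_le_ae => //.
    by apply: L1Z; apply: L1D; [exact: L1_cst|exact: L1Z].
  by apply: filterS noise_y_bounded => w /kapE[_ /(_ _ kK0)[]].
rewrite meanZ; last by apply: L1D; [exact: L1_cst|exact: L1Z].
rewrite meanD; [|exact: L1_cst|exact: L1Z].
rewrite mean_cst meanZ// -mulrA ler_wpM2l//.
rewrite mean_sum; last by move=> l; case: (ymart_L2 hnoise pr r k.+1 l).
apply: (@le_trans _ _ ((1 + n%:R * CS) * k.+2%:R `^ (- m))); last first.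
  by rewrite ler_wpM2l// addr_ge0// mulr_ge0.
rewrite mulrDl mul1r; apply: lerD.
  by rewrite /A1 ler_powR ?ler1n// lerN2.
have -> : n%:R * CS * k.+2%:R `^ (- m) = A2 * (n%:R * (CS * k.+2%:R `^ e)).
  have -> : k.+2%:R `^ (- m) = A2 * k.+2%:R `^ e :> R.
    by rewrite /A2 -natS_powRD; congr (_ `^ _); rewrite /e; ring.
  by ring.
rewrite ler_wpM2l ?powR_ge0//.
have -> : n%:R * (CS * k.+2%:R `^ e) = \sum_(l < n) CS * k.+2%:R `^ e.
  by rewrite sumr_const card_ord -[RHS]mulr_natl.
by apply: ler_sum => l _; exact: mart.
Qed.

Lemma iterates_L1 k :
  [/\ L1 P (fun w => (wavg r (x_ (st w k)) - xstar) ^+ 2),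
      L1 P (fun w => sqA A (Qmx r *m x_ (st w k))),
      L1 P (fun w => sqA A (Qmx r *m z_ (st w k)))
    & forall i, measurable_fun setT (fun w => x_ (st w k) i 0)].
Proof. by split => //; [case: (u_L2 k)|move=> i; case: (x_L2 k i)]. Qed.

End with_kappa_bounds.

Lemma mean_rates : exists B, exists K, forall k, (K <= k)%N ->
  [/\ L1 P (fun w => (wavg r (x_ (st w k)) - xstar) ^+ 2),
      L1 P (fun w => sqA A (Qmx r *m x_ (st w k))),
      L1 P (fun w => sqA A (Qmx r *m z_ (st w k))),
      forall i, measurable_fun setT (fun w => x_ (st w k) i 0)
    & [/\ dist_sqr k <= B * k.+1%:R `^ (- m), x_cons k <= B * k.+1%:R `^ (- m)
        & z_cons k <= B * k.+1%:R `^ (- m)]].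
Proof.
have sy0 : 0 <= sy by rewrite le_max lexx orbT.
have [CK [CD [K0 [CD0 kapE]]]] := @kappa_estimate _ _ pr r A rhoA c_beta
  c_lambda c_gamma p q sy W0 W1 rW r0 r1 hA cb0 hrhoA contr hA_scale erefl erefl
  hc_lambda hc_gamma hq hqp hp sy0 heps dl dl0.
have [C1 C10 [K1 s1]] := dist_sqr_step kapE.
have [C2 C20 s2] := x_cons_step kapE.
have [C3 C30 s3] := z_cons_step kapE.
have [C4 C40 s4] := kappa_mse_le CD0 kapE.
have [m0 m1 mp mab mba] := m_bounds.
pose C := C1 + C2 + C3 + C4.
have C0 : 0 <= C by rewrite !addr_ge0.
have U0 k : 0 <= dist_sqr k by apply: mean_ge0 => w; exact: sqr_ge0.
have X0 k : 0 <= x_cons k by apply: mean_ge0 => w; exact: sqA_ge0.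
have Z0 k : 0 <= z_cons k by apply: mean_ge0 => w; exact: sqA_ge0.
have D0 k : 0 <= kappa_mse k.
  by apply: mean_ge0 => w; apply: sumr_ge0 => i _; exact: sqr_ge0.
have C1C : C1 <= C by rewrite /C -!addrA lerDl !addr_ge0.
have C2C : C2 <= C by rewrite /C -!addrA addrCA lerDl !addr_ge0.
have C3C : C3 <= C by rewrite /C addrAC lerDr !addr_ge0.
have C4C : C4 <= C by rewrite /C lerDr !addr_ge0.
have al0 k : 0 <= al k by rewrite power_gain_ge0// ltW.
have be0 k : 0 <= be k by rewrite power_gain_ge0// ltW.
have g0 k : 0 <= al k ^+ 2 / be k by rewrite divr_ge0 ?sqr_ge0.
have S0 k : 0 <= 1 + dist_sqr k + x_cons k by rewrite !addr_ge0.
have [B [K' hB]] : exists B, exists K', forall k, (K' <= k)%N ->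
    [/\ dist_sqr k <= B * k.+1%:R `^ (- m), x_cons k <= B * k.+1%:R `^ (- m)
      & z_cons k <= B * k.+1%:R `^ (- m)].
  apply: (@coupled_recursion _ dist_sqr x_cons z_cons kappa_mse (K0 + K1)%N
    c_alpha c_beta a b m (mu / 2) (rhoA / 2) C) => //.
  - by rewrite (ltW m0).
  - by rewrite divr_gt0.
  - by rewrite divr_gt0.
  - move=> k Kk; have kK : (K0 <= k)%N by rewrite (leq_trans _ Kk)// leq_addr.
    by apply: le_trans (s4 k kK) _; rewrite ler_wpM2r ?powR_ge0.
  - move=> k Kk; have kK : (K1 <= k)%N by rewrite (leq_trans _ Kk)// leq_addl.
    apply: le_trans (s1 k kK) _; apply: lerD; last by rewrite ler_wpM2r ?sqr_ge0.
    by rewrite lerD2l ler_wpM2r ?addr_ge0// ler_wpM2l.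
  - move=> k Kk; have kK : (K0 <= k)%N by rewrite (leq_trans _ Kk)// leq_addr.
    apply: le_trans (s2 k kK) _; apply: lerD; last by rewrite ler_wpM2r ?sqr_ge0.
    apply: lerD; last by rewrite ler_wpM2r// ler_wpM2r.
    by rewrite lerD2l ler_wpM2r// ler_wpM2l.
  - move=> k Kk; have kK : (K0 <= k)%N by rewrite (leq_trans _ Kk)// leq_addr.
    apply: le_trans (s3 k kK) _; apply: lerD; last by rewrite ler_wpM2r ?sqr_ge0.
    by rewrite lerD2l ler_wpM2r// ler_wpM2r.
by exists B, K' => k Kk; have [] := iterates_L1 kapE k; split => //; exact: hB.
Qed.

End mean_recursions.

(** Integrability makes the extended expectation finite, so a bound on [mean] becomes a bound in the
    extended reals. *)
Lemma ebigO_mean d (T : measurableType d) (R : realType) (P : probability T R)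
    (g : nat -> T -> R) (s : R) (B : R) K :
  (forall k, (K <= k)%N -> L1 P (g k)) -> (forall k w, 0 <= g k w) ->
  (forall k, (K <= k)%N -> mean P (g k) <= B * k.+1%:R `^ s) ->
  ebigO (fun k => 'E_P[g k]%E) (fun k => k.+1%:R `^ s).
Proof.
move=> g1 g0 gB; exists B; exists K => // k /= Kk.
rewrite (expectation_mean (g1 k Kk)) abse_EFin lee_fin.
by rewrite !ger0_norm ?powR_ge0 ?mean_ge0// gB.
Qed.

Theorem theorem2 (R : realType) (d : measure_display) (T : measurableType d)
    (P : probability T R) (n : nat)
    (* network *)
    (edge : rel 'I_n) (W : 'M[R]_n) (r : 'cV[R]_n)
    (hW : weight_mx edge W) (hr : left_perron W r)
    (* objectives *)
    (f : 'I_n -> R -> R) (mu L xstar : R)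
    (hmu : 0 < mu) (hL : 0 < L)
    (hf_convex : forall i, strongly_convex mu (f i))
    (hf_smooth : forall i, smooth L (f i))
    (hxstar : forall x, mean_objective f xstar <= mean_objective f x)
    (* noise *)
    (sigma sigma_y : R) (hsigma : 0 < sigma)
    (ex : 'I_n -> nat -> {RV P >-> R})
    (ey : 'I_n -> nat -> {RV P >-> n.-tuple R})
    (ez : 'I_n -> nat -> {RV P >-> R})
    (hnoise : noise_assumption sigma sigma_y ex ey ez)
    (* gains *)
    (c_lambda c_gamma c_alpha c_beta p q a b : R)
    (hc_lambda : 0 < c_lambda <= 1) (hc_beta : 0 < c_beta <= 1)
    (hc_gamma : 0 < c_gamma) (hc_alpha : 0 < c_alpha)
    (hq : 0 < q) (hqp : q < p) (hp : p < 1)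
    (hb : 1 / 2 < b) (hba : b < a) (ha : a < 1)
    (hap : 2 * p - 1 < a) (hab : 1 < 2 * a - b)
    (* threshold and initial values *)
    (eps : R) (heps : 0 < eps) (x0 z0 : 'cV[R]_n)
    (* the norm *)
    (A : 'M[R]_n) (rhoA : R)
    (hA : A \in unitmx) (hrhoA : 0 < rhoA)
    (hA_contract : forall k : nat,
       mxnormA A (lazy_mx W (power_gain c_beta b k) - ones R n *m r^T)
         <= 1 - power_gain c_beta b k * rhoA < 1)
    (hA_scale : forall v : 'cV[R]_n, norm2 v <= normA A v) :
  let param := {| weights := W; objective := f;
                  lambda := power_gain c_lambda p;
                  gamma := power_gain c_gamma q;
                  alpha := power_gain c_alpha a;
                  beta := power_gain c_beta b;
                  eps_kappa := eps; x_init := x0; z_init := z0 |} in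
  let x k w := x_ (RXi param (noise_at ex ey ez w) k) in
  let z k w := z_ (RXi param (noise_at ex ey ez w) k) in
  let F := mean_objective f in
  let m : R := Num.min (2 * (1 - p)) (Num.min (a - b) (2 * b - a)) in
  let rate (k : nat) : R := k.+1%:R `^ (- m) in
  let optimality_gap k w := F (wavg r (x k w)) - F xstar in
  let consensus_error (v : 'cV[R]_n) := v - wavg r v *: ones R n in
  [/\ ebigO (fun k => 'E_P[optimality_gap k]%E) rate,
      ebigO (fun k => 'E_P[fun w => (normA A (consensus_error (x k w)) ^+ 2)%R]%E)
            rate
    & ebigO (fun k => 'E_P[fun w => (normA A (consensus_error (z k w)) ^+ 2)%R]%E)
            rate].
Proof.
move=> param x z F m rate optimality_gap consensus_error.
have [B [K hB]] := @mean_rates R d T P n edge W r f mu L xstar sigma sigma_y ex ey ez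
  c_lambda c_gamma c_alpha c_beta p q a b eps x0 z0 A rhoA hW hr hmu hL hf_convex
  hf_smooth hxstar hsigma hnoise hc_lambda hc_beta hc_gamma hc_alpha hq hqp hp hb hba
  ha heps hA hrhoA hA_contract hA_scale.
have n0 : (0 < n)%N.
  by have [_ _ r1] := hr; exact: sum_ord_eq1_gt0 r1.
have consE v : normA A (consensus_error v) ^+ 2 = sqA A (Qmx r *m v).
  by rewrite /normA norm2_sqr /consensus_error -Qmx_mul.
split.
- have gap0 k w : 0 <= optimality_gap k w by rewrite subr_ge0.
  (* This domination yields both the integrability of the gap and its rate. *)
  have gapL k w : optimality_gap k w <= L * (wavg r (x k w) - xstar) ^+ 2.
    exact: mean_objective_gap.
  have gap1 k : (K <= k)%N -> L1 P (optimality_gap k).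
    move=> /hB[u1 _ _ mx _].
    apply: (L1_le _ (L1Z L u1)) => [|w]; last by rewrite ger0_norm.
    apply: measurable_funB => //; apply: measurable_fun_Zl.
    apply: measurable_fun_sumR => i.
    apply: (measurableT_comp (f := f i)); last first.
      by apply: measurable_fun_sumR => j; exact: measurable_fun_Zl.
    by apply: continuous_measurable_fun; exact: smooth_continuous (hf_smooth i).
  apply: (@ebigO_mean _ _ _ _ _ _ (L * B) K) => // k Kk.
  have [u1 _ _ _ [uB _ _]] := hB k Kk.
  apply: le_trans (mean_le (gap1 k Kk) (L1Z L u1) (gapL k)) _.
  by rewrite meanZ// -mulrA ler_wpM2l// ltW.
- under eq_fun do under eq_fun do rewrite consE.
  apply: (@ebigO_mean _ _ _ _ _ _ B K) => [k /hB[_ h _ _ _]|k w|k /hB[_ _ _ _ [_ h _]]] //.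
  exact: sqA_ge0.
- under eq_fun do under eq_fun do rewrite consE.
  apply: (@ebigO_mean _ _ _ _ _ _ B K) => [k /hB[_ _ h _ _]|k w|k /hB[_ _ _ _ [_ _ h]]] //.
  exact: sqA_ge0.
Qed.
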